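(* The function $d_{KB}$ defined by $$d_{KB}^2(G_0,G_1)=\inf_{(G,\mathfrak U)\in\mathcal A(G_0,G_1)}\|\mathfrak U\|^2_{L^2(0,1;L^2(\mathrm dG_t))},\qquad G_0,G_1\in\mathbb P^+,$$ is a distance on $\mathbb P^+$ (in particular it is finite-valued).
   Context: Fix $d\ge 1$. $\mathcal S$ is the space of symmetric real $d\times d$ matrices, $\mathcal P^+\subset\mathcal S$ the positive-semidefinite ones, $A:B=\mathrm{Tr}(AB^\top)$, $A^{Sym}=\frac12(A+A^\top)$. $\mathbb P^+$ is the set of $\mathcal P^+$-valued Radon measures $G$ on $\mathbb R^d$ with finite mass $m(G)=\mathrm{Tr}\,G(\mathbb R^d)$. For a matrix measure $G=g\,\mu$ with $\mu=\mathrm{Tr}\,G$, and vector fields $u,v$ and matrix fields $U,V$, write $\int \mathrm dG\,u\cdot v=\int gu\cdot v\,\mathrm d\mu$, $\int \mathrm dG\,U:V=\int (gU):V\,\mathrm d\mu$. $\mathcal C_w([0,1];\mathbb P^+)$ is the set of curves $t\mapsto G_t\in\mathbb P^+$ continuous for narrow convergence (convergence of $\int\phi\,\mathrm dG$ for all bounded continuous scalar $\phi$). For $G\in\mathcal C_w([0,1];\mathbb P^+)$, $L^2(0,1;L^2(\mathrm dG_t))$ is the Hilbert space obtained from $\mathcal C^1_b([0,1]\times\mathbb R^d;\mathcal S\times\mathbb R^d)$ ($\mathcal C^1$, bounded with bounded first derivatives) by quotienting by the kernel of, and completing with respect to, the seminorm $$\|\mathfrak U\|^2_{L^2(0,1;L^2(\mathrm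 dG_t))}=\int_0^1\Big(\int_{\mathbb R^d}\mathrm dG_t\,u_t\cdot u_t+\int_{\mathbb R^d}\mathrm dG_t\,U_t:U_t\Big)\mathrm dt,\qquad \mathfrak U=(U,u).$$ Its elements are rendered as pairs $\mathfrak U=(U,u)$ of an $\mathcal S$-valued and an $\mathbb R^d$-valued square-integrable field. The pair $(G_t,\mathfrak U_t)_{t\in[0,1]}$, $\mathfrak U_t=(U_t,u_t)$, belongs to the admissible set $\mathcal A(G_0,G_1)$ if $G\in\mathcal C_w([0,1];\mathbb P^+)$, $G|_{t=0}=G_0$, $G|_{t=1}=G_1$, $\mathfrak U\in L^2(0,1;L^2(\mathrm dG_t))$, and $\partial_tG_t=\{-\nabla(G_tu_t)+G_tU_t\}^{Sym}$ in the weak sense, i.e. $$\int_{\mathbb R^d}\Phi_t:\mathrm dG_t-\int_{\mathbb R^d}\Phi_s:\mathrm dG_s-\int_s^t\int_{\mathbb R^d}\mathrm dG_\tau:\partial_\tau\Phi_\tau\,\mathrm d\tau=\int_s^t\int_{\mathbb R^d}(\mathrm dG_\tau u_\tau\cdot\operatorname{div}\Phi_\tau+\mathrm dG_\tau U_\tau:\Phi_\tau)\,\mathrm d\tau$$ for all $\Phi\in\mathcal C^1_b([0,1]\times\mathbb R^d;\mathcal S)$ and $t,s\in[0,1]$ ($\operatorname{div}$ is the row-wise divergence). *)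

(* Defs.v *)
From HB Require Import structures.
From mathcomp Require Import all_boot all_order all_algebra.
From mathcomp Require Import all_classical all_reals all_analysis.

Set Implicit Arguments.
Unset Strict Implicit.
Unset Printing Implicit Defensive.

Import Order.TTheory GRing.Theory Num.Theory.
Import numFieldNormedType.Exports.

Local Open Scope classical_set_scope.
Local Open Scope ring_scope.

Notation borel_space R d := (g_sigma_algebraType (@open 'cV[R]_d)).

Section MatrixAlgebra.
Context (R : realType) (d : nat).

Definition dotv (u v : 'cV[R]_d) : R := (u^T *m v) 0 0.

Definition frob (A B : 'M[R]_d) : R := \tr (A *m B^T).

Definition sym_mx (A : 'M[R]_d) : Prop := A^T = A.

Definition psd_mx (A : 'M[R]_d) : Prop :=
  sym_mx A /\ forall v : 'cV[R]_d, 0 <= dotv (A *m v) v.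

End MatrixAlgebra.

(* A finite Borel measure on R^d is automatically Radon, and a matrix of
   (finite) charges automatically has finite mass. *)
Record psd_measure (R : realType) (d : nat) := PsdMeasure {
  pm_entry :> 'I_d -> 'I_d -> {charge set (borel_space R d) -> \bar R} ;
  pm_psd : forall A : set (borel_space R d), measurable A ->
    psd_mx (\matrix_(i, j) fine (pm_entry i j A)) }.

(* Charges are functions on all sets, only whose values on measurable sets
   are meaningful. *)
Definition pm_eq (R : realType) (d : nat) (G H : psd_measure R d) : Prop :=
  forall (i j : 'I_d) (A : set (borel_space R d)),
    measurable A -> G i j A = H i j A.

Section TraceMeasure.
Context (R : realType) (d : nat) (G : psd_measure R d).
Local Open Scope ereal_scope.

Lemma pm_entryE (i j : 'I_d) (A : set (borel_space R d)) :
  measurable A -> (fine (G i j A))%:E = G i j A.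
Proof. by move=> mA; rewrite fineK// fin_num_measure. Qed.

Lemma pm_diag_ge0 (i : 'I_d) (A : set (borel_space R d)) :
  measurable A -> 0 <= G i i A.
Proof.
move=> mA; have [_ /(_ (delta_mx i 0%R))] := pm_psd G mA.
rewrite /dotv -colE !mxE (bigD1 i)//= big1 ?addr0 => [|j /negbTE ji].
  by rewrite !mxE eqxx/= mulr1 => h; rewrite -pm_entryE// lee_fin.
by rewrite !mxE ji/= mulr0.
Qed.

(* The value 0 on nonmeasurable sets is there because a measure has to be
   nonnegative on every set. *)
Definition trace_measure (A : set (borel_space R d)) : \bar R :=
  if `[< measurable A >] then \sum_(i < d) G i i A else 0.

Lemma trace_measureE (A : set (borel_space R d)) :
  measurable A -> trace_measure A = \sum_(i < d) G i i A.
Proof. by move=> mA; rewrite /trace_measure asboolT. Qed.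

Let trace0 : trace_measure set0 = 0.
Proof. by rewrite trace_measureE// big1// => i _; rewrite charge0. Qed.

Let trace_ge0 A : 0 <= trace_measure A.
Proof.
rewrite /trace_measure; case: asboolP => // mA.
by apply: sume_ge0 => i _; exact: pm_diag_ge0.
Qed.

Let trace_sigma_additive : semi_sigma_additive trace_measure.
Proof.
move=> F mF tF mUF; rewrite trace_measureE//.
rewrite (_ : (fun n => _) =
    (fun n => \sum_(i < d) \sum_(0 <= k < n) G i i (F k))); last first.
  apply/funext => n; rewrite exchange_big/=; apply: eq_bigr => k _.
  by rewrite trace_measureE.
apply: cvg_nnesum => i _.
  by apply: nearW => n; apply: sume_ge0 => k _; exact: pm_diag_ge0.
exact: charge_semi_sigma_additive.
Qed.

HB.instance Definition _ := isMeasure.Build _ _ _ trace_measure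
  trace0 trace_ge0 trace_sigma_additive.

Let trace_fin : fin_num_fun trace_measure.
Proof.
move=> A mA; rewrite trace_measureE//.
by apply/sum_fin_numP => i _ _; exact: fin_num_measure.
Qed.

HB.instance Definition _ := @Measure_isFinite.Build _ _ _ trace_measure
  trace_fin.

End TraceMeasure.

Section Integrals.
Context (R : realType) (d : nat).
Implicit Types G : psd_measure R d.

Local Open Scope charge_scope.

(* The density g in G = g mu with mu = Tr G. The Radon-Nikodym derivatives are
   not junk by [dominated_trace]; g is determined mu-almost everywhere. *)
Definition density G (x : borel_space R d) : 'M[R]_d :=
  \matrix_(i, j) fine (('d (G i j) '/d (trace_measure G)) x).

Lemma dominated_trace G (i j : 'I_d) : G i j `<< trace_measure G.
Proof.
move=> A A0 B mB BA.
have GB k : G k k B = 0%E.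
  have /eqP := A0 B mB BA; rewrite trace_measureE//.
  rewrite seq_psume_eq0 => [/allP/(_ k)|l _]; last exact: pm_diag_ge0.
  by rewrite mem_index_enum => /(_ isT)/eqP.
set M := \matrix_(i, j) fine (G i j B).
have [sM pM] : psd_mx M := pm_psd G mB.
have Mkk k : M k k = 0 by rewrite mxE GB.
have dotM (v w : 'cV[R]_d) : dotv (M *m v) w = (v^T *m M *m w) 0 0.
  by rewrite /dotv trmx_mul sM.
have MijE k l : (delta_mx k (0 : 'I_1))^T *m M *m delta_mx l (0 : 'I_1) = (M k l)%:M.
  by rewrite trmx_delta -rowE -colE; apply/matrixP => a b; rewrite !mxE !ord1 eqxx.
have Mji : M j i = M i j by rewrite -[in LHS]sM mxE.
have Mij s : 0 <= s * M i j *+ 2.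
  have := pM (delta_mx i 0 + s *: delta_mx j 0).
  have trE (v w : 'cV[R]_d) : (v + s *: w)^T = v^T + s *: w^T.
    by apply/matrixP => a b; rewrite !mxE.
  rewrite dotM trE !mulmxDl !mulmxDr -!scalemxAl -!scalemxAr.
  rewrite !MijE !Mkk Mji; move: (M i j) => m; rewrite !mxE !eqxx/= !mulr1n.
  by rewrite ?mulr0 ?addr0 ?add0r -mulr2n.
have : M i j = 0.
  apply/eqP; rewrite eq_le; apply/andP; split.
    by have := Mij (-1); rewrite pmulrn_lge0// mulN1r oppr_ge0.
  by have := Mij 1; rewrite pmulrn_lge0// mul1r.
by rewrite mxE => Gij0; rewrite -(pm_entryE G i j mB) Gij0.
Qed.

Definition int_scalar G (phi : 'cV[R]_d -> R) : 'M[R]_d :=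
  \matrix_(i, j) (\int[trace_measure G]_x (phi x * density G x i j)).

Definition int_vv G (u v : 'cV[R]_d -> 'cV[R]_d) : R :=
  \int[trace_measure G]_x (dotv (density G x *m u x) (v x)).

Definition int_mm G (U V : 'cV[R]_d -> 'M[R]_d) : R :=
  \int[trace_measure G]_x (frob (density G x *m U x) (V x)).

Definition int_m G (Phi : 'cV[R]_d -> 'M[R]_d) : R :=
  \int[trace_measure G]_x (frob (Phi x) (density G x)).

End Integrals.

Definition narrow_continuous (R : realType) (d : nat) (G : R -> psd_measure R d)
    : Prop :=
  forall phi : 'cV[R]_d -> R,
    continuous phi -> (exists M : R, forall x, `|phi x| <= M) ->
    {within `[0, 1], continuous (fun t : R => int_scalar (G t) phi)}.

Section TimeSpaceC1.
Context (R : realType) (d : nat) (V : normedModType R).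
Implicit Types f : R -> 'cV[R]_d -> V.

Definition dquot_t f (t : R) (x : 'cV[R]_d) (s : R) : V :=
  (s - t)^-1 *: (f s x - f t x).

(* Time derivative along [0, 1], one-sided at the end points. *)
Definition derivable_t f (t : R) (x : 'cV[R]_d) : Prop :=
  cvg (dquot_t f t x s @[s --> within `[0, 1] t^']).

Definition deriv_t f (t : R) (x : 'cV[R]_d) : V :=
  lim (dquot_t f t x s @[s --> within `[0, 1] t^']).

Definition basis_vec (k : 'I_d) : 'cV[R]_d := delta_mx k 0.

Definition deriv_x (k : 'I_d) f (t : R) (x : 'cV[R]_d) : V :=
  'D_(basis_vec k) (f t) x.

Definition Cb01 f : Prop :=
  {within `[0, 1] `*` setT,
    continuous (fun p : R * 'cV[R]_d => f p.1 p.2)} /\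
  exists M : R, forall t x, 0 <= t <= 1 -> `|f t x| <= M.

(* Bounded C^1 functions on [0, 1] x R^d with bounded first derivatives;
   the values of [f] outside [0, 1] are irrelevant. *)
Definition C1b f : Prop :=
  [/\ forall t x, 0 <= t <= 1 -> derivable_t f t x,
      forall t x k, 0 <= t <= 1 -> derivable (f t) x (basis_vec k),
      Cb01 f,
      Cb01 (deriv_t f) &
      forall k, Cb01 (deriv_x k f)].

End TimeSpaceC1.

Section Admissible.
Context (R : realType) (d : nat).
Implicit Types (G : R -> psd_measure R d)
  (U Phi : R -> 'cV[R]_d -> 'M[R]_d) (u : R -> 'cV[R]_d -> 'cV[R]_d).

Definition sym_field U : Prop :=
  forall t x, 0 <= t <= 1 -> sym_mx (U t x).

Definition div_mx Phi (t : R) (x : 'cV[R]_d) : 'cV[R]_d :=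
  \col_i \sum_(k < d) deriv_x k Phi t x i k.

Definition normsq G U u : \bar R :=
  (\int[lebesgue_measure]_(t in `[0%R, 1%R])
    (\int[trace_measure (G t)]_x
        (dotv (density (G t) x *m u t x) (u t x))%:E +
     \int[trace_measure (G t)]_x
        (frob (density (G t) x *m U t x) (U t x))%:E))%E.

Definition measurable_field (m n : nat) (F : R -> 'cV[R]_d -> 'M[R]_(m, n))
    : Prop :=
  forall i j, measurable_fun
    (`[0, 1] `*` setT : set (measurableTypeR R * borel_space R d)%type)
    (fun p => F p.1 p.2 i j).

(* The completion of C^1_b for the seminorm is realized inside the space of
   measurable fields, as the closure of C^1_b: a Cauchy sequence in C^1_b
   always has a measurable field as limit, unique up to the kernel. *)
Definition in_L2 G U u : Prop :=
  [/\ measurable_field U, measurable_field u, sym_field U,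
      (normsq G U u < +oo)%E &
      exists (Un : nat -> R -> 'cV[R]_d -> 'M[R]_d)
             (un : nat -> R -> 'cV[R]_d -> 'cV[R]_d),
        (forall n, [/\ C1b (Un n), sym_field (Un n) & C1b (un n)]) /\
        normsq G (fun t x => U t x - Un n t x) (fun t x => u t x - un n t x)
          @[n --> \oo] --> 0%E].

Definition int_time (s t : R) (f : R -> R) : R :=
  if s <= t then \int[lebesgue_measure]_(r in `[s, t]) f r
  else - \int[lebesgue_measure]_(r in `[t, s]) f r.

Definition weak_equation G U u : Prop :=
  forall Phi, C1b Phi -> sym_field Phi ->
  forall s t : R, 0 <= s <= 1 -> 0 <= t <= 1 ->
    int_m (G t) (Phi t) - int_m (G s) (Phi s)
      - int_time s t (fun r => int_m (G r) (deriv_t Phi r))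
    = int_time s t (fun r =>
        int_vv (G r) (u r) (div_mx Phi r) + int_mm (G r) (U r) (Phi r)).

Definition admissible (G0 G1 : psd_measure R d) G U u : Prop :=
  [/\ narrow_continuous G, pm_eq (G 0) G0, pm_eq (G 1) G1,
      in_L2 G U u & weak_equation G U u].

Definition dKB (G0 G1 : psd_measure R d) : \bar R :=
  sqrte (ereal_inf [set c | exists G U u,
    admissible G0 G1 G U u /\ c = normsq G U u]).

End Admissible.

(* Main.v *)
Require Import Defs.
From HB Require Import structures.
From mathcomp Require Import all_boot all_order all_algebra.
From mathcomp Require Import all_classical all_reals all_analysis.
From mathcomp Require Import measurable_realfun ring lra.

(** Reversing time gives symmetry, and concatenating two paths, with time
    fractions proportional to their lengths, gives the triangle inequality; the
    C^1 approximants of the two pieces are first multiplied by a polynomial in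
    time that vanishes to second order at the junction. The distance is finite
    since the path [(1 - t)^2 G], driven by the field [- 2 / (1 - t)] times the
    identity, joins [G] to 0 with an energy controlled by the mass of [G].

    Young's inequality in the weak equation, tested with the identity matrix,
    bounds the mass along a path by the initial mass and the energy. Tested with
    a field [Phi] that does not depend on time, it then bounds the difference of
    the integrals of [Phi] against the two end points by a multiple of the square
    root of the energy. If the distance is 0, the end points therefore agree on
    all bounded C^1 functions, and by Dynkin's theorem on all Borel sets.

    No measurability in time of the energy density of a path is needed: the
    action is a lower integral, and its behaviour under affine changes of time
    and concatenation does not require measurability. *)

(** Positivity is given for the values of [G] on sets, whereas Young's inequality is needed
    pointwise. The density is therefore shown to be positive semidefinite almost everywhere and
    replaced by [rd], for which this holds everywhere; a single form [bil] then serves vector and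
    matrix fields.

    Lower integrals are homogeneous in the integrand and additive in the domain, but not additive in
    the integrand. A sum is split only if one summand is measurable, such as a mass term or a
    constant; in time, energies are only added pointwise or over disjoint intervals.

    The bound on the mass avoids a Gronwall argument: the mass is estimated at a time where it is
    largest, with a Young parameter that lets half of it be absorbed.

    Cutting off at the junction costs nothing in the limit, because the seminorm contains no
    derivative: the cutoff may be as steep as desired, and each approximant is bounded.

    The field that drives [(1 - t)^2 G] is unbounded near [t = 1]. The weight [(1 - t)^2] cancels
    its pole, so that truncated geometric series approximate it in the seminorm. *)

Set Implicit Arguments.
Unset Strict Implicit.
Unset Printing Implicit Defensive.

Import Order.TTheory GRing.Theory Num.Theory.
Import numFieldNormedType.Exports.

Local Open Scope classical_set_scope.
Local Open Scope ring_scope.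

(** * Lower integrals *)

Section LowerIntegral.
Local Open Scope ereal_scope.
Context d (T : measurableType d) (R : realType).
Implicit Types (mu : {measure set T -> \bar R}) (D : set T) (f g k : T -> \bar R).

Import HBNNSimple.

(** For nonnegative functions both sides are suprema of integrals of simple minorants, and every
    simple minorant of [f \_ D] is one of [g \_ D]. This covers nonmeasurable functions. *)
Lemma lint_mono mu D f g : (forall x, D x -> 0 <= f x) ->
  (forall x, D x -> f x <= g x) ->
  \int[mu]_(x in D) f x <= \int[mu]_(x in D) g x.
Proof.
move=> f0 fg; have g0 x : D x -> 0 <= g x by move=> Dx; exact: le_trans (f0 _ Dx) (fg _ Dx).
rewrite !ge0_integralE//; apply: le_ereal_sup => _ [h hf <-]; exists h => // x.
apply: le_trans (hf x) _; rewrite /patch; case: ifPn => //; rewrite inE.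
exact: fg.
Qed.

(* The integral of a nonnegative function is a lower integral, also when the
   function is not measurable. *)
Lemma lint_minorant mu D f : measurable D -> (forall x, D x -> 0 <= f x) ->
  exists k, [/\ measurable_fun setT k, forall x, 0 <= k x,
    forall x, D x -> k x <= f x, forall x, ~ D x -> k x = 0 &
    \int[mu]_(x in D) f x = \int[mu]_x k x].
Proof.
move=> mD f0; have fD0 x : 0 <= (f \_ D) x by exact: erestrict_ge0.
pose S := [set sintegral mu h |
  h in [set h : {nnsfun T >-> R} | forall x, (h x)%:E <= (f \_ D) x]].
have Sn : S != set0.
  by apply/set0P; exists (sintegral mu (@nnsfun0 _ T R)), nnsfun0.
have [u uS ucvg] := ereal_sup_seq Sn.
have /choice[h hP] n : exists h : {nnsfun T >-> R},
    (forall x, (h x)%:E <= (f \_ D) x) /\ sintegral mu h = u n.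
  by have [h ? ?] := uS n; exists h.
(* A countable supremum of simple minorants is measurable and still lies below [f]; along a
   maximizing sequence its integral cannot fall short of the supremum. *)
pose k x := ereal_sup (range (fun n => (h n x)%:E)).
have hk n x : (h n x)%:E <= k x by apply: ereal_sup_ubound; exists n.
have kf x : k x <= (f \_ D) x.
  by apply: ge_ereal_sup => _ [n _ <-]; exact: (hP n).1.
have k0 x : 0 <= k x.
  by apply: le_trans (hk 0%N x); rewrite lee_fin.
have mk : measurable_fun setT (k : T -> \bar R).
  have := @measurable_fun_esups _ T R setT (fun n x => (h n x)%:E).
  move=> /(_ _ 0%N); rewrite /esups /=.
  have E x : sdrop (fun n => (h n x)%:E) 0 = range (fun n => (h n x)%:E).
    by rewrite /sdrop/= ; congr (_ @` _); apply/seteqP; split.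
  under eq_fun do rewrite E; apply => n.
  by apply/measurable_EFinP.
exists k; split => //.
- by move=> x Dx; have := kf x; rewrite /patch mem_set.
- move=> x Dx; apply/eqP; rewrite eq_le k0 andbT.
  by have := kf x; rewrite /patch memNset.
- apply/eqP; rewrite eq_le; apply/andP; split.
    rewrite ge0_integralE//.
    apply: (cvge_le _ ucvg); apply: nearW => n.
    rewrite -(hP n).2 -(patch_setT (fun _ => 0%R) (h n)) -integral_nnsfun//.
    by apply: lint_mono => x _; [rewrite lee_fin|exact: hk].
  rewrite [leRHS]integral_mkcond; exact: lint_mono.
Qed.

(** The way to upper bounds: the lower integral is attained by a measurable minorant, so it is
    enough to estimate such minorants by the ordinary theory of integration. *)
Lemma lint_le mu D f X : measurable D -> (forall x, D x -> 0 <= f x) ->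
  (forall k, measurable_fun setT k -> (forall x, 0 <= k x) ->
    (forall x, D x -> k x <= f x) -> (forall x, ~ D x -> k x = 0) ->
    \int[mu]_x k x <= X) ->
  \int[mu]_(x in D) f x <= X.
Proof.
move=> mD f0 H; have [k [mk k0 kf kD ->]] := lint_minorant mu mD f0.
exact: H.
Qed.

Lemma lintT_le mu D f k : measurable_fun setT k -> measurable D ->
  (forall x, 0 <= k x) ->
  (forall x, D x -> k x <= f x) -> (forall x, ~ D x -> k x = 0) ->
  \int[mu]_x k x <= \int[mu]_(x in D) f x.
Proof.
move=> mk mD k0 kf kD; rewrite [leRHS]integral_mkcond.
apply: lint_mono => // x _; rewrite /patch; case: ifPn; rewrite ?inE ?notin_setE.
  exact: kf.
by move=> /kD ->.
Qed.

Lemma lint_null_le mu D N f g : measurable D -> measurable N -> mu N = 0 ->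
  (forall x, D x -> 0 <= f x) -> (forall x, D x -> 0 <= g x) ->
  (forall x, D x -> ~ N x -> f x <= g x) ->
  \int[mu]_(x in D) f x <= \int[mu]_(x in D) g x.
Proof.
move=> mD mN N0 f0 g0 fg; apply: lint_le => // k mk k0 kf kD.
rewrite (ge0_negligible_integral mN measurableT mk)//.
rewrite integral_mkcond; apply: lintT_le => //.
- apply/(measurable_restrictT _ _).1; first exact: measurableD.
  exact: measurable_funS mk.
- by move=> x; exact: erestrict_ge0.
- move=> x Dx; rewrite /patch; case: ifPn; rewrite ?inE => H; last exact: g0.
  case: H => _ Nx; exact: le_trans (kf _ Dx) (fg _ Dx Nx).
- by move=> x Dx; rewrite /patch kD// if_same.
Qed.

Lemma lint_null mu D N f g : measurable D -> measurable N -> mu N = 0 ->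
  (forall x, D x -> 0 <= f x) -> (forall x, D x -> 0 <= g x) ->
  (forall x, D x -> ~ N x -> f x = g x) ->
  \int[mu]_(x in D) f x = \int[mu]_(x in D) g x.
Proof.
move=> mD mN N0 f0 g0 fg; apply/eqP; rewrite eq_le; apply/andP; split;
  by apply: (lint_null_le mD mN N0) => // x Dx Nx; rewrite fg.
Qed.

(** Scaling a minorant gives one inequality for every positive factor; the other one is the same
    inequality for the factor [c^-1] and the function [c * f]. *)
Lemma lintZ mu D f (c : R) : (0 <= c)%R -> (forall x, D x -> 0 <= f x) ->
  measurable D ->
  \int[mu]_(x in D) (c%:E * f x) = c%:E * \int[mu]_(x in D) f x.
Proof.
move=> c0 + mD; rewrite le_eqVlt in c0; case/predU1P : c0 => [<-|c0] f0.
  by rewrite mul0e integral0_eq// => x _; rewrite mul0e.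
have H (a : R) h : (0 < a)%R -> (forall x, D x -> 0 <= h x) ->
    a%:E * \int[mu]_(x in D) h x <= \int[mu]_(x in D) (a%:E * h x).
  move=> a0 h0; have [k [mk k0 kf kD ->]] := lint_minorant mu mD h0.
  rewrite -ge0_integralZl_EFin//; last exact: ltW.
  apply: lintT_le => //.
  - exact: measurable_funeM.
  - by move=> x; rewrite mule_ge0// lee_fin ltW.
  - by move=> x Dx; rewrite lee_pmul2l//; exact: kf.
  - by move=> x Dx; rewrite kD// mule0.
apply/eqP; rewrite eq_le; apply/andP; split; last exact: H.
rewrite -lee_pdivrMl//; apply: le_trans (H c^-1%R (fun x => c%:E * f x) _ _) _.
- by rewrite invr_gt0.
- by move=> x Dx; rewrite mule_ge0// ?f0// lee_fin ltW.
- by apply: lint_mono => x Dx; rewrite muleA -EFinM mulVf ?gt_eqF// mul1e ?f0.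
Qed.

(** Minorants on [A] and on [B] that vanish elsewhere add up to a minorant on the union, and a
    minorant on the union restricts to both pieces. *)
Lemma lint_setU mu A B f : measurable A -> measurable B -> [disjoint A & B] ->
  (forall x, (A `|` B) x -> 0 <= f x) ->
  \int[mu]_(x in A `|` B) f x =
  \int[mu]_(x in A) f x + \int[mu]_(x in B) f x.
Proof.
move=> mA mB AB f0; have mAB : measurable (A `|` B) by exact: measurableU.
apply/eqP; rewrite eq_le; apply/andP; split.
  apply: lint_le => // k mk k0 kf kD.
  have -> : \int[mu]_x k x = \int[mu]_(x in A `|` B) k x.
    rewrite [RHS]integral_mkcond; apply: eq_integral => x _.
    by rewrite /patch; case: ifPn => //; rewrite notin_setE => /kD.
  rewrite ge0_integral_setU//; last exact: measurable_funS mk.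
  apply: leeD; apply: lint_mono => // x xAB; apply: kf.
    by left.
  by right.
have fA x : A x -> 0 <= f x by move=> Ax; apply: f0; left.
have fB x : B x -> 0 <= f x by move=> Ax; apply: f0; right.
have [k [mk k0 kf kD ->]] := lint_minorant mu mA fA.
have [l [ml l0 lf lD ->]] := lint_minorant mu mB fB.
rewrite -ge0_integralD//; apply: lintT_le => //.
- exact: emeasurable_funD.
- by move=> x; rewrite adde_ge0.
- have NAB x : A x -> ~ B x by move=> Ax Bx; move/disj_setPS: AB => /(_ x); apply.
  move=> x [Ax|Bx].
    by rewrite lD ?adde0 ?kf//; exact: NAB.
  by rewrite kD ?add0e ?lf// => Ax; exact: NAB Bx.
- by move=> x /not_orP[Ax Bx]; rewrite kD// lD// adde0.
Qed.

(** In general lower integrals are only superadditive. Here [m] is measurable, so a measurable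
    minorant [k] of [f + m] yields the measurable minorant [max (k - m) 0] of [f]. *)
Lemma lintD_le mu D f (m : T -> R) : measurable D ->
  (forall x, D x -> 0 <= f x) -> measurable_fun setT m ->
  (forall x, (0 <= m x)%R) ->
  \int[mu]_(x in D) (f x + (m x)%:E) <=
  \int[mu]_(x in D) f x + \int[mu]_(x in D) (m x)%:E.
Proof.
move=> mD f0 mm m0; apply: lint_le => //.
  by move=> x Dx; rewrite adde_ge0 ?f0 ?lee_fin.
have mm' : measurable_fun setT (EFin \o m) by exact/measurable_EFinP.
move=> k mk k0 kf kD; pose l x := maxe (k x - (m x)%:E) 0.
have ml : measurable_fun setT (l : T -> \bar R).
  by apply: measurable_maxe => //; exact: emeasurable_funB.
rewrite [X in _ + X]integral_mkcond.
apply: (@le_trans _ _ (\int[mu]_x l x + \int[mu]_x ((fun x => (m x)%:E) \_ D) x)).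
  rewrite -ge0_integralD//.
  - apply: lint_mono => // x _; rewrite /l /patch; case: ifPn.
      move=> _; rewrite -leeBlDr// le_max lexx//.
    by rewrite notin_setE => /kD ->; rewrite adde0 le_max lexx orbT.
  - by move=> x _; rewrite /l le_max lexx orbT.
  - by move=> x _; apply: erestrict_ge0 => y _; rewrite lee_fin.
  - apply/(measurable_restrictT _ _).1 => //.
    exact: measurable_funS mm'.
apply: leeD => //; apply: lintT_le => //.
- by move=> x; rewrite /l le_max lexx orbT.
- by move=> x Dx; rewrite /l ge_max leeBlDr// kf// f0.
- move=> x Dx; rewrite /l kD// sub0e; apply/max_idPr.
  by rewrite -EFinN lee_fin oppr_le0.
Qed.

Lemma lint_measureZ (mu mu' : {measure set T -> \bar R}) D f (c : R) :
  (0 <= c)%R -> (forall A, measurable A -> mu' A = c%:E * mu A) ->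
  measurable D -> (forall x, D x -> 0 <= f x) ->
  \int[mu']_(x in D) f x = c%:E * \int[mu]_(x in D) f x.
Proof.
move=> c0 mu'E mD f0.
have H k : measurable_fun setT k -> (forall x, 0 <= k x) ->
    \int[mu']_x k x = c%:E * \int[mu]_x k x.
  move=> mk k0; rewrite -(ge0_integral_mscale mu measurableT (NngNum c0))//.
  by apply: eq_measure_integral => A mA _; rewrite mu'E.
apply/eqP; rewrite eq_le; apply/andP; split.
  apply: lint_le => // k mk k0 kf kD; rewrite H//.
  by apply: lee_wpmul2l; [rewrite lee_fin|exact: lintT_le].
have [k [mk k0 kf kD ->]] := lint_minorant mu mD f0.
by rewrite -H//; exact: lintT_le.
Qed.

(** Positive and negative parts scale separately, and are exchanged if [c < 0]. If one of them has
    infinite integral, [fine] returns 0 on both sides. *)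
Lemma RintZ mu D (f : T -> R) (c : R) : measurable D ->
  (\int[mu]_(x in D) (c * f x) = c * \int[mu]_(x in D) f x)%R.
Proof.
move=> mD; rewrite /Rintegral integralE [in RHS]integralE.
set A := \int[mu]_(x in D) (_ ^\+ x); set B := \int[mu]_(x in D) (_ ^\- x).
set A' := \int[mu]_(x in D) (_ ^\+ x); set B' := \int[mu]_(x in D) (_ ^\- x).
have A0 : 0 <= A' by apply: integral_ge0 => x _; exact: funepos_ge0.
have B0 : 0 <= B' by apply: integral_ge0 => x _; exact: funeneg_ge0.
have fin0 (x y : \bar R) (a : R) : (0 <= a)%R -> 0 <= x -> 0 <= y ->
    fine (a%:E * x - a%:E * y) = (a * fine (x - y))%R.
  rewrite le_eqVlt => /predU1P[<-|a0] x0 y0; first by rewrite !mul0e sube0 mul0r.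
  move: x y x0 y0 => [x| |] [y| |]//= _ _; rewrite ?gt0_muley ?lte_fin//=;
    by rewrite ?mulr0 ?mulrBr.
have [c0|c0] := leP 0%R c.
  have -> : A = c%:E * A'.
    rewrite -lintZ//.
    apply: eq_integral => x _; rewrite !funeposE EFinM maxe_pMr//.
      by rewrite mule0.
  have -> : B = c%:E * B'.
    rewrite -lintZ//.
    apply: eq_integral => x _; rewrite !funenegE EFinM -muleN maxe_pMr//.
      by rewrite mule0.
  exact: fin0.
have c0' : (0 <= - c)%R by lra.
have -> : A = (- c)%:E * B'.
  rewrite -lintZ//.
  apply: eq_integral => x _; rewrite !funeposE !funenegE -EFinN -!EFin_max -EFinM.
  by rewrite maxr_pMr// mulr0 mulrNN.
have -> : B = (- c)%:E * A'.
  rewrite -lintZ//.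
  apply: eq_integral => x _; rewrite !funeposE !funenegE -EFinN -!EFin_max -EFinM.
  by rewrite maxr_pMr// mulr0 mulNr.
rewrite fin0//.
move: {A B fin0} A0 B0; case: A' => [x| |]; case: B' => [y| |]//= _ _; lra.
Qed.

End LowerIntegral.

Section RealLowerIntegral.
Local Open Scope ereal_scope.
Context d (T : measurableType d) (R : realType).
Implicit Types (mu : {measure set T -> \bar R}) (D : set T) (f g : T -> R).

Lemma fine_subZ (x y : \bar R) (a : R) : (0 <= a)%R -> 0 <= x -> 0 <= y ->
  fine (a%:E * x - a%:E * y) = (a * fine (x - y))%R.
Proof.
rewrite le_eqVlt => /predU1P[<-|a0] x0 y0; first by rewrite !mul0e sube0 mul0r.
move: x y x0 y0 => [x| |] [y| |]//= _ _; rewrite ?gt0_muley ?lte_fin//=;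
  by rewrite ?mulr0 ?mulrBr.
Qed.

Lemma Rint_null mu D N f g : measurable D -> measurable N -> mu N = 0 ->
  (forall x, D x -> ~ N x -> f x = g x) ->
  (\int[mu]_(x in D) f x = \int[mu]_(x in D) g x)%R.
Proof.
move=> mD mN N0 fg; rewrite /Rintegral integralE [in RHS]integralE.
congr (fine (_ - _)); apply: (lint_null mD mN N0) => // x Dx Nx.
  by rewrite !funeposE fg.
by rewrite !funenegE fg.
Qed.

Lemma Rint_measureZ (mu mu' : {measure set T -> \bar R}) D f (c : R) :
  (0 <= c)%R -> (forall A, measurable A -> mu' A = c%:E * mu A) ->
  measurable D ->
  (\int[mu']_(x in D) f x = c * \int[mu]_(x in D) f x)%R.
Proof.
move=> c0 H mD; rewrite /Rintegral integralE [in RHS]integralE.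
rewrite !(lint_measureZ c0 H mD)// fine_subZ//;
  by apply: integral_ge0 => x _; rewrite ?funepos_ge0 ?funeneg_ge0.
Qed.

(** The integrals of the positive and of the negative part both lie between 0 and [X], hence so does
    the absolute value of their difference; no sum of integrals is formed. *)
Lemma Rint_bound mu D f (g : T -> \bar R) (X : R) :
  (forall x, D x -> `|f x|%:E <= g x) -> \int[mu]_(x in D) g x <= X%:E ->
  (`|\int[mu]_(x in D) f x| <= X)%R.
Proof.
move=> fg gX; rewrite /Rintegral integralE.
have H1 : \int[mu]_(x in D) ((EFin \o f)^\+ x) <= X%:E.
  apply: le_trans gX; apply: lint_mono => x Dx //.
  by apply: le_trans (fg _ Dx); rewrite funeposE -EFin_max lee_fin ge_max ler_norm/=.
have H2 : \int[mu]_(x in D) ((EFin \o f)^\- x) <= X%:E.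
  apply: le_trans gX; apply: lint_mono => x Dx //.
  apply: le_trans (fg _ Dx); rewrite funenegE -EFinN -EFin_max lee_fin ge_max.
  by rewrite -normrN ler_norm/=.
have H10 : 0 <= \int[mu]_(x in D) ((EFin \o f)^\+ x) by exact: integral_ge0.
have H20 : 0 <= \int[mu]_(x in D) ((EFin \o f)^\- x) by exact: integral_ge0.
move: H1 H2 H10 H20; rewrite /comp/=.
case: (\int[mu]_(x in D) _) => [x| |]//; case: (\int[mu]_(x in D) _) => [y| |]//=.
by rewrite !lee_fin ler_norml => *; lra.
Qed.

End RealLowerIntegral.

(** * Affine changes of the time variable *)

Section Time.
Context (R : realType).
Local Notation mu := (@lebesgue_measure R).
Local Notation mR := (measurableTypeR R).
Implicit Types (f g : R -> R) (s t r : R).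

Lemma measurable_affine (a b : R) :
  measurable_fun setT ((fun r => a * r + b) : mR -> mR).
Proof.
apply: continuous_measurable_fun => x.
by apply: cvgD; [apply: cvgM; [exact: cvg_cst|exact: cvg_id]|exact: cvg_cst].
Qed.

Local Notation push_affine a b :=
  (measure_function_pushforward__canonical__measure_function_Measure mu
    (measurable_affine a b)).

(** The push-forward multiplied by [|a|] agrees with Lebesgue measure on the intervals []x, y]], and
    uniqueness does the rest. For [a < 0] the preimage is closed at the other end, which does not
    change its length. *)
Lemma lebesgue_affine (a b : R) (A : set mR) : a != 0 -> measurable A ->
  (mu ((fun r => (a * r + b)%R) @^-1` A) = `|a|^-1%:E * mu A)%E.
Proof.
move=> a0 mA; have na : 0 <= `|a| by [].
pose m : {measure set mR -> \bar R} := mscale (NngNum na) (push_affine a b).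
have E : forall B, measurable B -> mu B = m B.
  apply: lebesgue_measure_unique => _ [[x y] _ <-].
  rewrite /m /= /mscale /= /pushforward /=.
  have [ag|al|/eqP] := ltgtP a 0; last by rewrite (negbTE a0).
    rewrite (_ : _ @^-1` _ = `[((y - b) / a), ((x - b) / a)[%classic); last first.
      apply/seteqP; split => z /=; rewrite !in_itv/= ler_ndivrMr// ltr_ndivlMr//;
        by move=> /andP[? ?]; apply/andP; split; lra.
    rewrite !lebesgue_measure_itv/= !lte_fin ltr_nM2r ?invr_lt0// ltrBlDr subrK.
    case: ltP => xy; last by rewrite mule0.
    rewrite -!EFinB -EFinM; congr EFin; rewrite ltr0_norm//; field.
    by rewrite lt_eqF.
  rewrite (_ : _ @^-1` _ = `]((x - b) / a), ((y - b) / a)]%classic); last first.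
    apply/seteqP; split => z /=; rewrite !in_itv/= ler_pdivlMr// ltr_pdivrMr//;
      by move=> /andP[? ?]; apply/andP; split; lra.
  rewrite !lebesgue_measure_itv/= !lte_fin ltr_pM2r ?invr_gt0// ltrBlDr subrK.
  case: ltP => xy; last by rewrite mule0.
  rewrite -!EFinB -EFinM; congr EFin; rewrite gtr0_norm//; field.
  by rewrite gt_eqF.
rewrite (E _ mA) /m/= /mscale/= /pushforward muleA -EFinM mulVf ?mul1e//.
by rewrite normr_eq0.
Qed.

(** Pulling back a measurable minorant gives [>=] for every affine bijection; [<=] is the same
    statement for the inverse map. *)
Lemma lint_affine (a b : R) (D : set mR) (f : mR -> \bar R) :
  a != 0 -> measurable D -> (forall r, 0 <= f r)%E ->
  (\int[mu]_(r in (fun r => (a * r + b)%R) @^-1` D) f (a * r + b)%R =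
   `|a|^-1%:E * \int[mu]_(r in D) f r)%E.
Proof.
move=> a0 mD f0.
have H (c e : R) (E : set mR) (g : mR -> \bar R) : c != 0 -> measurable E ->
    (forall r, 0 <= g r)%E ->
    (`|c|^-1%:E * \int[mu]_(r in E) g r <=
     \int[mu]_(r in (fun r => (c * r + e)%R) @^-1` E) g (c * r + e)%R)%E.
  move=> c0 mE g0; have [k [mk k0 kg kE ->]] := lint_minorant mu mE (fun r _ => g0 r).
  pose phi : mR -> mR := fun r => c * r + e.
  have mphi : measurable_fun setT phi := measurable_affine c e.
  have nc : 0 <= `|c|^-1 by rewrite invr_ge0.
  rewrite -(lint_measureZ (mu := mu) (mu' := push_affine c e) nc)//; last first.
    by move=> A mA; exact: lebesgue_affine.
  rewrite ge0_integral_pushforward// preimage_setT.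
  apply: lintT_le.
  - exact: measurableT_comp.
  - by rewrite -[X in measurable X]setTI; exact: mphi.
  - by move=> x; exact: k0.
  - by move=> x; exact: kg.
  - by move=> x; exact: kE.
apply/eqP; rewrite eq_le; apply/andP; split; last exact: H.
have mD' : measurable ((fun r => (a * r + b)%R) @^-1` D : set mR).
  by rewrite -[X in measurable X]setTI; exact: measurable_affine.
have := H a^-1 (- b / a) _ (fun r => f (a * r + b)) (_ : a^-1 != 0) mD'.
rewrite invr_eq0 => /(_ a0 (fun r => f0 _)).
rewrite normrV ?unitfE// invrK.
have E x : (a * (a^-1 * x + - b / a) + b) = x by field.
under [X in (_ <= X)%E]eq_integral do rewrite E.
rewrite (_ : (fun r => a^-1 * r + - b / a) @^-1` ((fun r => a * r + b) @^-1` D) = D);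
  last by apply/seteqP; split => x; rewrite /preimage/= E.
by rewrite lee_pdivlMl// normr_gt0.
Qed.

Lemma Rint_affine (a b : R) (D : set mR) f : a != 0 -> measurable D ->
  \int[mu]_(r in (fun r => (a * r + b)%R) @^-1` D) f (a * r + b) =
  `|a|^-1 * \int[mu]_(r in D) f r.
Proof.
move=> a0 mD; rewrite /Rintegral integralE [in RHS]integralE.
rewrite -fine_subZ ?integral_ge0//.
rewrite -(lint_affine b a0 mD)// -(lint_affine b a0 mD)//.
by congr (fine (_ - _)); apply: eq_integral => x _;
  rewrite ?funeposE ?funenegE.
Qed.

Lemma itv_affine_pos (a b s t : R) : 0 < a ->
  (fun r => a * r + b) @^-1` `[a * s + b, a * t + b] = `[s, t]%classic.
Proof.
move=> a0; apply/seteqP; split => z /=; rewrite !in_itv/= !lerD2r !ler_pM2l//.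
Qed.

Lemma itv_affine_neg (a b s t : R) : a < 0 ->
  (fun r => a * r + b) @^-1` `[a * t + b, a * s + b] = `[s, t]%classic.
Proof.
move=> a0; apply/seteqP; split => z /=; rewrite !in_itv/= !lerD2r !ler_nM2l//;
  by rewrite andbC.
Qed.

(** The factor is [a] and not [|a|] because [int_time] is oriented: a negative [a] also exchanges
    the two bounds. *)
Lemma int_time_affine (a b s t : R) f : a != 0 ->
  int_time (a * s + b) (a * t + b) f = int_time s t (fun r => a * f (a * r + b)).
Proof.
move=> a0; rewrite /int_time lerD2r.
have [ag|al|/eqP] := ltgtP a 0; last by rewrite (negbTE a0).
- rewrite ler_nM2l//; have [st|ts|->] := ltgtP s t.
  + rewrite -(itv_affine_neg b s t ag) RintZ; last first.
      by rewrite itv_affine_neg.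
    rewrite Rint_affine//.
    by rewrite ltr0_norm// mulrA invrN mulrN mulfV// mulN1r.
  + rewrite -(itv_affine_neg b t s ag) RintZ; last first.
      by rewrite itv_affine_neg.
    rewrite Rint_affine//.
    by rewrite ltr0_norm// mulrA invrN mulrN mulfV// mulN1r opprK.
  + by rewrite !set_itv1 /Rintegral !integral_set1 ?oppr0.
- rewrite ler_pM2l//; have [st|ts] := leP s t.
  + rewrite -(itv_affine_pos b s t al) RintZ; last first.
      by rewrite itv_affine_pos.
    rewrite Rint_affine//.
    by rewrite gtr0_norm// mulrA mulfV// mul1r.
  + rewrite -(itv_affine_pos b t s al) RintZ; last first.
      by rewrite itv_affine_pos.
    rewrite Rint_affine//.
    by rewrite gtr0_norm// mulrA mulfV// mul1r.
Qed.

End Time.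

(** * Additivity and bounds for integrals in time *)

Section TimeIntegral.
Context (R : realType).
Local Notation mu := (@lebesgue_measure R).
Local Notation mR := (measurableTypeR R).
Implicit Types (f g : R -> R) (s t r : R).

Lemma fine_addsub (x y z w : \bar R) : (0 <= x)%E -> (0 <= y)%E ->
  (0 <= z)%E -> (0 <= w)%E -> (x + y < +oo)%E -> (z + w < +oo)%E ->
  fine ((x + y) - (z + w)) = fine (x - z) + fine (y - w).
Proof.
by case: x => [x| |]; case: y => [y| |]; case: z => [z| |]; case: w => [w| |]//= *;
  rewrite opprD addrACA.
Qed.

(** Finiteness of the lower integral of [|f|] makes all four integrals of positive and negative
    parts finite, so that their differences can be rearranged. *)
Lemma Rint_setU (A B : set mR) f : measurable A -> measurable B ->
  [disjoint A & B] -> (\int[mu]_(r in A `|` B) `|f r|%:E < +oo)%E ->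
  \int[mu]_(r in A `|` B) f r = \int[mu]_(r in A) f r + \int[mu]_(r in B) f r.
Proof.
move=> mA mB AB foo; rewrite /Rintegral (integralE mu (A `|` B)) (integralE mu A) (integralE mu B).
have pf r : ((EFin \o f)^\+ r <= `|f r|%:E)%E.
  by rewrite funeposE -EFin_max lee_fin ge_max normr_ge0 ler_norm.
have nf r : ((EFin \o f)^\- r <= `|f r|%:E)%E.
  rewrite funenegE -EFinN -EFin_max lee_fin ge_max normr_ge0 -normrN.
  by rewrite ler_norm.
have Pf : (\int[mu]_(r in A `|` B) (EFin \o f)^\+ r < +oo)%E.
  by apply: le_lt_trans foo; apply: lint_mono.
have Nf : (\int[mu]_(r in A `|` B) (EFin \o f)^\- r < +oo)%E.
  by apply: le_lt_trans foo; apply: lint_mono.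
have P0 x : (0 <= (EFin \o f)^\+ x)%E by exact: funepos_ge0.
have N0 x : (0 <= (EFin \o f)^\- x)%E by exact: funeneg_ge0.
rewrite /comp in Pf Nf P0 N0 *.
rewrite (lint_setU _ mA mB AB (fun x _ => P0 x)) in Pf *.
rewrite (lint_setU _ mA mB AB (fun x _ => N0 x)) in Nf *.
by rewrite fine_addsub// integral_ge0.
Qed.

Lemma Rint_cc_split (a b c : R) f : a <= b -> b <= c ->
  (\int[mu]_(r in `[a, c]) `|f r|%:E < +oo)%E ->
  \int[mu]_(r in `[a, c]) f r =
  \int[mu]_(r in `[a, b]) f r + \int[mu]_(r in `[b, c]) f r.
Proof.
move=> ab bc foo.
have E : `[a, c]%classic = `[a, b]%classic `|` `]b, c]%classic.
  apply/seteqP; split => z /=; rewrite !in_itv/=.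
    by move=> /andP[az zc]; have [zb|zb] := leP z b; [left|right]; rewrite ?az ?zc.
  by move=> [|] /andP[H1 H2]; apply/andP; split; lra.
rewrite E Rint_setU//; last 2 first.
- apply/disj_setPS => z [/=]; rewrite !in_itv/= => /andP[_ zb] /andP[bz _].
  by move: (lt_le_trans bz zb); rewrite ltxx.
- by rewrite -E.
congr (_ + _); rewrite [LHS]Rintegral_mkcond [RHS]Rintegral_mkcond.
have mb : measurable ([set b] : set mR) by exact: measurable_set1.
apply: (Rint_null measurableT mb).
  exact: lebesgue_measure_set1.
move=> r _ /= rb; rewrite /patch; case: ifPn; rewrite ?inE ?notin_setE/= !in_itv/=.
  by move=> /andP[br rc]; rewrite mem_set//= in_itv/= (ltW br).
move=> bc'; rewrite memNset//= in_itv/= => /andP[br rc]; move: bc'.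
have [br'|rb'|br'] := ltgtP b r; first by rewrite rc.
  by move: (lt_le_trans rb' br); rewrite ltxx.
by case: rb; rewrite br'.
Qed.

Lemma int_time_split (s t : R) f : 0 <= s <= 1 -> 0 <= t <= 1 ->
  (\int[mu]_(r in `[0%R, 1%R]) `|f r|%:E < +oo)%E ->
  int_time s t f = int_time 0 t f - int_time 0 s f.
Proof.
move=> /andP[s0 s1] /andP[t0 t1] foo.
have fs (x : R) : x <= 1 -> (\int[mu]_(r in `[0%R, x]) `|f r|%:E < +oo)%E.
  move=> x1; apply: le_lt_trans foo; rewrite integral_mkcond [leRHS]integral_mkcond.
  apply: lint_mono => y _; first exact: erestrict_ge0.
  rewrite /patch; case: ifPn; rewrite ?inE/=; last by case: ifP => *; rewrite ?lee_fin.
  by rewrite in_itv/= => /andP[? ?]; rewrite mem_set//= in_itv/=; apply/andP; split; lra.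
rewrite /int_time s0 t0; case: leP => st.
  by rewrite (Rint_cc_split s0 st) ?fs// addrAC subrr add0r.
by rewrite (Rint_cc_split t0 (ltW st)) ?fs// opprD addrA subrr add0r.
Qed.

(** Only interior times are compared: reparametrized and glued fields are not controlled at the end
    points, and the coefficient of the scaling path has its pole at time 1. *)
Lemma int_time_eq (s t : R) f g : 0 <= s <= 1 -> 0 <= t <= 1 ->
  (forall r, 0 < r < 1 -> f r = g r) -> int_time s t f = int_time s t g.
Proof.
move=> /andP[s0 s1] /andP[t0 t1] fg.
have H (a b : R) : 0 <= a -> b <= 1 ->
    \int[mu]_(r in `[a, b]) f r = \int[mu]_(r in `[a, b]) g r.
  have m1 (x : R) : measurable ([set x] : set mR) by exact: measurable_set1.
  have m01 : measurable ([set 0] `|` [set 1] : set mR) by exact: measurableU.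
  have mab : measurable (`[a, b]%classic : set mR) by exact: measurable_itv.
  move=> a0 b1; apply: (Rint_null mab m01).
    apply/eqP; rewrite eq_le measure_ge0 andbT.
    apply: (le_trans (measureU2 _ (m1 0) (m1 1))).
    rewrite -[leRHS](adde0 0%E); apply: leeD; rewrite le_eqVlt; apply/orP; left;
      apply/eqP; exact: lebesgue_measure_set1.
  move=> r /=; rewrite in_itv/= => /andP[ar rb] /not_orP[r0 r1]; apply: fg.
  rewrite !lt_neqAle; apply/andP; split; apply/andP; split.
  - by apply/eqP => /esym.
  - exact: le_trans ar.
  - exact/eqP.
  - exact: le_trans b1.
by rewrite /int_time !H.
Qed.

Lemma int_time_bound (s t : R) f (g : R -> \bar R) (X : R) :
  0 <= s <= 1 -> 0 <= t <= 1 ->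
  (forall r, 0 <= r <= 1 -> (`|f r|%:E <= g r)%E) ->
  (\int[mu]_(r in `[0%R, 1%R]) g r <= X%:E)%E -> `|int_time s t f| <= X.
Proof.
move=> /andP[s0 s1] /andP[t0 t1] fg gX.
have H (a b : R) : 0 <= a -> b <= 1 -> `|\int[mu]_(r in `[a, b]) f r| <= X.
  move=> a0 b1; have sub x : `[a, b]%classic x -> `[0, 1]%classic x.
    by rewrite /= !in_itv/= => /andP[? ?]; apply/andP; split; lra.
  apply: (@Rint_bound _ mR R mu `[a, b]%classic f g).
    by move=> x xab; apply: fg; have := sub _ xab; rewrite /= in_itv.
  apply: le_trans gX.
  have g0 x : `[0, 1]%classic x -> (0 <= g x)%E.
    by rewrite /= in_itv/= => /fg; apply: le_trans; rewrite lee_fin.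
  rewrite integral_mkcond [leRHS]integral_mkcond.
  apply: lint_mono => x _; rewrite /patch; do 2?case: ifPn => //;
    rewrite ?inE ?notin_setE//.
  - by move=> xab; apply: g0; exact: sub.
  - by move=> H xab; case: H; exact: sub.
  - by move=> x01 _; exact: g0.
rewrite /int_time; case: ifP => _; first exact: H.
by rewrite normrN H.
Qed.

Lemma int_time_lfin f (g : R -> \bar R) :
  (forall r, 0 <= r <= 1 -> (`|f r|%:E <= g r)%E) ->
  (\int[mu]_(r in `[0%R, 1%R]) g r < +oo)%E ->
  (\int[mu]_(r in `[0%R, 1%R]) `|f r|%:E < +oo)%E.
Proof.
move=> fg; apply: le_lt_trans; apply: lint_mono => x; rewrite /= in_itv/= => x01.
  by rewrite lee_fin.
exact: fg.
Qed.

Lemma int_timexx t f : int_time t t f = 0.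
Proof. by rewrite /int_time lexx set_itv1 /Rintegral integral_set1. Qed.

Lemma lint01_cst (c : R) : (\int[mu]_(r in `[0%R, 1%R]) c%:E = c%:E)%E.
Proof.
have m01 : measurable (`[0, 1]%classic : set mR) by exact: measurable_itv.
rewrite (integral_cst mu m01)/= lebesgue_measure_itv/=.
by rewrite lte_fin ltr01 oppr0 adde0 mule1.
Qed.

End TimeIntegral.

(** * Positive semidefinite densities *)

Section Bilinear.
Context (R : realType) (d : nat).
Implicit Types (g : 'M[R]_d).

(** One form for both kinds of fields: [m = 1] gives [gu . v] and [m = d] gives [(gU) : V]. *)
Definition bil m g (A B : 'M[R]_(d, m)) : R := \tr (g *m A *m B^T).

Lemma dotv_bil g (u v : 'cV[R]_d) : dotv (g *m u) v = bil g u v.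
Proof.
rewrite /dotv /bil mxtrace_mulC /mxtrace big_ord1.
by rewrite -[v^T *m _]trmxK [RHS]mxE [in RHS]trmx_mul trmxK.
Qed.

Lemma frob_symr g (P : 'M[R]_d) : sym_mx g -> frob P g = bil g P 1%:M.
Proof. by move=> gs; rewrite /frob gs /bil trmx1 mulmx1 mxtrace_mulC. Qed.

Lemma bilE m g (A B : 'M[R]_(d, m)) :
  bil g A B = \sum_k \sum_i \sum_j g i j * A j k * B i k.
Proof.
rewrite /bil /mxtrace exchange_big/=; apply: eq_bigr => i _.
rewrite mxE; apply: eq_bigr => k _; rewrite !mxE mulr_suml.
by apply: eq_bigr => j _.
Qed.

Lemma bilDl m g (A A' B : 'M[R]_(d, m)) : bil g (A + A') B = bil g A B + bil g A' B.
Proof. by rewrite /bil mulmxDr mulmxDl mxtraceD. Qed.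

Lemma bilDr m g (A B B' : 'M[R]_(d, m)) : bil g A (B + B') = bil g A B + bil g A B'.
Proof. by rewrite /bil linearD/= mulmxDr mxtraceD. Qed.

Lemma bilZl m g (A B : 'M[R]_(d, m)) c : bil g (c *: A) B = c * bil g A B.
Proof. by rewrite /bil -scalemxAr -scalemxAl mxtraceZ. Qed.

Lemma bilZr m g (A B : 'M[R]_(d, m)) c : bil g A (c *: B) = c * bil g A B.
Proof. by rewrite /bil linearZ/= -scalemxAr mxtraceZ. Qed.

Lemma bil_sym m g (A B : 'M[R]_(d, m)) : sym_mx g -> bil g A B = bil g B A.
Proof.
by move=> gs; rewrite /bil -mxtrace_tr !trmx_mul trmxK gs mulmxA mxtrace_mulC mulmxA.
Qed.

(** The form is the sum of the quadratic forms of [g] at the columns of [A]. *)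
Lemma bil_ge0 m g (A : 'M[R]_(d, m)) : psd_mx g -> 0 <= bil g A A.
Proof.
move=> [gs g0]; rewrite bilE; apply: sumr_ge0 => k _.
have := g0 (col k A); rewrite dotv_bil bilE big_ord1.
by under eq_bigr do under eq_bigr do rewrite !mxE.
Qed.

(** For [e = 1] and [e = -1], expand the nonnegative value of the form at [s *: A - e *: B] and
    divide by [2 * s]. *)
Lemma bil_young m g (A B : 'M[R]_(d, m)) (s : R) : psd_mx g -> 0 < s ->
  `|bil g A B| <= s / 2 * bil g A A + s^-1 / 2 * bil g B B.
Proof.
move=> pg s0; have H (e : R) : e * e = 1 ->
    e * bil g A B <= s / 2 * bil g A A + s^-1 / 2 * bil g B B.
  move=> ee; have := bil_ge0 (s *: A - e *: B) pg.
  have -> : bil g (s *: A - e *: B) (s *: A - e *: B) =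
      s * s * bil g A A - 2 * s * (e * bil g A B) + e * e * bil g B B.
    by rewrite -scaleNr !(bilDl, bilDr, bilZl, bilZr) (bil_sym B A pg.1); ring.
  rewrite ee mul1r => H; rewrite -(ler_pM2l (_ : 0 < 2 * s)) ?mulr_gt0//.
  have -> : 2 * s * (s / 2 * bil g A A + s^-1 / 2 * bil g B B) =
     s * s * bil g A A + bil g B B by field; rewrite gt_eqF.
  lra.
have [ab|ab] := ger0P (bil g A B).
  by have := H 1 (mul1r 1); rewrite mul1r.
by have := H (-1); rewrite mulrNN mul1r mulN1r; apply.
Qed.

Lemma bilD_le m g (A B : 'M[R]_(d, m)) : psd_mx g ->
  bil g (A + B) (A + B) <= 2 * bil g A A + 2 * bil g B B.
Proof.
move=> pg; have := bil_ge0 (A - B) pg.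
rewrite -scaleN1r !(bilDl, bilDr, bilZl, bilZr) (bil_sym B A pg.1); lra.
Qed.

Lemma psd_diag_ge0 g i : psd_mx g -> 0 <= g i i.
Proof.
move=> [_ /(_ (delta_mx i 0%R))].
rewrite /dotv -colE !mxE (bigD1 i)//= big1 ?addr0 => [|j /negbTE ji].
  by rewrite !mxE eqxx/= mulr1.
by rewrite !mxE ji/= mulr0.
Qed.

Lemma psd_tr_ge0 g : psd_mx g -> 0 <= \tr g.
Proof. by move=> pg; apply: sumr_ge0 => i _; exact: psd_diag_ge0. Qed.

(** Young's inequality with parameter 1 at two basis vectors bounds an entry by the mean of two
    diagonal entries. *)
Lemma psd_entry_le g i j : psd_mx g -> `|g i j| <= \tr g.
Proof.
move=> pg; have trle k : g k k <= \tr g.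
  rewrite /mxtrace (bigD1 k)//= lerDl; apply: sumr_ge0 => l _.
  exact: psd_diag_ge0.
have E (k l : 'I_d) : bil g (delta_mx k 0 : 'cV_d) (delta_mx l 0) = g l k.
  by rewrite -dotv_bil /dotv -!colE !mxE.
have := bil_young (delta_mx j 0 : 'cV_d) (delta_mx i 0) pg ltr01.
rewrite !E; have := trle i; have := trle j; lra.
Qed.

Lemma bil_bound m g (B : 'M[R]_(d, m)) (C : R) : psd_mx g ->
  (forall i k, `|B i k| <= C) ->
  bil g B B <= (m * d * d)%:R * C ^+ 2 * \tr g.
Proof.
move=> pg BC; rewrite bilE.
have -> : (m * d * d)%:R * C ^+ 2 * \tr g =
    \sum_(k < m) \sum_(i < d) \sum_(j < d) \tr g * C * C.
  by rewrite !sumr_const !card_ord -!mulrnA !mulr_natl -mulr_natl; ring.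
apply: ler_sum => k _; apply: ler_sum => i _; apply: ler_sum => j _.
apply: le_trans (ler_norm _) _; rewrite !normrM.
by do 2!apply: ler_pM => //; rewrite ?mulr_ge0// ?psd_entry_le.
Qed.

End Bilinear.

Lemma cvg_sumr (K : numFieldType) (V : normedModType K) I (r : seq I) T
    (F : set_system T) {FF : Filter F} (f : I -> T -> V) (l : I -> V) :
  (forall i, f i x @[x --> F] --> l i) ->
  (\sum_(i <- r) f i x) @[x --> F] --> \sum_(i <- r) l i.
Proof. by move=> H; apply: cvg_big => //; exact: add_continuous. Qed.

Section Negligible.
Local Open Scope ereal_scope.
Context dd (T : measurableType dd) (R : realType) (mu : {measure set T -> \bar R}).

(** On the part of any measurable set where [h] is negative, the integral of [h] is both nonnegative
    and nonpositive. Hence [h] cut down to that part is almost everywhere 0. *)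
Lemma negligible_lt0 (h : T -> \bar R) : mu.-integrable setT h ->
  (forall A, measurable A -> 0 <= \int[mu]_(x in A) h x) ->
  mu.-negligible [set x | h x < 0].
Proof.
move=> ih h0; set A := [set x | _].
have mh : measurable_fun setT h by case/integrableP: ih.
have mA : measurable A by rewrite /A -[X in measurable X]setTI; exact: emeasurable_fun_infty_o.
have [N [mN N0 sN]] : ae_eq mu setT (h \_ A) (cst 0).
  apply: integral_ae_eq => //.
  - by apply/(integrable_mkcond h mA); apply: integrableS ih.
  - move=> E _ mE; rewrite integral0 -integral_mkcondr.
    apply/eqP; rewrite eq_le h0 ?andbT//; last exact: measurableI.
    rewrite integralE [X in X - _]integral0_eq ?sub0e ?oppe_le0 ?integral_ge0//.
    by move=> x [_ /ltW hx]; rewrite funeposE; exact/max_idPr.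
exists N; split => // x Ax; apply: sN => /= /(_ I).
by rewrite patchT ?inE// => hx; move: Ax; rewrite /A/= hx ltxx.
Qed.

End Negligible.

(** * The density is almost everywhere positive semidefinite *)

Section Density.
Context (R : realType) (d : nat).
Local Notation X := (borel_space R d).
Implicit Types (G : psd_measure R d).
Local Open Scope charge_scope.

Lemma density_EFin G i j x :
  (density G x i j)%:E = ('d (G i j) '/d (trace_measure G)) x.
Proof.
by rewrite mxE fineK//; exact/Radon_Nikodym_fin_num/dominated_trace.
Qed.

Lemma density_integrable G i j :
  (trace_measure G).-integrable setT (fun x => (density G x i j)%:E).
Proof.
rewrite (_ : (fun x => _) = 'd (G i j) '/d (trace_measure G)); last first.
  by apply/funext => x; rewrite density_EFin.
exact/Radon_Nikodym_integrable/dominated_trace.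
Qed.

Lemma integral_density G i j (A : set X) : measurable A ->
  (\int[trace_measure G]_(x in A) (density G x i j)%:E = G i j A)%E.
Proof.
move=> mA; rewrite (Radon_Nikodym_integral (@dominated_trace _ _ G i j) mA).
by apply: eq_integral => x _; rewrite density_EFin.
Qed.

Lemma integrable_bil_density G m (v w : 'M[R]_(d, m)) :
  (trace_measure G).-integrable setT (fun x => (bil (density G x) v w)%:E).
Proof.
under eq_fun do rewrite bilE -sumEFin.
apply: integrable_sum => // k _.
under eq_fun do rewrite -sumEFin.
apply: integrable_sum => // i _.
under eq_fun do rewrite -sumEFin.
apply: integrable_sum => // j _.
under eq_fun do rewrite -mulrA mulrC EFinM.
by apply: integrableZl => //; exact: density_integrable.
Qed.

Lemma integral_bil_density G m (v w : 'M[R]_(d, m)) (A : set X) : measurable A ->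
  (\int[trace_measure G]_(x in A) (bil (density G x) v w)%:E =
   (bil (\matrix_(i, j) fine (G i j A)) v w)%:E)%E.
Proof.
move=> mA; under eq_integral do rewrite bilE -sumEFin.
have iD i j : (trace_measure G).-integrable A (fun x => (density G x i j)%:E).
  by apply: integrableS (density_integrable G i j).
have iZ i j c e : (trace_measure G).-integrable A
    (fun x => (density G x i j * c * e)%:E).
  under eq_fun do rewrite -mulrA mulrC EFinM.
  exact: integrableZl.
have iS k i : (trace_measure G).-integrable A
    (fun x => (\sum_j density G x i j * v j k * w i k)%:E).
  under eq_fun do rewrite -sumEFin.
  by apply: integrable_sum.
rewrite integral_sum//; last first.
  move=> k; under eq_fun do rewrite -sumEFin.
  by apply: integrable_sum.
rewrite bilE -sumEFin; apply: eq_bigr => k _.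
under eq_integral do rewrite -sumEFin.
rewrite integral_sum// -sumEFin; apply: eq_bigr => i _.
under eq_integral do rewrite -sumEFin.
rewrite integral_sum// -sumEFin; apply: eq_bigr => j _.
under eq_integral do rewrite -mulrA mulrC EFinM.
rewrite integralZl// integral_density// mxE -mulrA [in RHS]mulrC EFinM.
by rewrite -EFinM -(pm_entryE G i j mA).
Qed.

Lemma density_sym_null G :
  (trace_measure G).-negligible [set x | ~ sym_mx (density G x)].
Proof.
have H i j : (trace_measure G).-negligible
    [set x | density G x i j <> density G x j i].
  have [N [mN N0 sN]] : ae_eq (trace_measure G) setT
      (fun x => (density G x i j)%:E) (fun x => (density G x j i)%:E).
    apply: integral_ae_eq => //; first exact: density_integrable.
      by case/integrableP : (density_integrable G j i).
    move=> E _ mE; rewrite !integral_density//.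
    have [sM _] := pm_psd G mE; rewrite -(pm_entryE G i j mE) -(pm_entryE G j i mE); congr EFin.
    by move/matrixP : sM => /(_ j i); rewrite !mxE.
  by exists N; split => // x /= ne; apply: sN => /= /(_ I)[].
have : (trace_measure G).-negligible
    (\bigcup_k [set x | if unpickle k is Some (i, j) then
        density G x i j <> density G x j i else False]).
  apply: negligible_bigcup => k; case: (unpickle k) => [[i j]|]; first exact: H.
  by exists set0; split.
apply: negligibleS => x /= ns.
have [i [j ij]] : exists i j, density G x i j <> density G x j i.
  apply: contrapT => H'; apply: ns; apply/matrixP => i j; rewrite mxE.
  by apply: contrapT => ji; apply: H'; exists j, i.
by exists (pickle (i, j)) => //=; rewrite pickleK.
Qed.

(** For a fixed vector the integral of the quadratic form over [A] is the form of the matrix [G(A)],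
    hence nonnegative, and the form is nonnegative off a null set. Countably many rational vectors
    give one null set; off it, continuity excludes a negative value at a real vector. *)
Lemma density_psd_null G :
  (trace_measure G).-negligible [set x | ~ psd_mx (density G x)].
Proof.
pose rv (v : 'cV[rat]_d) : 'cV[R]_d := \col_i ratr (v i 0).
have H v : (trace_measure G).-negligible
    [set x | bil (density G x) (rv v) (rv v) < 0].
  have := @negligible_lt0 _ _ _ (trace_measure G)
    (fun x => (bil (density G x) (rv v) (rv v))%:E).
  apply; first exact: integrable_bil_density.
  move=> A mA; rewrite integral_bil_density// lee_fin.
  by apply: bil_ge0; exact: pm_psd.
have : (trace_measure G).-negligible ([set x | ~ sym_mx (density G x)] `|`
    (\bigcup_k [set x | if unpickle k is Some v then
        bil (density G x) (rv v) (rv v) < 0 else False])).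
  apply: negligibleU; first exact: density_sym_null.
  apply: negligible_bigcup => k; case: (unpickle k) => [v|]; first exact: H.
  by exists set0; split.
apply: negligibleS => x /= ns.
have [s|] := pselect (sym_mx (density G x)); last by left.
right; have [v qv] : exists v : 'cV[R]_d, bil (density G x) v v < 0.
  apply: contrapT => H'; apply: ns; split => // v; rewrite dotv_bil leNgt.
  by apply/negP => qv; apply: H'; exists v.
set g := density G x in qv *.
have cq : continuous (fun w : 'cV[R]_d => bil g w w).
  under eq_fun do rewrite bilE.
  move=> w; do 3!apply: (@cvg_sumr _ _ _ _ _ (nbhs w) (nbhs_filter w)) => ?.
  by apply: cvgM; [apply: cvgM; [exact: cvg_cst|exact: coord_continuous]|
    exact: coord_continuous].
have /nbhs_ballP[e /= e0 He] : \forall w \near v, bil g w w < 0.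
  exact: (cq v [set y | y < 0] (lt_nbhsl qv)).
have /choice[r hr] (i : 'I_d) : exists r : rat, `|v i 0 - ratr r| < e.
  have [|r] := @rat_in_itvoo R (v i 0 - e) (v i 0 + e); first by lra.
  by rewrite in_itv/= => /andP[r1 r2]; exists r; rewrite ltr_norml; lra.
exists (pickle (\col_i r i : 'cV[rat]_d)) => //=; rewrite pickleK.
apply: He; split => // i j; rewrite !mxE ord1; exact: hr.
Qed.

End Density.

Section NullSets.
Local Open Scope ereal_scope.
Context dd (T : measurableType dd) (R : realType).
Implicit Types (mu : {measure set T -> \bar R}).

Lemma int_null mu D N (f g : T -> \bar R) : measurable D -> measurable N ->
  mu N = 0 -> (forall x, D x -> ~ N x -> f x = g x) ->
  \int[mu]_(x in D) f x = \int[mu]_(x in D) g x.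
Proof.
move=> mD mN N0 fg; rewrite integralE [in RHS]integralE.
congr (_ - _); apply: (lint_null mD mN N0) => // x Dx Nx.
  by rewrite !funeposE fg.
by rewrite !funenegE fg.
Qed.

Lemma negligible_forall mu (I : countType) (P : I -> T -> Prop) :
  (forall i, mu.-negligible [set x | ~ P i x]) ->
  mu.-negligible [set x | ~ forall i, P i x].
Proof.
move=> H; have : mu.-negligible
    (\bigcup_k [set x | if unpickle k is Some i then ~ P i x else False]).
  apply: negligible_bigcup => k; case: (unpickle k) => [i|]; first exact: H.
  by exists set0; split.
apply: negligibleS => x /= /existsNP[i Pi].
by exists (pickle i) => //=; rewrite pickleK.
Qed.

End NullSets.

(** * Energy and pairings written with the representative [rd] *)

Section Energy.
Context (R : realType) (d : nat).
Local Notation X := (borel_space R d).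
Implicit Types (G : psd_measure R d).

Definition rd_null G : set X := sval (cid (density_psd_null G)).

(* Zero on the exceptional null set, hence positive semidefinite everywhere. *)
Definition rd G (x : X) : 'M[R]_d :=
  if x \in rd_null G then 0 else density G x.

Lemma rd_nullP G : [/\ measurable (rd_null G), trace_measure G (rd_null G) = 0%E &
  forall x, ~ rd_null G x -> rd G x = density G x].
Proof.
rewrite /rd /rd_null; case: cid => N [mN N0 sN] /=; split => // x Nx.
by rewrite memNset.
Qed.

Lemma rd_psd G x : psd_mx (rd G x).
Proof.
rewrite /rd; case: ifPn => [_|].
  by split; [rewrite /sym_mx trmx0|move=> v; rewrite dotv_bil /bil !mul0mx mxtrace0].
rewrite notin_setE /rd_null; case: cid => N [mN N0 sN] /= Nx.
by apply: contrapT => px; exact/Nx/sN.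
Qed.

Lemma rd_measurable G i j : measurable_fun setT (fun x => rd G x i j).
Proof.
have [mN _ _] := rd_nullP G.
have md : measurable_fun setT (fun x => density G x i j).
  by apply/measurable_EFinP; case/integrableP: (density_integrable G i j).
rewrite (_ : (fun x => _) = (fun x => density G x i j) \_ (~` rd_null G)).
  apply/(measurable_restrictT _ _).1; first exact: measurableC.
  exact: measurable_funS md.
apply/funext => x; rewrite /rd /patch in_setC.
by case: (x \in rd_null G); rewrite ?mxE.
Qed.

Lemma rd_integrable G i j :
  (trace_measure G).-integrable setT (fun x => (rd G x i j)%:E).
Proof.
apply: le_integrable (density_integrable G i j) => //.
  by apply/measurable_EFinP; exact: rd_measurable.
move=> x _; rewrite lee_fin /rd; case: ifP => // _; rewrite !mxE normr0//.
Qed.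

Definition mass G : R := \int[trace_measure G]_x \tr (rd G x).

Definition En m G (A : 'cV[R]_d -> 'M[R]_(d, m)) : \bar R :=
  (\int[trace_measure G]_x (bil (rd G x) (A x) (A x))%:E)%E.

Definition Jn m G (A B : 'cV[R]_d -> 'M[R]_(d, m)) : R :=
  \int[trace_measure G]_x bil (rd G x) (A x) (B x).

Lemma rd_tr_measurable G : measurable_fun setT (fun x => \tr (rd G x)).
Proof. by apply: measurable_sum => i; exact: rd_measurable. Qed.

Lemma massE G : (\int[trace_measure G]_x (\tr (rd G x))%:E = (mass G)%:E)%E.
Proof.
rewrite fineK//; apply: integrable_fin_num => //.
under eq_fun do rewrite /mxtrace -sumEFin.
by apply: integrable_sum => // i _; exact: rd_integrable.
Qed.

Lemma mass_ge0 G : 0 <= mass G.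
Proof.
rewrite -lee_fin -massE; apply: integral_ge0 => x _.
by rewrite lee_fin psd_tr_ge0//; exact: rd_psd.
Qed.

Lemma En_ge0 m G (A : 'cV[R]_d -> 'M[R]_(d, m)) : (0 <= En G A)%E.
Proof. by apply: integral_ge0 => x _; rewrite lee_fin bil_ge0//; exact: rd_psd. Qed.

Lemma int_vvE G u v : int_vv G u v = Jn G u v.
Proof.
have [mN N0 E] := rd_nullP G.
by apply: (Rint_null measurableT mN N0) => x _ Nx; rewrite E// dotv_bil.
Qed.

Lemma int_mmE G U V : int_mm G U V = Jn G U V.
Proof.
have [mN N0 E] := rd_nullP G.
by apply: (Rint_null measurableT mN N0) => x _ Nx; rewrite E.
Qed.

Lemma int_mE G Phi : int_m G Phi = Jn G Phi (fun=> 1%:M).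
Proof.
have [mN N0 E] := rd_nullP G.
apply: (Rint_null measurableT mN N0) => x _ Nx; rewrite -E// frob_symr//.
by have [] := rd_psd G x.
Qed.

Lemma energy_vE G u :
  (\int[trace_measure G]_x (dotv (density G x *m u x) (u x))%:E = En G u)%E.
Proof.
have [mN N0 E] := rd_nullP G.
by apply: (int_null measurableT mN N0) => x _ Nx; rewrite E// dotv_bil.
Qed.

Lemma energy_mE G U :
  (\int[trace_measure G]_x (frob (density G x *m U x) (U x))%:E = En G U)%E.
Proof.
have [mN N0 E] := rd_nullP G.
by apply: (int_null measurableT mN N0) => x _ Nx; rewrite E.
Qed.

(** The number of terms in the expansion [bilE], hence the constant of the crude bound
    [bil_bound]. *)
Definition kdim m : R := (m * d * d)%:R.

Lemma kdim_ge0 m : 0 <= kdim m.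
Proof. exact: ler0n. Qed.

(** The energy density of [A] may fail to be measurable, but the trace term is measurable, which is
    what [lintD_le] asks of one summand. *)
Lemma lint_tr_bound m G (f : X -> \bar R) (A : 'cV[R]_d -> 'M[R]_(d, m)) (s K : R) :
  0 <= s -> 0 <= K -> (forall x, 0 <= f x)%E ->
  (forall x, f x <= s%:E * (bil (rd G x) (A x) (A x))%:E + (K * \tr (rd G x))%:E)%E ->
  (\int[trace_measure G]_x f x <= s%:E * En G A + (K * mass G)%:E)%E.
Proof.
move=> s0 K0 f0 fle.
have b0 (x : X) : (0 <= (bil (rd G x) (A x) (A x))%:E)%E.
  by rewrite lee_fin bil_ge0//; exact: rd_psd.
have t0 (x : X) : 0 <= \tr (rd G x) by apply: psd_tr_ge0; exact: rd_psd.
apply: (@le_trans _ _ (\int[trace_measure G]_x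
    (s%:E * (bil (rd G x) (A x) (A x))%:E + (K * \tr (rd G x))%:E))%E).
  exact: lint_mono.
have mK : measurable_fun setT (fun x : X => K * \tr (rd G x)).
  by apply: measurable_funM => //; exact: rd_tr_measurable.
have K0' (x : X) : 0 <= K * \tr (rd G x) by rewrite mulr_ge0.
have sb0 (x : X) : setT x -> (0 <= s%:E * (bil (rd G x) (A x) (A x))%:E)%E.
  by move=> _; rewrite mule_ge0// lee_fin.
apply: le_trans (lintD_le (trace_measure G) measurableT sb0 mK K0') _.
rewrite lintZ//; apply: leeD => //.
under eq_integral do rewrite EFinM.
by rewrite lintZ ?massE ?EFinM// => x _; rewrite lee_fin.
Qed.

Lemma Jn_young m G (A B : 'cV[R]_d -> 'M[R]_(d, m)) (s C : R) : 0 < s ->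
  (forall x i k, `|B x i k| <= C) ->
  (`|Jn G A B|%:E <=
   (s / 2)%:E * En G A + (s^-1 / 2 * (kdim m * C ^+ 2) * mass G)%:E)%E.
Proof.
move=> s0 BC; set Y := (X in (_ <= X)%E).
have K0 : 0 <= s^-1 / 2 * (kdim m * C ^+ 2).
  apply: mulr_ge0; last by apply: mulr_ge0; [exact: kdim_ge0|exact: sqr_ge0].
  by apply: divr_ge0 => //; apply: ltW; rewrite invr_gt0.
have H : (\int[trace_measure G]_x (`|bil (rd G x) (A x) (B x)|)%:E <= Y)%E.
  apply: (@lint_tr_bound m G _ A (s / 2)) => //.
    by apply: divr_ge0 => //; exact: ltW.
  move=> x; rewrite -EFinM -EFinD lee_fin.
  apply: le_trans (bil_young _ _ (rd_psd G x) s0) _; rewrite lerD2l -[leRHS]mulrA.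
  apply: ler_wpM2l; last by apply: bil_bound => //; exact: rd_psd.
  by apply: divr_ge0 => //; apply: ltW; rewrite invr_gt0.
have Y0 : (0 <= Y)%E.
  by apply: le_trans H; apply: integral_ge0 => x _; rewrite lee_fin.
(* [Rint_bound] needs a real bound; if the energy of [A] makes [Y] infinite, the claim is
   trivial. *)
move: Y0 H; case: Y => [y| |]// _ H; last by rewrite leey.
rewrite lee_fin; exact: (Rint_bound _ H).
Qed.

Lemma EnD_le m G (A B : 'cV[R]_d -> 'M[R]_(d, m)) (C : R) :
  (forall x i k, `|B x i k| <= C) ->
  (En G (fun x => (A x + B x)%R) <= 2%:E * En G A + (2 * (kdim m * C ^+ 2) * mass G)%:E)%E.
Proof.
move=> BC; apply: lint_tr_bound => //.
- by apply: mulr_ge0 => //; apply: mulr_ge0; [exact: kdim_ge0|exact: sqr_ge0].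
- by move=> x; rewrite lee_fin bil_ge0//; exact: rd_psd.
- move=> x; rewrite -EFinM -EFinD lee_fin.
  apply: le_trans (bilD_le _ _ (rd_psd G x)) _; rewrite lerD2l -[leRHS]mulrA.
  by apply: ler_wpM2l => //; apply: bil_bound => //; exact: rd_psd.
Qed.

Lemma En_bound m G (B : 'cV[R]_d -> 'M[R]_(d, m)) (C : R) :
  (forall x i k, `|B x i k| <= C) ->
  (En G B <= (kdim m * C ^+ 2 * mass G)%:E)%E.
Proof.
move=> BC; have K0 : 0 <= kdim m * C ^+ 2 by apply: mulr_ge0; [exact: kdim_ge0|exact: sqr_ge0].
have := @lint_tr_bound m G _ B 0 (kdim m * C ^+ 2)  _ K0
  (fun x => _ : (0 <= (bil (rd G x) (B x) (B x))%:E)%E).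
rewrite mul0e add0e; apply => // x; rewrite ?mul0e ?add0e lee_fin.
  exact/bil_ge0/rd_psd.
exact/bil_bound/BC/rd_psd.
Qed.

Lemma Jn_bound m G (A B : 'cV[R]_d -> 'M[R]_(d, m)) (C : R) :
  (forall x i k, `|A x i k| <= C) -> (forall x i k, `|B x i k| <= C) ->
  `|Jn G A B| <= kdim m * C ^+ 2 * mass G.
Proof.
move=> AC BC; rewrite -lee_fin; apply: le_trans (@Jn_young m G A B 1 C ltr01 BC) _.
apply: (@le_trans _ _ ((1 / 2)%:E * (kdim m * C ^+ 2 * mass G)%:E +
   (1^-1 / 2 * (kdim m * C ^+ 2) * mass G)%:E)%E).
  by apply: leeD => //; rewrite lee_pmul2l ?En_bound// lte_fin; lra.
by rewrite -EFinM -EFinD lee_fin invr1; lra.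
Qed.

Lemma EnZ m G (A : 'cV[R]_d -> 'M[R]_(d, m)) (c : R) :
  En G (fun x => c *: A x) = ((c ^+ 2)%:E * En G A)%E.
Proof.
rewrite -lintZ ?sqr_ge0//; last first.
  by move=> x _; rewrite lee_fin bil_ge0//; exact: rd_psd.
by apply: eq_integral => x _; rewrite bilZl bilZr -EFinM expr2 mulrA.
Qed.

Lemma JnZl m G (A B : 'cV[R]_d -> 'M[R]_(d, m)) (c : R) :
  Jn G (fun x => c *: A x) B = c * Jn G A B.
Proof.
by rewrite -RintZ//; apply: eq_Rintegral => x _; rewrite bilZl.
Qed.

End Energy.

(** * Proportional matrix measures *)

Section Scaling.
Context (R : realType) (d : nat).
Local Notation X := (borel_space R d).
Implicit Types (G H : psd_measure R d).

(** For [c = 1] this is [pm_eq]. Measures equal on Borel sets may still come with different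
    Radon-Nikodym representatives, so independence of the representative is proved together with
    scaling. *)
Definition pm_scale (c : R) G H : Prop :=
  forall (i j : 'I_d) (A : set X), measurable A -> H i j A = (c%:E * G i j A)%E.

Lemma pm_scale1 G H : pm_eq H G -> pm_scale 1 G H.
Proof. by move=> GH i j A mA; rewrite mul1e GH. Qed.

Lemma trace_scale c G H : 0 <= c -> pm_scale c G H ->
  forall A, measurable A -> trace_measure H A = (c%:E * trace_measure G A)%E.
Proof.
move=> c0 GH A mA; rewrite !trace_measureE// ge0_sume_distrr//; last first.
  by move=> i _; exact: pm_diag_ge0.
by apply: eq_bigr => i _; rewrite GH.
Qed.

(** Entries and trace are multiplied by the same positive [c], which cancels in the density. *)
Lemma density_scale c G H : 0 < c -> pm_scale c G H ->
  (trace_measure G).-negligible [set x | density H x <> density G x].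
Proof.
move=> c0 GH; have cge0 := ltW c0; have mc := trace_scale cge0 GH.
have iH i j : (trace_measure G).-integrable setT (fun x => (density H x i j)%:E).
  have /integrableP[mh ih] := density_integrable H i j.
  apply/integrableP; split => //; move: ih.
  rewrite (lint_measureZ cge0 mc)// => ih; rewrite ltNge leye_eq; apply/negP => /eqP E.
  by move: ih; rewrite E gt0_muley ?lte_fin// ltxx.
have E i j : ae_eq (trace_measure G) setT
    (fun x => (density H x i j)%:E) (fun x => (density G x i j)%:E).
  apply: integral_ae_eq => //.
    by case/integrableP : (density_integrable G i j).
  move=> B _ mB; have fB K : (trace_measure G).-integrable setT K ->
      ((fine (\int[trace_measure G]_(x in B) K x))%:E =
       \int[trace_measure G]_(x in B) K x)%E.
    by move=> iK; rewrite fineK//; apply: integrable_fin_num => //; exact: integrableS iK.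
  rewrite -(fB _ (iH i j)) integral_density//.
  have := integral_density H i j mB; rewrite GH// => /(congr1 fine).
  rewrite -[X in X = _ -> _]/(\int[trace_measure H]_(x in B) (density H x i j)).
  rewrite (Rint_measureZ _ cge0 mc mB) -pm_entryE// -EFinM/=.
  by move=> /(mulfI (lt0r_neq0 c0)); rewrite /Rintegral => ->; rewrite pm_entryE.
have := @negligible_forall _ _ _ (trace_measure G) ('I_d * 'I_d)%type
  (fun ij x => density H x ij.1 ij.2 = density G x ij.1 ij.2).
move=> /(_ _)/negligibleS; apply.
  move=> x /= ne Hx; apply: ne; apply/matrixP => i j; exact: (Hx (i, j)).
move=> [i j]; have [N [mN N0 sN]] := E i j; exists N; split => // x /= ne.
by apply: sN => /= /(_ I)[].
Qed.

Lemma rd_scale c G H : 0 < c -> pm_scale c G H -> exists N : set X,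
  [/\ measurable N, trace_measure G N = 0%E & forall x, ~ N x -> rd H x = rd G x].
Proof.
move=> c0 GH; have [M [mM M0 sM]] := density_scale c0 GH.
have [mN N0 EG] := rd_nullP G; have [mN' N0' EH] := rd_nullP H.
exists (M `|` (rd_null G `|` rd_null H)); split.
- by apply: measurableU => //; exact: measurableU.
- have nN' : trace_measure G (rd_null H) = 0%E.
    apply/eqP; have /eqP := trace_scale (ltW c0) GH mN'.
    by rewrite N0' eq_sym mule_eq0 eqe (gt_eqF c0).
  apply/(negligibleP _ (measurableU _ _ mM (measurableU _ _ mN mN'))).
  by apply: negligibleU; [|apply: negligibleU]; apply/negligibleP.
- move=> x /not_orP[Mx /not_orP[nG nH]]; rewrite EG// EH//.
  by apply: contrapT => ne; exact/Mx/sM.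
Qed.

(** For [c = 0] the two densities are unrelated, but both sides vanish. *)
Lemma lint_rd_scale c G H (F : 'M[R]_d -> X -> \bar R) : 0 <= c ->
  pm_scale c G H -> (forall x, 0 <= F (rd G x) x)%E -> (forall x, 0 <= F (rd H x) x)%E ->
  (\int[trace_measure H]_x F (rd H x) x =
   c%:E * \int[trace_measure G]_x F (rd G x) x)%E.
Proof.
move=> c0 GH FG FH; rewrite (lint_measureZ c0 (trace_scale c0 GH))//.
move: c0; rewrite le_eqVlt => /predU1P[<-|c0]; first by rewrite !mul0e.
have [N [mN N0 E]] := rd_scale c0 GH; congr (_ * _)%E.
by apply: (lint_null measurableT mN N0) => // x _ Nx; rewrite E.
Qed.

Lemma Rint_rd_scale c G H (F : 'M[R]_d -> X -> R) : 0 <= c ->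
  pm_scale c G H ->
  \int[trace_measure H]_x F (rd H x) x = c * \int[trace_measure G]_x F (rd G x) x.
Proof.
move=> c0 GH; rewrite (Rint_measureZ _ c0 (trace_scale c0 GH))//.
move: c0; rewrite le_eqVlt => /predU1P[<-|c0]; first by rewrite !mul0r.
have [N [mN N0 E]] := rd_scale c0 GH; congr (_ * _).
by apply: (Rint_null measurableT mN N0) => // x _ Nx; rewrite E.
Qed.

Lemma En_scale m c G H (A : 'cV[R]_d -> 'M[R]_(d, m)) : 0 <= c ->
  pm_scale c G H -> (En H A = c%:E * En G A)%E.
Proof.
move=> c0 GH; apply: (@lint_rd_scale c G H (fun g x => (bil g (A x) (A x))%:E)) => //;
  by move=> x; rewrite lee_fin bil_ge0//; exact: rd_psd.
Qed.

Lemma Jn_scale m c G H (A B : 'cV[R]_d -> 'M[R]_(d, m)) : 0 <= c ->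
  pm_scale c G H -> Jn H A B = c * Jn G A B.
Proof.
by move=> c0 GH; exact: (@Rint_rd_scale c G H (fun g x => bil g (A x) (B x))).
Qed.

Lemma int_scalarE G phi i j :
  int_scalar G phi i j = \int[trace_measure G]_x (phi x * rd G x i j).
Proof.
rewrite mxE; have [mN N0 E] := rd_nullP G.
by apply: (Rint_null measurableT mN N0) => x _ Nx; rewrite E.
Qed.

Lemma int_scalar_scale c G H phi : 0 <= c -> pm_scale c G H ->
  int_scalar H phi = c *: int_scalar G phi.
Proof.
move=> c0 GH; apply/matrixP => i j; rewrite [RHS]mxE !int_scalarE.
exact: (@Rint_rd_scale c G H (fun g x => phi x * g i j)).
Qed.

(** Expresses the mass by integrals of a bounded continuous function, to which narrow continuity
    applies. *)
Lemma mass_int_scalar G : mass G = \tr (int_scalar G (fun=> 1)).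
Proof.
apply: EFin_inj; rewrite -massE.
under eq_integral do rewrite /mxtrace -sumEFin.
rewrite integral_sum//; last by move=> i; exact: rd_integrable.
rewrite /mxtrace -sumEFin; apply: eq_bigr => i _.
rewrite int_scalarE fineK; last first.
  apply: integrable_fin_num => //; under eq_fun do rewrite mul1r.
  exact: rd_integrable.
by under [RHS]eq_integral do rewrite mul1r.
Qed.

Section Make.
Variables (c : R) (c0 : 0 <= c) (G : psd_measure R d).

Let entry (i j : 'I_d) : {charge set X -> \bar R} := cscale c (G i j).

Let entry_psd (A : set X) : measurable A ->
  psd_mx (\matrix_(i, j) fine (entry i j A)).
Proof.
move=> mA; rewrite (_ : \matrix_(i, j) _ = c *: \matrix_(i, j) fine (G i j A)).
  have [sM pM] := pm_psd G mA; split.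
    by rewrite /sym_mx linearZ/= sM.
  move=> v; rewrite dotv_bil /bil -!scalemxAl mxtraceZ.
  by have := pM v; rewrite dotv_bil; exact: mulr_ge0.
by apply/matrixP => i j; rewrite !mxE /entry /cscale/= fineM// fin_num_measure.
Qed.

Definition scale_pm : psd_measure R d := PsdMeasure entry_psd.

Lemma scale_pmP : pm_scale c G scale_pm.
Proof. by []. Qed.

End Make.

End Scaling.

(** * Bounded C^1 fields *)

Section SmoothFields.
Context (R : realType) (d : nat) (V : normedModType R).
Implicit Types (f g df : R -> 'cV[R]_d -> V) (S : set R) (p : {poly R}).
Local Notation C := ('cV[R]_d).

Definition HasD S f df : Prop := forall t x, S t ->
  dquot_t f t x s @[s --> within S t^'] --> df t x.

Definition CB S f : Prop :=
  {within S `*` setT, continuous (fun q : R * C => f q.1 q.2)} /\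
  exists M : R, forall t x, S t -> `|f t x| <= M.

(* [C1b] over a set [S] of times, with the derivatives named. *)
Definition C1S S f df (dx : 'I_d -> R -> C -> V) : Prop :=
  [/\ HasD S f df,
      forall t x k, S t -> is_derive x (basis_vec R k) (f t) (dx k t x),
      CB S f, CB S df & forall k, CB S (dx k)].

Lemma HasDP S f df : HasD S f df <->
  forall t x, S t -> forall P, nbhs (df t x) P ->
    \forall s \near t, s != t -> S s -> P (dquot_t f t x s).
Proof.
by split => H t x St P; have := H t x St P.
Qed.

Lemma CBP S f : {within S `*` setT, continuous (fun q : R * C => f q.1 q.2)} <->
  forall t x, S t -> forall P, nbhs (f t x) P ->
    \forall q \near ((t, x) : R * C), S q.1 -> P (f q.1 q.2).
Proof.
split=> [/subspace_continuousP H t x St P NP|H].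
  apply: (@filterS _ (nbhs ((t, x) : R * C)) _ _ _ _ (H (t, x) (conj St I) P NP)).
  move=> q Hq Sq.
  by apply: Hq; split.
apply/subspace_continuousP => -[t x] [/= St _] P NP.
apply: (@filterS _ (nbhs ((t, x) : R * C)) _ _ _ _ (H t x St P NP)) => q Hq [Sq _].
exact: Hq.
Qed.

Lemma HasD_ext S f g df dg : (forall t x, S t -> f t x = g t x) ->
  (forall t x, S t -> df t x = dg t x) -> HasD S f df -> HasD S g dg.
Proof.
move=> fg dfg /HasDP H; apply/HasDP => t x St P; rewrite -dfg// => NP.
have := H t x St P NP; apply: filterS => s Hs st Ss.
by rewrite /dquot_t -!fg//; exact: Hs.
Qed.

Lemma CB_ext S f g : (forall t x, S t -> f t x = g t x) -> CB S f -> CB S g.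
Proof.
move=> fg [/CBP H [M HM]]; split; last by exists M => t x St; rewrite -fg// HM.
apply/CBP => t x St P; rewrite -fg// => NP.
have := H t x St P NP; apply: filterS => q Hq Sq.
by rewrite -fg//; exact: Hq.
Qed.

Lemma CB_slice S f t : CB S f -> S t -> continuous (f t).
Proof.
move=> [/CBP H _] St x P NP; have := H t x St P NP.
move=> [[A B] /= [A1 B1] AB]; have At := nbhs_singleton A1.
by apply: filterS B1 => y By; exact: (AB (t, y)).
Qed.

Lemma CB_slice_t S f x : CB S f -> {within S, continuous (f ^~ x)}.
Proof.
move=> [/CBP H _]; apply/subspace_continuousP => t St P NP.
have [[A B] /= [A1 B1] AB] := H t x St P NP.
have Bx := nbhs_singleton B1.
by apply: filterS A1 => s As Ss; exact: (AB (s, x)).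
Qed.

Lemma CB_poly S f p : S `<=` `[0, 1] -> CB S f -> CB S (fun t x => p.[t] *: f t x).
Proof.
move=> S01 [Hc [M HM]]; split.
  apply/subspace_continuousP => -[t x] [/= St _]; apply: cvgZ.
    apply: cvg_within_filter.
    apply: (@cvg_comp _ _ _ (fun q : R * C => q.1) (horner p) _ (nbhs t)).
      exact: cvg_fst.
    exact: continuous_horner.
  by move/subspace_continuousP: Hc => /(_ (t, x)); apply; split.
have cp : {within `[0, 1], continuous (fun t : R => `|p.[t]|)}.
  apply: continuous_subspaceT => t; apply: cvg_norm; exact: continuous_horner.
have [c _ Hc'] := EVT_max ler01 cp.
exists (`|p.[c]| * `|M|) => t x St; rewrite normrZ ler_pM//.
  by apply: Hc'; exact: S01.
by apply: le_trans (HM _ _ St) _; exact: ler_norm.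
Qed.

Lemma CB_add S f g : CB S f -> CB S g -> CB S (fun t x => f t x + g t x).
Proof.
move=> [/subspace_continuousP Hf [M HM]] [/subspace_continuousP Hg [N HN]]; split.
  by apply/subspace_continuousP => q Sq; apply: cvgD; [exact: Hf|exact: Hg].
exists (M + N) => t x St; apply: le_trans (ler_normD _ _) _.
by rewrite lerD ?HM ?HN.
Qed.

Lemma CB_affine S S' f (a b : R) : (forall t, S t -> S' (a * t + b)) -> CB S' f ->
  CB S (fun t x => f (a * t + b) x).
Proof.
move=> SS [/CBP Hc [M HM]]; split; last by exists M => t x /SS St; exact: HM.
apply/(@CBP S (fun t x => f (a * t + b) x)) => t x St P NP.
have Hc' := Hc _ x (SS _ St) P NP.
have : (fun q : R * C => (a * q.1 + b, q.2)) @ ((t, x) : R * C) -->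
    ((a * t + b, x) : R * C).
  have H1 : (fun q : R * C => a * q.1 + b) @ ((t, x) : R * C) --> a * t + b; last first.
    exact: (cvg_pair H1 (@cvg_snd _ _ _ _ _)).
  apply: (@cvg_comp _ _ _ (fun q : R * C => q.1) (fun r => a * r + b) _ (nbhs t)).
    exact: cvg_fst.
  by apply: cvgD; [apply: cvgM; [exact: cvg_cst|exact: cvg_id]|exact: cvg_cst].
move=> K; apply: (@filterS _ (nbhs ((t, x) : R * C)) _ _ _ _ (K _ Hc')) => q Hq Sq.
by apply: Hq => /=; exact: SS.
Qed.

(** At a point outside one of the closed sets, its complement is a neighbourhood and the condition
    relative to that set is void; so the two relative conditions can simply be intersected.
    [HasD_union] follows the same pattern. *)
Lemma CB_union S S' f : closed S -> closed S' -> CB S f -> CB S' f ->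
  CB (S `|` S') f.
Proof.
move=> cS cS' [/CBP H [M HM]] [/CBP H' [M' HM']]; split.
  have K (W : set R) t x : closed W ->
    (forall t x, W t -> forall P, nbhs (f t x) P ->
      \forall q \near ((t, x) : R * C), W q.1 -> P (f q.1 q.2)) ->
    forall P, nbhs (f t x) P ->
      \forall q \near ((t, x) : R * C), W q.1 -> P (f q.1 q.2).
    move=> cW HW P NP; have [Wt|nWt] := pselect (W t); first exact: HW.
    have oW : open (~` W) by exact: closed_openC.
    have Nt : nbhs t (~` W) by exact: open_nbhs_nbhs.
    have : (fun q : R * C => q.1) @ ((t, x) : R * C) --> t by exact: cvg_fst.
    by move=> L; apply: (@filterS _ (nbhs ((t, x) : R * C)) _ _ _ _ (L _ Nt)).
  apply/CBP => t x _ P NP.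
  apply: (@filterS2 _ (nbhs ((t, x) : R * C)) _ _ _ _ _ (K S t x cS H P NP)
    (K S' t x cS' H' P NP)) => q h h' [Sq|Sq]; [exact: h|exact: h'].
exists (Num.max M M') => t x [St|St]; rewrite le_max ?(HM _ _ St) ?(HM' _ _ St)//.
by rewrite orbT.
Qed.

Lemma HasD_union S S' f df : closed S -> closed S' -> HasD S f df ->
  HasD S' f df -> HasD (S `|` S') f df.
Proof.
move=> cS cS' /HasDP H /HasDP H'; apply/HasDP => t x _ P NP.
have K (W : set R) : closed W ->
    (W t -> \forall s \near t, s != t -> W s -> P (dquot_t f t x s)) ->
    \forall s \near t, s != t -> W s -> P (dquot_t f t x s).
  move=> cW HW; have [Wt|nWt] := pselect (W t); first exact: HW.
  have oW : open (~` W) by exact: closed_openC.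
  have : nbhs t (~` W) by exact: open_nbhs_nbhs.
  by apply: filterS => s nWs _ /nWs.
have K1 := K S cS (fun St => H t x St P NP).
have K2 := K S' cS' (fun St => H' t x St P NP).
by apply: filterS2 K1 K2 => s h h' st [Ss|Ss]; [exact: h|exact: h'].
Qed.

Lemma HasD_affine S S' f df (a b : R) : a != 0 ->
  (forall t, S t -> S' (a * t + b)) -> HasD S' f df ->
  HasD S (fun t x => f (a * t + b) x) (fun t x => a *: df (a * t + b) x).
Proof.
move=> a0 SS /HasDP H t x St.
have E s : dquot_t (fun t x => f (a * t + b) x) t x s =
    a *: dquot_t f (a * t + b) x (a * s + b).
  rewrite /dquot_t scalerA; congr (_ *: _).
  rewrite opprD addrACA subrr addr0 -mulrBr.
  have [->|st] := eqVneq (s - t) 0; first by rewrite mulr0 invr0 mulr0.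
  by field; rewrite st a0.
under eq_cvg do rewrite E.
apply: cvgZr => P NP; have H' := H _ x (SS _ St) P NP.
have : (fun s => a * s + b) @ t --> a * t + b.
  by apply: cvgD; [apply: cvgM; [exact: cvg_cst|exact: cvg_id]|exact: cvg_cst].
move=> K; apply: (@filterS _ (nbhs t) _ _ _ _ (K _ H')) => s Hs st Ss.
apply: Hs; last exact: SS.
by rewrite (inj_eq (addIr _)) (inj_eq (mulfI a0)).
Qed.

(** Writing [p - p(t) = q (X - t)] turns the difference quotient of [p] into the polynomial [q],
    with [q(t) = p'(t)]. This gives the product rule for quotients relative to any set of times. *)
Lemma HasD_poly S f df p : HasD S f df ->
  HasD S (fun t x => p.[t] *: f t x) (fun t x => p^`().[t] *: f t x + p.[t] *: df t x).
Proof.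
move=> H t x St.
have /factor_theorem[q Eq] : root (p - (p.[t])%:P) t.
  by rewrite /root !hornerE subrr.
have Ep : p = q * ('X - t%:P) + (p.[t])%:P by rewrite -Eq subrK.
have Ep' : p^`().[t] = q.[t].
  by rewrite Ep derivD derivC addr0 derivM derivXsubC !hornerE subrr mulr0 add0r.
have E s : s != t -> dquot_t (fun t x => p.[t] *: f t x) t x s =
    q.[s] *: f t x + p.[s] *: dquot_t f t x s.
  move=> st; rewrite /dquot_t.
  rewrite (scalerA p.[s]) (mulrC p.[s]) -(scalerA _ p.[s]).
  have -> : q.[s] = (s - t)^-1 * (p.[s] - p.[t]).
    rewrite [in p.[s]]Ep !hornerE addrK mulrC mulfK//.
    by rewrite subr_eq0.
  rewrite -(scalerA _ (p.[s] - p.[t])) -scalerDr; congr (_ *: _).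
  by rewrite scalerBl scalerBr [RHS]addrC addrA subrK.
rewrite Ep'.
apply: (@cvg_trans _ ((fun s => q.[s] *: f t x + p.[s] *: dquot_t f t x s)
    @ within S t^')).
  apply: near_eq_cvg.
  exact: (@filterE _ (nbhs t) _ (fun s => s != t -> S s -> _)
    (fun s st _ => esym (E s st))).
have ch (r : {poly R}) : horner r s @[s --> within S t^'] --> r.[t].
  apply: cvg_within_filter; apply: cvg_within_filter.
  exact: continuous_horner.
apply: cvgD; first by apply: cvgZl; exact: ch.
by apply: cvgZ; [exact: ch|exact: H].
Qed.

Lemma C1S_ext S f df dx g dg dy : (forall t x, S t -> f t x = g t x) ->
  (forall t x, S t -> df t x = dg t x) ->
  (forall k t x, S t -> dx k t x = dy k t x) -> C1S S f df dx -> C1S S g dg dy.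
Proof.
move=> fg dfg dxy [h1 h2 h3 h4 h5]; split.
- exact: HasD_ext h1.
- move=> t x k St; rewrite -dxy// (_ : g t = f t); first exact: h2.
  by apply/funext => y; rewrite fg.
- exact: CB_ext h3.
- exact: CB_ext h4.
- by move=> k; apply: CB_ext (h5 k) => t x St; exact: dxy.
Qed.

Lemma C1S_poly S f df dx p : S `<=` `[0, 1] -> C1S S f df dx ->
  C1S S (fun t x => p.[t] *: f t x)
    (fun t x => p^`().[t] *: f t x + p.[t] *: df t x)
    (fun k t x => p.[t] *: dx k t x).
Proof.
move=> S01 [h1 h2 h3 h4 h5]; split.
- exact: HasD_poly.
- by move=> t x k St; have := h2 t x k St => ?; exact: is_deriveZ.
- exact: CB_poly.
- by apply: CB_add; exact: CB_poly.
- by move=> k; exact: CB_poly.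
Qed.

Lemma C1S_affine S S' f df dx (a b : R) : a != 0 -> S `<=` `[0, 1] ->
  (forall t, S t -> S' (a * t + b)) -> C1S S' f df dx ->
  C1S S (fun t x => f (a * t + b) x) (fun t x => a *: df (a * t + b) x)
    (fun k t x => dx k (a * t + b) x).
Proof.
move=> a0 S01 SS [h1 h2 h3 h4 h5]; split.
- exact: HasD_affine h1.
- by move=> t x k /SS St; exact: h2.
- exact: CB_affine h3.
- have := CB_poly a%:P S01 (CB_affine SS h4).
  by apply: CB_ext => t x _; rewrite hornerC.
- by move=> k; exact: CB_affine (h5 k).
Qed.

Lemma C1S_union S S' f df dx : closed S -> closed S' -> C1S S f df dx ->
  C1S S' f df dx -> C1S (S `|` S') f df dx.
Proof.
move=> cS cS' [h1 h2 h3 h4 h5] [g1 g2 g3 g4 g5]; split.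
- exact: HasD_union.
- by move=> t x k [St|St]; [exact: h2|exact: g2].
- exact: CB_union.
- exact: CB_union.
- by move=> k; exact: CB_union.
Qed.

(** Makes limits unique, so that a known limit of the quotients is the value of [deriv_t]. The
    witness moves from [t] towards the farther end point by at most a quarter, and so stays in
    [[0, 1]]. *)
Lemma within01_proper (t : R) : 0 <= t <= 1 -> ProperFilter (within `[0, 1] t^').
Proof.
move=> /andP[t0 t1]; apply: Build_ProperFilter => -[e /= e0 He].
pose s := if t < 2^-1 then t + Num.min (e / 2) 4^-1 else t - Num.min (e / 2) 4^-1.
have m0 : 0 < Num.min (e / 2) 4^-1 by rewrite lt_min; apply/andP; split; lra.
have m1 : Num.min (e / 2) 4^-1 <= e / 2 by rewrite ge_min lexx.
have m2 : Num.min (e / 2) 4^-1 <= 4^-1 by rewrite ge_min lexx orbT.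
move: (Num.min _ _) @s m0 m1 m2 => m s m0 m1 m2.
suff [bs [st s01]] : `|t - s| < e /\ s != t /\ s \in `[0, 1].
  exact: (He s bs st s01).
rewrite /s in_itv/=; have [h|h] := ltP t 2^-1.
  rewrite opprD addrA subrr add0r normrN gtr0_norm//; split; first lra.
  by split; [apply/eqP|apply/andP; split]; lra.
rewrite opprD addrA subrr add0r opprK gtr0_norm//; split; first lra.
by split; [apply/eqP|apply/andP; split]; lra.
Qed.

Lemma C1S_C1b f df dx : C1S `[0, 1] f df dx ->
  [/\ C1b f, forall t x, 0 <= t <= 1 -> deriv_t f t x = df t x &
    forall k t x, 0 <= t <= 1 -> deriv_x k f t x = dx k t x].
Proof.
move=> [h1 h2 h3 h4 h5].
have e1 t x : 0 <= t <= 1 -> deriv_t f t x = df t x.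
  move=> t01; have PF := within01_proper t01.
  by apply: cvg_lim => //; apply: h1; rewrite /= in_itv.
have e2 k t x : 0 <= t <= 1 -> deriv_x k f t x = dx k t x.
  by move=> t01; apply: (@derive_val _ _ _ _ _ _ _ (h2 t x k _)); rewrite /= in_itv.
have CE g : CB `[0, 1] g <-> Cb01 g.
  by split=> -[c [M HM]]; split => //; exists M => t x; have := HM t x; rewrite /= in_itv.
split => //; split.
- move=> t x t01; apply/cvg_ex; exists (df t x); apply: h1; rewrite /= ?in_itv//.
- by move=> t x k t01; have [] := h2 t x k _; rewrite /= ?in_itv.
- exact/CE.
- by apply/CE; apply: CB_ext h4 => t x; rewrite /= in_itv/= => /e1.
- by move=> k; apply/CE; apply: CB_ext (h5 k) => t x; rewrite /= in_itv/= => /e2.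
Qed.

Lemma C1b_C1S f : C1b f -> C1S `[0, 1] f (deriv_t f) (fun k => deriv_x k f).
Proof.
have CE g : Cb01 g -> CB `[0, 1] g.
  by move=> -[c [M HM]]; split => //; exists M => t x; rewrite /= in_itv/=; exact: HM.
move=> [h1 h2 h3 h4 h5]; split.
- by move=> t x; rewrite /= in_itv/= => t01; exact: (h1 t x t01).
- move=> t x k; rewrite /= in_itv/= => t01; apply: DeriveDef => //; exact: h2.
- exact: CE.
- exact: CE.
- by move=> k; exact: CE.
Qed.

End SmoothFields.

(** * Gluing two fields in time *)

Definition glue (R : realType) (T U : Type) (l : R) (f g : R -> T -> U) (t : R)
  : T -> U := if t <= l then f t else g t.

Section Glue.
Context (R : realType) (d : nat) (V : normedModType R).
Local Notation C := ('cV[R]_d).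
Implicit Types (A B : R -> C -> V).

Lemma C1S_static (S : set R) (phi : C -> V) (dphi : 'I_d -> C -> V) :
  (forall x k, is_derive x (basis_vec R k) phi (dphi k x)) ->
  continuous phi -> (exists M, forall x, `|phi x| <= M) ->
  (forall k, continuous (dphi k)) -> (forall k, exists M, forall x, `|dphi k x| <= M) ->
  C1S S (fun=> phi) (fun _ _ => 0) (fun k _ => dphi k).
Proof.
have H (f : C -> V) : continuous f -> (exists M, forall x, `|f x| <= M) -> CB S (fun=> f).
  move=> cf [M HM]; split; last by exists M.
  apply: continuous_subspaceT => q.
  apply: (@cvg_comp _ _ _ (fun q : R * C => q.2) f _ (nbhs q.2)); last exact: cf.
  by case: q => a b; exact: cvg_snd.
move=> h1 h2 h3 h4 h5; split.
- move=> t x St; rewrite /dquot_t; under eq_cvg do rewrite subrr scaler0.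
  exact: cvg_cst.
- by [].
- exact: H.
- by apply: H; [exact: cst_continuous|exists 0 => x; rewrite normr0].
- by move=> k; exact: H.
Qed.

(** What a junction requires. The derivatives in space then vanish as well, since the whole slice
    [A t] is 0. *)
Definition vanish A (t : R) : Prop :=
  (forall x, A t x = 0) /\ (forall x, deriv_t A t x = 0).

Lemma vanish_deriv_x A t k x : vanish A t -> deriv_x k A t x = 0.
Proof.
move=> [A0 _]; rewrite /deriv_x (_ : A t = cst 0); last by apply/funext => y; rewrite A0.
exact: derive_cst.
Qed.

Lemma C1b_glue A B (l : R) : 0 < l < 1 -> C1b A -> C1b B ->
  vanish A 1 -> vanish B 0 ->
  C1b (glue l (fun t => A (l^-1 * t + 0)) (fun t => B ((1 - l)^-1 * t + - (l / (1 - l))))).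
Proof.
move=> /andP[l0 l1] /C1b_C1S cA /C1b_C1S cB vA vB.
have l10 : 0 < 1 - l by lra.
pose a := l^-1; pose b := (1 - l)^-1; pose c := - (l / (1 - l)).
have a0 : a != 0 by rewrite invr_eq0 gt_eqF.
have b0 : b != 0 by rewrite invr_eq0 gt_eqF.
have al : a * l + 0 = 1 by rewrite addr0 mulVf ?gt_eqF.
have bl : b * l + c = 0 by rewrite /c /b mulrC subrr.
have S1 : (`[0, l]%classic : set R) `<=` `[0, 1].
  by move=> t; rewrite /= !in_itv/=; lra.
have S2 : (`[l, 1]%classic : set R) `<=` `[0, 1].
  by move=> t; rewrite /= !in_itv/=; lra.
have s1 (t : R) : `[0, l]%classic t -> `[0, 1]%classic (a * t + 0).
  rewrite /= !in_itv/= addr0 => /andP[t0 tl].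
  by rewrite /a mulr_ge0 ?invr_ge0 ?(ltW l0)//= ler_pdivrMl// mulr1.
have s2 (t : R) : `[l, 1]%classic t -> `[0, 1]%classic (b * t + c).
  rewrite /= !in_itv/= => /andP[tl t1].
  have -> : b * t + c = (t - l) / (1 - l) by rewrite /b /c mulrBl mulrC.
  by rewrite divr_ge0 ?(ltW l10) ?subr_ge0//= ler_pdivrMr// mul1r lerD2r.
have := C1S_affine a0 S1 s1 cA; have := C1S_affine b0 S2 s2 cB.
pose df := glue l (fun t x => a *: deriv_t A (a * t + 0) x)
  (fun t x => b *: deriv_t B (b * t + c) x).
pose dx k := glue l (fun t => deriv_x k A (a * t + 0)) (fun t => deriv_x k B (b * t + c)).
pose f := glue l (fun t => A (a * t + 0)) (fun t => B (b * t + c)).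
move=> /(@C1S_ext _ _ _ _ _ _ _ f df dx) H2 /(@C1S_ext _ _ _ _ _ _ _ f df dx) H1.
have E t : `[l, 1]%classic t -> t <= l -> t = l.
  by rewrite /= in_itv/= => /andP[? ?] ?; lra.
suff : C1S `[0, 1] f df dx by case/C1S_C1b.
have -> : `[0, 1]%classic = `[0, l]%classic `|` `[l, 1]%classic :> set R.
  apply/seteqP; split => t /=; rewrite !in_itv/=; last by move=> [|]; lra.
  by move=> /andP[t0 t1]; have [tl|lt] := leP t l; [left|right]; lra.
apply: C1S_union; [exact: itv_closed|exact: itv_closed|apply: H1|apply: H2].
- by move=> t x; rewrite /= in_itv/= /f /glue => /andP[_ ->].
- by move=> t x; rewrite /= in_itv/= /df /glue => /andP[_ ->].
- by move=> k t x; rewrite /= in_itv/= /dx /glue => /andP[_ ->].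
(* On [[l, 1]] the left branch is met only at [t = l]. There both branches are 0 together with their
   derivatives, whatever the two speeds are. *)
- move=> t x St; rewrite /f /glue; case: ifPn => // tl; rewrite (E t St tl) al bl.
  by rewrite vA.1 vB.1.
- move=> t x St; rewrite /df /glue; case: ifPn => // tl; rewrite (E t St tl) al bl.
  by rewrite vA.2 vB.2 !scaler0.
- move=> k t x St; rewrite /dx /glue; case: ifPn => // tl; rewrite (E t St tl) al bl.
  by rewrite !vanish_deriv_x.
Qed.

Lemma C1b_poly A (p : {poly R}) : C1b A ->
  C1b (fun t x => p.[t] *: A t x) /\
  forall t x, 0 <= t <= 1 -> deriv_t (fun t x => p.[t] *: A t x) t x =
    p^`().[t] *: A t x + p.[t] *: deriv_t A t x.
Proof.
move=> /C1b_C1S /(C1S_poly p (fun _ h => h)) /C1S_C1b[c e _]; split => //.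
Qed.

Lemma C1b_affine A (a b : R) : a != 0 ->
  (forall t, 0 <= t <= 1 -> 0 <= a * t + b <= 1) -> C1b A ->
  [/\ C1b (fun t => A (a * t + b)),
   (forall t x, 0 <= t <= 1 -> deriv_t (fun t => A (a * t + b)) t x =
     a *: deriv_t A (a * t + b) x) &
   (forall k t x, 0 <= t <= 1 -> deriv_x k (fun t => A (a * t + b)) t x =
     deriv_x k A (a * t + b) x)].
Proof.
move=> a0 ab /C1b_C1S cA.
have s t : `[0, 1]%classic t -> `[0, 1]%classic (a * t + b) by rewrite /= !in_itv/=; exact: ab.
by have /C1S_C1b[] := C1S_affine a0 (fun _ h => h) s cA.
Qed.

End Glue.

(** * A polynomial cutoff in time *)

Section Cutoff.
Context (R : realType).

(* Vanishes together with its derivative at 0 and 1, and tends to 1 in L^2. *)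
Definition cutoff (N : nat) : {poly R} :=
  (1 - 'X^(N.+1.*2)) ^+ 2 * (1 - (1 - 'X) ^+ (N.+1.*2)) ^+ 2.

Lemma sq_root_deriv (p q : {poly R}) (a : R) : q.[a] = 0 ->
  (q ^+ 2 * p).[a] = 0 /\ (q ^+ 2 * p)^`().[a] = 0.
Proof.
move=> q0; split; first by rewrite hornerM horner_exp q0 expr0n mul0r.
by rewrite derivM expr2 derivM !hornerE q0 !(mul0r, mulr0, addr0).
Qed.

Lemma cutoff0 N : (cutoff N).[0] = 0 /\ (cutoff N)^`().[0] = 0.
Proof.
rewrite /cutoff mulrC; apply: sq_root_deriv.
by rewrite !hornerE ?subr0 expr1n subrr.
Qed.

Lemma cutoff1 N : (cutoff N).[1] = 0 /\ (cutoff N)^`().[1] = 0.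
Proof.
by apply: sq_root_deriv; rewrite !hornerE expr1n subrr.
Qed.

(** Call the product [z]. As [z] lies in [[0, 1]], [(1 - z)^2 <= 1 - z], and [(1 - p)^2 >= 1 - 2p],
    likewise for [q], bounds [z] from below by [1 - 2p - 2q]. *)
Lemma cutoff_ineq (p q : R) : 0 <= p <= 1 -> 0 <= q <= 1 ->
  (1 - (1 - p) ^+ 2 * (1 - q) ^+ 2) ^+ 2 <= 2 * p + 2 * q.
Proof.
move=> /andP[p0 p1] /andP[q0 q1].
have h1 : 0 <= (1 - p) ^+ 2 * (1 - q) ^+ 2 by rewrite mulr_ge0 ?sqr_ge0.
have e3 : 0 <= (1 - p) ^+ 2 <= 1 by rewrite sqr_ge0 expr_le1//; lra.
have e4 : 0 <= (1 - q) ^+ 2 <= 1 by rewrite sqr_ge0 expr_le1//; lra.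
have h2 : 1 - 2 * p - 2 * q <= (1 - p) ^+ 2 * (1 - q) ^+ 2.
  have e1 : 1 - 2 * p <= (1 - p) ^+ 2 by have := sqr_ge0 p; rewrite !expr2; lra.
  have e2 : 1 - 2 * q <= (1 - q) ^+ 2 by have := sqr_ge0 q; rewrite !expr2; lra.
  nra.
have h3 : (1 - p) ^+ 2 * (1 - q) ^+ 2 <= 1 by nra.
set z := _ * _ in h1 h2 h3 *.
apply: (@le_trans _ _ (1 - z)); last by lra.
by rewrite expr2 ler_piMl//; lra.
Qed.

Lemma cutoff_bound N (t : R) : 0 <= t <= 1 ->
  (1 - (cutoff N).[t]) ^+ 2 <= 2 * t ^+ N.+1.*2 + 2 * (1 - t) ^+ N.+1.*2.
Proof.
move=> /andP[t0 t1].
have -> : (cutoff N).[t] = (1 - t ^+ N.+1.*2) ^+ 2 * (1 - (1 - t) ^+ N.+1.*2) ^+ 2.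
  rewrite /cutoff -polyC1 !expr2; move: N.+1.*2 => n.
  by rewrite !(horner_exp, hornerXn, hornerM, hornerD, hornerN, hornerX, hornerC).
have P (x : R) : 0 <= x -> x <= 1 -> 0 <= x ^+ N.+1.*2 <= 1.
  by move=> x0 x1; rewrite exprn_ge0//= exprn_ile1.
by apply: cutoff_ineq; apply: P => //; lra.
Qed.

Local Notation mu := (@lebesgue_measure R).

Lemma lint_pow (n : nat) :
  (\int[mu]_(t in `[0%R, 1%R]) (t ^+ n)%:E = (n.+1%:R^-1)%:E)%E.
Proof.
pose p : {poly R} := n.+1%:R^-1 *: 'X^(n.+1).
have dp : p^`() = 'X^n.
  by rewrite derivZ derivXn/= -scalerMnr scalerMnl -mulr_natr mulVf ?scale1r ?pnatr_eq0.
under eq_integral do rewrite -hornerXn -dp.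
rewrite (@continuous_FTC2 _ (horner p^`()) (horner p) 0 1 ltr01).
- by rewrite -EFinB !hornerZ !hornerXn expr1n expr0n/= mulr1 mulr0 subr0.
- by apply: continuous_subspaceT; exact: continuous_horner.
- split.
  + by move=> x _; exact: derivable_horner.
  + by apply: cvg_at_right_filter; exact: continuous_horner.
  + by apply: cvg_at_left_filter; exact: continuous_horner.
- by move=> x _; rewrite derivE.
Qed.

Lemma lint_cutoff_tail (K : R) (n : nat) : 0 <= K ->
  (\int[mu]_(t in `[0%R, 1%R])
    (K * (2 * t ^+ n.*2 + 2 * (1 - t) ^+ n.*2))%:E = (K * (4 / n.*2.+1%:R))%:E)%E.
Proof.
move=> K0; have e0 (t : R) : 0 <= t ^+ n.*2 by rewrite -muln2 exprM sqr_ge0.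
have m01 : measurable (`[0, 1]%classic : set (measurableTypeR R)) by exact: measurable_itv.
have mp (p : {poly R}) : measurable_fun setT (fun t : measurableTypeR R => p.[t]).
  by apply: continuous_measurable_fun; exact: continuous_horner.
have H : (\int[mu]_(t in `[0%R, 1%R]) ((1 - t) ^+ n.*2)%:E = (n.*2.+1%:R^-1)%:E)%E.
  have := @lint_affine R (-1) 1 `[0, 1]%classic (fun t => (t ^+ n.*2)%:E).
  rewrite lint_pow oppr_eq0 oner_eq0 normrN1 invr1 mul1e => <-//.
  rewrite (_ : _ @^-1` _ = `[0, 1]%classic); last first.
    by apply/seteqP; split => t; rewrite /preimage/= !in_itv/=; lra.
  by apply: eq_integral => t _; rewrite mulN1r addrC.
under eq_integral => t _ do rewrite EFinM (EFinD (2 * t ^+ n.*2)) !EFinM.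
have p0 (t : R) : `[0, 1]%classic t -> (0 <= 2%:E * (t ^+ n.*2)%:E)%E.
  by move=> _; rewrite -EFinM lee_fin mulr_ge0.
have q0 (t : R) : `[0, 1]%classic t -> (0 <= 2%:E * ((1 - t) ^+ n.*2)%:E)%E.
  by move=> _; rewrite -EFinM lee_fin mulr_ge0.
rewrite lintZ//; last by move=> t t01; apply: adde_ge0; [exact: p0|exact: q0].
rewrite ge0_integralD//; last 2 first.
- apply: measurable_funeM; apply/measurable_EFinP; apply: measurable_funTS.
  by have := mp 'X^(n.*2); under eq_fun do rewrite hornerXn.
- apply: measurable_funeM; apply/measurable_EFinP; apply: measurable_funTS.
  by have := mp ((1 - 'X) ^+ (n.*2)); under eq_fun do rewrite !hornerE.
rewrite !lintZ ?lint_pow ?H//; do ?by move=> t _; rewrite lee_fin.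
transitivity (K * (2 * n.*2.+1%:R^-1 + 2 * n.*2.+1%:R^-1))%:E; first by [].
by congr EFin; ring.
Qed.

End Cutoff.

(** * Energy of a path *)

Section L2.
Context (R : realType) (d : nat).
Local Notation C := ('cV[R]_d).
Local Notation mu := (@lebesgue_measure R).
Implicit Types (G : R -> psd_measure R d) (U : R -> C -> 'M[R]_d) (u : R -> C -> C).

Definition En2 (H : psd_measure R d) (V : C -> 'M[R]_d) (v : C -> C) : \bar R :=
  (En H v + En H V)%E.

Lemma En2_ge0 H V v : (0 <= En2 H V v)%E.
Proof. by rewrite adde_ge0// En_ge0. Qed.

Lemma normsqE G U u :
  (normsq G U u = \int[mu]_(t in `[0%R, 1%R]) En2 (G t) (U t) (u t))%E.
Proof. by apply: eq_integral => t _; rewrite energy_vE energy_mE. Qed.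

Lemma normsq_ge0 G U u : (0 <= normsq G U u)%E.
Proof. by rewrite normsqE; apply: integral_ge0 => t _; exact: En2_ge0. Qed.

Lemma cvge0P (v : nat -> \bar R) : (forall n, 0 <= v n)%E ->
  v n @[n --> \oo] --> 0%E <->
  forall e : R, 0 < e -> \forall n \near \oo, (v n <= e%:E)%E.
Proof.
move=> v0; split.
  move=> vc e e0; have /= := vc [set y | (y < e%:E)%E].
  have N : nbhs (0 : \bar R)%E [set y | (y < e%:E)%E].
    by apply: open_nbhs_nbhs; split; [exact: open_ereal_lt_ereal|rewrite /= lte_fin].
  by move=> /(_ N) K; apply: (@filterS _ \oo _ _ _ _ K) => n /ltW.
move=> H; apply/fine_cvgP; split.
  have := H 1 ltr01; apply: filterS => n vn; rewrite ge0_fin_numE//.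
  exact: le_lt_trans vn (ltry _).
apply/cvgrPdist_le => e e0; have := H e e0; apply: filterS => n vn.
rewrite sub0r normrN ger0_norm ?fine_ge0//= -lee_fin fineK//.
by rewrite ge0_fin_numE//; exact: le_lt_trans vn (ltry _).
Qed.

Lemma mx_entry_le m n (A : 'M[R]_(m, n)) i j : `|A i j| <= `|A|.
Proof.
rewrite [leRHS]/Num.norm/= mx_normrE.
by apply: (le_trans _ (le_bigmax _ _ (i, j))).
Qed.

Lemma Cb01_entry m n (f : R -> C -> 'M[R]_(m, n)) : Cb01 f ->
  exists2 M : R, 0 <= M & forall t x i k, 0 <= t <= 1 -> `|f t x i k| <= M.
Proof.
move=> [_ [M HM]]; exists `|M| => // t x i k t01.
exact: le_trans (mx_entry_le _ _ _) (le_trans (HM _ _ t01) (ler_norm _)).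
Qed.

Lemma div_bound (Phi : R -> C -> 'M[R]_d) : C1b Phi ->
  exists2 M : R, 0 <= M & forall t x i k, 0 <= t <= 1 -> `|div_mx Phi t x i k| <= M.
Proof.
move=> [_ _ _ _ H5].
have /choice[M HM] k : exists M : R, 0 <= M /\
    forall t x i j, 0 <= t <= 1 -> `|deriv_x k Phi t x i j| <= M.
  by have [M M0 HM] := Cb01_entry (H5 k); exists M.
exists (\sum_k M k); first by apply: sumr_ge0 => k _; case: (HM k).
move=> t x i j t01; rewrite mxE; apply: le_trans (ler_norm_sum _ _ _) _.
by apply: ler_sum => k _; case: (HM k) => _; apply.
Qed.

(** A time of maximal mass, and not merely a bound, is what the absorption in [mass_path_bound]
    needs. *)
Lemma narrow_mass_max G : narrow_continuous G -> exists2 c : R, 0 <= c <= 1 &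
  forall t, 0 <= t <= 1 -> mass (G t) <= mass (G c).
Proof.
move=> nG; have c1 : continuous (fun _ : C => (1 : R)) by exact: cst_continuous.
have := nG _ c1 (ex_intro _ 1 (fun _ => _)).
move=> /(_ (fun _ => ltac:(by rewrite normr1))) cG.
have cm : {within `[0, 1], continuous (fun t => mass (G t))}.
  rewrite (_ : (fun t => _) = (fun t => \sum_i int_scalar (G t) (fun=> 1) i i));
    last by apply/funext => t; rewrite mass_int_scalar.
  apply/subspace_continuousP => t t01; apply: cvg_sumr => i.
  have := cG; move=> /subspace_continuousP/(_ t t01) cGt.
  exact: (@cvg_comp _ _ _ (fun t => int_scalar (G t) (fun=> 1)) (fun A : 'M[R]_d => A i i)
    _ (nbhs (int_scalar (G t) (fun=> 1))) _ cGt (@coord_continuous _ _ _ i i _)).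
have [c c01 Hc] := EVT_max ler01 cm; exists c.
  by move: c01; rewrite in_itv.
by move=> t t01; apply: Hc; rewrite /= in_itv.
Qed.

Lemma narrow_mass_bound G : narrow_continuous G ->
  exists2 M : R, 0 <= M & forall t, 0 <= t <= 1 -> mass (G t) <= M.
Proof.
by move=> /narrow_mass_max[c _ Hc]; exists (mass (G c)); [exact: mass_ge0|].
Qed.

Definition rhs G U u (Phi : R -> C -> 'M[R]_d) (r : R) : R :=
  int_vv (G r) (u r) (div_mx Phi r) + int_mm (G r) (U r) (Phi r).

Definition lhs G (Phi : R -> C -> 'M[R]_d) (r : R) : R :=
  int_m (G r) (deriv_t Phi r).

(** [K] depends on [Phi] alone and is fixed before the path and the Young parameter [s], so that [s]
    can later be chosen in terms of [K]. *)
Lemma rhs_bound (Phi : R -> C -> 'M[R]_d) : C1b Phi ->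
  exists2 K : R, 0 <= K & forall G U u s r, 0 < s -> 0 <= r <= 1 ->
  (`|rhs G U u Phi r|%:E <=
   (s / 2)%:E * En2 (G r) (U r) (u r) + (s^-1 / 2 * K * mass (G r))%:E)%E.
Proof.
move=> cP; have [D D0 HD] := div_bound cP.
have [M M0 HM] : exists2 M : R, 0 <= M &
    forall t x i k, 0 <= t <= 1 -> `|Phi t x i k| <= M.
  by case: cP => _ _ c3 _ _; exact: Cb01_entry.
exists (kdim R d 1 * D ^+ 2 + kdim R d d * M ^+ 2).
  by apply: addr_ge0; apply: mulr_ge0; rewrite ?kdim_ge0 ?sqr_ge0.
move=> G U u s r s0 r01; rewrite /rhs int_vvE int_mmE.
have H1 := @Jn_young R d 1 (G r) (u r) (div_mx Phi r) s D s0
  (fun x i k => HD r x i k r01).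
have H2 := @Jn_young R d d (G r) (U r) (Phi r) s M s0
  (fun x i k => HM r x i k r01).
apply: (@le_trans _ _ (`|Jn (G r) (u r) (div_mx Phi r)|%:E +
  `|Jn (G r) (U r) (Phi r)|%:E)%E); first by rewrite -EFinD lee_fin ler_normD.
apply: le_trans (leeD H1 H2) _; rewrite addeACA -ge0_muleDr ?En_ge0//.
by rewrite -EFinD mulrDr mulrDl.
Qed.

Lemma lhs_bound (Phi : R -> C -> 'M[R]_d) : C1b Phi ->
  exists2 K : R, 0 <= K & forall G r, 0 <= r <= 1 ->
  `|lhs G Phi r| <= K * mass (G r).
Proof.
move=> [_ _ _ c4 _]; have [M M0 HM] := Cb01_entry c4.
exists (kdim R d d * (M + 1) ^+ 2); first by apply: mulr_ge0; rewrite ?kdim_ge0 ?sqr_ge0.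
move=> G r r01; rewrite /lhs int_mE; apply: Jn_bound => x i k.
  by apply: le_trans (HM _ _ _ _ r01) _; rewrite lerDl.
rewrite mxE; case: eqP => _; rewrite ?normr1 ?normr0; lra.
Qed.

Lemma lint_En2_add G U u (a K M : R) : 0 <= a -> 0 <= K ->
  (forall t, 0 <= t <= 1 -> mass (G t) <= M) ->
  (\int[mu]_(t in `[0%R, 1%R])
     (a%:E * En2 (G t) (U t) (u t) + (K * mass (G t))%:E) <=
   a%:E * normsq G U u + (K * M)%:E)%E.
Proof.
move=> a0 K0 mM; have M0 : 0 <= M.
  by apply: le_trans (mass_ge0 (G 0)) (mM _ _); rewrite lexx ler01.
have m01 : measurable (`[0, 1]%classic : set (measurableTypeR R)) by exact: measurable_itv.
(* The mass is first replaced by its bound, so that the measurable summand of [lintD_le] is a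
   constant in time. *)
apply: (@le_trans _ _ (\int[mu]_(t in `[0%R, 1%R])
  (a%:E * En2 (G t) (U t) (u t) + (K * M)%:E))%E).
  apply: lint_mono => t; rewrite /= in_itv/= => t01.
    by rewrite adde_ge0 ?mule_ge0 ?En2_ge0 ?lee_fin// mulr_ge0// mass_ge0.
  by rewrite leeD2l// lee_fin ler_wpM2l// mM.
apply: (le_trans (lintD_le (d := _) mu m01 _ _ _)).
- by move=> t _; rewrite mule_ge0 ?En2_ge0 ?lee_fin.
- exact: measurable_cst.
- by move=> t; rewrite mulr_ge0.
by rewrite lintZ// ?normsqE ?lint01_cst// => t _; exact: En2_ge0.
Qed.

Lemma rhs_lfin G U u Phi : narrow_continuous G -> (normsq G U u < +oo)%E -> C1b Phi ->
  (\int[mu]_(r in `[0%R, 1%R]) `|rhs G U u Phi r|%:E < +oo)%E.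
Proof.
move=> nG fin cP; have [M M0 HM] := narrow_mass_bound nG.
have [K K0 HK] := rhs_bound cP.
apply: (int_time_lfin (fun r => HK G U u 1 r ltr01)).
have h0 : 0 <= 1 / 2 :> R by lra.
have k0 : 0 <= 1^-1 / 2 * K by apply: mulr_ge0 => //; rewrite invr1.
apply: le_lt_trans (@lint_En2_add G U u _ _ M h0 k0 HM) _.
rewrite lte_add_pinfty ?ltry// lte_mul_pinfty ?lee_fin//; lra.
Qed.

Lemma lhs_lfin G Phi : narrow_continuous G -> C1b Phi ->
  (\int[mu]_(r in `[0%R, 1%R]) `|lhs G Phi r|%:E < +oo)%E.
Proof.
move=> nG cP; have [M M0 HM] := narrow_mass_bound nG.
have [K K0 HK] := lhs_bound cP.
apply: (@int_time_lfin _ _ (fun=> (K * M)%:E)); last by rewrite lint01_cst ltry.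
move=> r r01; rewrite lee_fin; apply: le_trans (HK _ _ r01) _.
by rewrite ler_wpM2l// HM.
Qed.

End L2.

(** * Approximants that vanish at both end times *)

Section Vanish.
Context (R : realType) (d : nat).
Local Notation C := ('cV[R]_d).
Local Notation mu := (@lebesgue_measure R).
Implicit Types (G : R -> psd_measure R d) (U : R -> C -> 'M[R]_d) (u : R -> C -> C).

Lemma vanish_cutoff m n (W : R -> C -> 'M[R]_(m, n)) N : C1b W ->
  [/\ C1b (fun t x => (cutoff R N).[t] *: W t x),
   vanish (fun t x => (cutoff R N).[t] *: W t x) 0 &
   vanish (fun t x => (cutoff R N).[t] *: W t x) 1].
Proof.
move=> cW; have [cV dV] := C1b_poly (cutoff R N) cW; split => //.
  split=> x; rewrite ?dV ?lexx ?ler01// (cutoff0 R N).1 ?(cutoff0 R N).2;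
    by rewrite !scale0r ?addr0.
split=> x; rewrite ?dV ?lexx ?ler01// (cutoff1 R N).1 ?(cutoff1 R N).2;
  by rewrite !scale0r ?addr0.
Qed.

Lemma En2_cutoff (H : psd_measure R d) (V W : C -> 'M[R]_d) (v w : C -> C)
    (c D E : R) :
  (forall x i k, `|w x i k| <= D) -> (forall x i k, `|W x i k| <= E) ->
  (En2 H (fun x => V x - c *: W x)%R (fun x => v x - c *: w x)%R <=
   2%:E * En2 H (fun x => V x - W x)%R (fun x => v x - w x)%R +
   ((2 * (kdim R d 1 * D ^+ 2 + kdim R d d * E ^+ 2)) * (1 - c) ^+ 2 * mass H)%:E)%E.
Proof.
move=> HD HE.
(* The error is that of the uncut approximant plus [(1 - c) B], with [B] bounded; the factors 2
   absorb the cross term. *)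
have e m (A B : C -> 'M[R]_(d, m)) : (fun x => A x - c *: B x) =
    (fun x => (A x - B x) + (1 - c) *: B x).
  by apply/funext => x; rewrite scalerBl scale1r addrA subrK.
have b m (A : C -> 'M[R]_(d, m)) K : (forall x i k, `|A x i k| <= K) ->
    forall x i k, `|((1 - c) *: A x) i k| <= `|1 - c| * K.
  by move=> AK x i k; rewrite mxE normrM ler_wpM2l.
rewrite /En2 !e.
have H1 := @EnD_le R d 1 H (fun x => v x - w x) (fun x => (1 - c) *: w x) _ (b _ _ _ HD).
have H2 := @EnD_le R d d H (fun x => V x - W x) (fun x => (1 - c) *: W x) _ (b _ _ _ HE).
apply: le_trans (leeD H1 H2) _; rewrite addeACA -ge0_muleDr ?En_ge0// leeD2l//.
by rewrite -EFinD lee_fin !exprMn real_normK ?num_real//; lra.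
Qed.

Lemma in_L2_cut G U u (W : R -> C -> 'M[R]_d) (w : R -> C -> C) (e : R) :
  narrow_continuous G -> C1b W -> C1b w -> 0 < e -> exists N,
  (normsq G (fun t x => U t x - (cutoff R N).[t] *: W t x)%R
            (fun t x => u t x - (cutoff R N).[t] *: w t x)%R <=
   2%:E * normsq G (fun t x => U t x - W t x)%R (fun t x => u t x - w t x)%R + e%:E)%E.
Proof.
move=> nG [_ _ cW _ _] [_ _ cw _ _] e0; have [M M0 HM] := narrow_mass_bound nG.
have [E E0 HE] := Cb01_entry cW; have [D D0 HD] := Cb01_entry cw.
set c := 2 * (kdim R d 1 * D ^+ 2 + kdim R d d * E ^+ 2).
have c0 : 0 <= c.
  by apply: mulr_ge0 => //; apply: addr_ge0; apply: mulr_ge0; rewrite ?kdim_ge0 ?sqr_ge0.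
pose K := c * M; have K0 : 0 <= K by exact: mulr_ge0.
have Ke0 : 0 <= K * 4 / e by rewrite divr_ge0 ?(ltW e0)// mulr_ge0.
(* The remainder integrates to [4 K] divided by [2 (N + 1) + 1], which is at most [e] as soon as
   [N >= 4 K / e]. *)
pose N := Num.bound (K * 4 / e); exists N.
have HN : K * 4 / e < N%:R by exact: archi_boundP.
have m01 : measurable (`[0, 1]%classic : set (measurableTypeR R)) by exact: measurable_itv.
have pw0 (t : R) : 0 <= t ^+ N.+1.*2 by rewrite -muln2 exprM sqr_ge0.
have tail0 (t : R) : 0 <= K * (2 * t ^+ N.+1.*2 + 2 * (1 - t) ^+ N.+1.*2).
  by apply: mulr_ge0 => //; apply: addr_ge0; apply: mulr_ge0.
rewrite [leLHS]normsqE.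
apply: (@le_trans _ _ (\int[mu]_(t in `[0%R, 1%R])
   (2%:E * En2 (G t) (fun x => U t x - W t x)%R (fun x => u t x - w t x)%R +
    (K * (2 * t ^+ N.+1.*2 + 2 * (1 - t) ^+ N.+1.*2))%:E))%E).
  apply: lint_mono => t; rewrite /= in_itv/= => t01; first exact: En2_ge0.
  apply: le_trans (En2_cutoff _ _ _ _ (fun x i k => HD t x i k t01)
    (fun x i k => HE t x i k t01)) _.
  rewrite leeD2l// lee_fin -/c /K mulrAC.
  apply: ler_pM; first by apply: mulr_ge0 => //; exact: mass_ge0.
  - exact: sqr_ge0.
  - by apply: ler_wpM2l => //; exact: HM.
  - exact: cutoff_bound.
have mt : measurable_fun setT (fun t : measurableTypeR R =>
    K * (2 * t ^+ N.+1.*2 + 2 * (1 - t) ^+ N.+1.*2)).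
  apply: continuous_measurable_fun => t.
  apply: cvgM; first exact: cvg_cst.
  apply: cvgD; apply: cvgM; try exact: cvg_cst; first exact: exprn_continuous.
  apply: (@cvg_comp _ _ _ (fun t : R => 1 - t) (fun t => t ^+ N.+1.*2) _ (nbhs (1 - t))).
    by apply: cvgB; [exact: cvg_cst|exact: cvg_id].
  exact: exprn_continuous.
have En20 (t : R) : `[0, 1]%classic t ->
    (0 <= 2%:E * En2 (G t) (fun x => U t x - W t x)%R (fun x => u t x - w t x)%R)%E.
  by move=> _; rewrite mule_ge0 ?En2_ge0.
apply: le_trans (lintD_le mu m01 En20 mt tail0) _.
rewrite lintZ//; last by move=> t _; exact: En2_ge0.
rewrite lint_cutoff_tail// -normsqE leeD2l// lee_fin.
rewrite mulrA ler_pdivrMr ?ltr0n// [leRHS]mulrC -ler_pdivrMr//.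
apply: le_trans (ltW HN) _; rewrite ler_nat -addnn.
exact: leq_trans (leqnSn N) (leqW (leq_addr _ _)).
Qed.

(** The degree of the cutoff is chosen after the [n]-th approximant, whose sup norm it has to beat.
    Its derivative may grow without bound, as derivatives do not enter [normsq]. *)
Lemma in_L2_vanish G U u : narrow_continuous G -> in_L2 G U u ->
  exists (Un : nat -> R -> C -> 'M[R]_d) (un : nat -> R -> C -> C),
  [/\ forall n, [/\ C1b (Un n), sym_field (Un n) & C1b (un n)],
   forall n, [/\ vanish (Un n) 0, vanish (Un n) 1, vanish (un n) 0 & vanish (un n) 1] &
   normsq G (fun t x => U t x - Un n t x)%R (fun t x => u t x - un n t x)%R
     @[n --> \oo] --> 0%E].
Proof.
move=> nG [_ _ _ _ [W [w [HW Hc]]]].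
have /choice[N HN] n : exists N,
    (normsq G (fun t x => U t x - (cutoff R N).[t] *: W n t x)%R
            (fun t x => u t x - (cutoff R N).[t] *: w n t x)%R <=
   2%:E * normsq G (fun t x => U t x - W n t x)%R (fun t x => u t x - w n t x)%R +
   (n.+1%:R^-1)%R%:E)%E.
  have [cW _ cw] := HW n; apply: (in_L2_cut U u nG cW cw).
  by rewrite invr_gt0.
exists (fun n t x => (cutoff R (N n)).[t] *: W n t x),
  (fun n t x => (cutoff R (N n)).[t] *: w n t x); split.
- move=> n; have [h1 h2 h3] := HW n; split.
  + by have [] := vanish_cutoff (N n) h1.
  + by move=> t x t01; rewrite /sym_mx linearZ/= h2.
  + by have [] := vanish_cutoff (N n) h3.
- move=> n; have [h1 _ h3] := HW n.
  by have [_ ? ?] := vanish_cutoff (N n) h1; have [_ ? ?] := vanish_cutoff (N n) h3.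
- apply/cvge0P => [n|e e0]; first exact: normsq_ge0.
  have e40 : 0 < e / 4 by rewrite divr_gt0.
  move/cvge0P : Hc => /(_ (fun n => normsq_ge0 _ _ _) _ e40).
  have K : \forall n \near \oo, n.+1%:R^-1 <= e / 2.
    have /cvgrPdist_le/(_ (e / 2)) := @cvg_harmonic R.
    have e20 : 0 < e / 2 by rewrite divr_gt0.
    move=> /(_ e20) K; apply: (@filterS _ \oo _ _ _ _ K) => n.
    by rewrite sub0r normrN ger0_norm ?harmonic_ge0.
  move=> K'; apply: (@filterS2 _ \oo _ _ _ _ _ K K') => n h h'.
  apply: le_trans (HN n) _.
  apply: (@le_trans _ _ (2%:E * (e / 4)%:E + (e / 2)%:E)%E).
    by apply: leeD; [exact: lee_wpmul2l|rewrite lee_fin].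
  by rewrite -EFinM -EFinD lee_fin; lra.
Qed.

End Vanish.

(** * Reparametrization, reversal and concatenation of paths *)

Section Moved.
Context (R : realType) (d : nat).
Local Notation C := ('cV[R]_d).
Local Notation mu := (@lebesgue_measure R).
Local Notation mR := (measurableTypeR R).
Implicit Types (G : R -> psd_measure R d) (U : R -> C -> 'M[R]_d) (u : R -> C -> C).

(* A path reparametrized by [r |-> a * r + b] carries its fields divided by [a]. *)
Definition moved (a b : R) m (F F' : R -> C -> 'M[R]_(d, m)) : Prop :=
  forall r, 0 < r < 1 -> forall x, F' (a * r + b) x = a^-1 *: F r x.

Definition moved_pm (a b : R) G G' : Prop :=
  forall r, 0 <= r <= 1 -> pm_eq (G' (a * r + b)) (G r).

Lemma movedB a b m (F F' H H' : R -> C -> 'M[R]_(d, m)) :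
  moved a b F F' -> moved a b H H' ->
  moved a b (fun t x => F t x - H t x) (fun t x => F' t x - H' t x).
Proof. by move=> FF HH r r01 x; rewrite FF// HH// scalerBr. Qed.

Lemma open01 (r : R) : 0 < r < 1 -> 0 <= r <= 1.
Proof. by move=> /andP[? ?]; apply/andP; split; lra. Qed.

Lemma En2_moved a b G U u G' U' u' : moved_pm a b G G' ->
  moved a b U U' -> moved a b u u' -> forall r, 0 < r < 1 ->
  (En2 (G' (a * r + b)%R) (U' (a * r + b)%R) (u' (a * r + b)%R) =
   (a ^- 2)%:E * En2 (G r) (U r) (u r))%E.
Proof.
move=> GG UU uu r r01; have E := pm_scale1 (GG r (open01 r01)).
rewrite /En2 !(En_scale _ ler01 E) !mul1e.
have -> : U' (a * r + b) = (fun x => a^-1 *: U r x) by apply/funext => x; rewrite UU.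
have -> : u' (a * r + b) = (fun x => a^-1 *: u r x) by apply/funext => x; rewrite uu.
by rewrite !EnZ -ge0_muleDr ?En_ge0// exprVn.
Qed.

Lemma null01 : measurable ([set 0; 1] : set mR) /\ mu [set 0; 1] = 0%E.
Proof.
have m1 (x : R) : measurable ([set x] : set mR) by exact: measurable_set1.
split; first by apply: measurableU; exact: m1.
apply/eqP; rewrite eq_le measure_ge0 andbT.
apply: (le_trans (measureU2 _ (m1 0) (m1 1))).
rewrite -[leRHS](adde0 0%E); apply: leeD; rewrite le_eqVlt; apply/orP; left;
  apply/eqP; exact: lebesgue_measure_set1.
Qed.

(** The energy density is multiplied by [a ^- 2] and the length of time by [|a|], which leaves
    [|a|^-1]. *)
Lemma lint_En2_moved a b G U u G' U' u' (D : set mR) : a != 0 -> measurable D ->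
  (fun r => a * r + b) @^-1` D = `[0, 1]%classic ->
  moved_pm a b G G' -> moved a b U U' -> moved a b u u' ->
  (\int[mu]_(t in D) En2 (G' t) (U' t) (u' t) = `|a|^-1%:E * normsq G U u)%E.
Proof.
move=> a0 mD aD GG UU uu.
have na : 0 < `|a| by rewrite normr_gt0.
have := @lint_affine R a b D (fun t => En2 (G' t) (U' t) (u' t)) a0 mD
  (fun t => En2_ge0 _ _ _).
have m01 : measurable (`[0, 1]%classic : set mR) by exact: measurable_itv.
have [mN N0] := null01.
rewrite aD => H.
have H2 : (\int[mu]_(r in `[0%R, 1%R]) En2 (G' (a * r + b)%R) (U' (a * r + b)%R) (u' (a * r + b)%R)
    = (a ^- 2)%:E * normsq G U u)%E.
  rewrite normsqE -lintZ ?invr_ge0 ?sqr_ge0//; last by move=> t _; exact: En2_ge0.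
  apply: (lint_null m01 mN N0) => r.
  - by move=> _; exact: En2_ge0.
  - by move=> _; rewrite mule_ge0 ?En2_ge0// lee_fin invr_ge0 sqr_ge0.
  - rewrite /= in_itv/= => /andP[r0 r1] /not_orP[n0 n1].
    rewrite (En2_moved GG UU uu)// !lt_neqAle r0 r1 !andbT.
    by apply/andP; split; apply/eqP => // e; exact: n0.
move: H; rewrite H2 => /(congr1 (fun y => (`|a|%:E * y)%E)).
rewrite !muleA -!EFinM mulfV ?mul1e ?gt_eqF// => <-.
congr (_%:E * _)%E; rewrite -exprVn expr2 -normfV.
have -> : a^-1 * a^-1 = `|a^-1| * `|a^-1| by rewrite -normrM ger0_norm// -expr2 sqr_ge0.
by rewrite mulrA normfV mulfV ?mul1r// gt_eqF.
Qed.

Lemma int_m_moved G G' a b r P : moved_pm a b G G' -> 0 <= r <= 1 ->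
  int_m (G' (a * r + b)) P = int_m (G r) P.
Proof.
by move=> GG r01; rewrite !int_mE (Jn_scale _ _ ler01 (pm_scale1 (GG r r01))) mul1r.
Qed.

(* The change of variables in the weak equation: test the original path with
   [Phi] precomposed with the affine map. *)
Lemma weak_affine a b G U u G' U' u' (Phi : R -> C -> 'M[R]_d) : a != 0 ->
  (forall t, 0 <= t <= 1 -> 0 <= a * t + b <= 1) ->
  moved_pm a b G G' -> moved a b U U' -> moved a b u u' ->
  weak_equation G U u -> C1b Phi -> sym_field Phi ->
  forall p q, 0 <= p <= 1 -> 0 <= q <= 1 ->
  int_m (G' (a * q + b)) (Phi (a * q + b)) - int_m (G' (a * p + b)) (Phi (a * p + b))
    - int_time (a * p + b) (a * q + b) (lhs G' Phi) =
  int_time (a * p + b) (a * q + b) (rhs G' U' u' Phi).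
Proof.
move=> a0 ab GG UU uu W cP sP p q p01 q01.
have [cQ dQ xQ] := C1b_affine a0 ab cP.
have sQ : sym_field (fun t => Phi (a * t + b)) by move=> t x t01; exact/sP/ab.
have := W _ cQ sQ p q p01 q01.
rewrite (int_m_moved (Phi (a * q + b)) GG q01) (int_m_moved (Phi (a * p + b)) GG p01).
rewrite !int_time_affine// => WQ.
have -> : int_time p q (fun r => a * lhs G' Phi (a * r + b)) =
    int_time p q (fun r => int_m (G r) (deriv_t (fun t => Phi (a * t + b)) r)).
  apply: int_time_eq => // r /open01 r01.
  rewrite /lhs (int_m_moved (deriv_t Phi (a * r + b)) GG r01) !int_mE -JnZl; congr Jn.
  by apply/funext => x; rewrite dQ.
rewrite WQ; apply: int_time_eq => // r r01; have r01' := open01 r01.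
rewrite /rhs !int_vvE !int_mmE !(Jn_scale _ _ ler01 (pm_scale1 (GG r r01'))) !mul1r.
have -> : U' (a * r + b) = (fun x => a^-1 *: U r x) by apply/funext => x; rewrite UU.
have -> : u' (a * r + b) = (fun x => a^-1 *: u r x) by apply/funext => x; rewrite uu.
have -> : div_mx Phi (a * r + b) = div_mx (fun t => Phi (a * t + b)) r.
  apply/funext => x; rewrite /div_mx; under [RHS]eq_mx do under eq_bigr do rewrite xQ//.
  by [].
by rewrite !JnZl -mulrDr mulrA mulfV// mul1r.
Qed.

Lemma measurable_affine_field (S : set mR) (a b : R) m (F : R -> C -> 'M[R]_(d, m)) i j c :
  measurable S -> (forall t, S t -> 0 <= a * t + b <= 1) -> measurable_field F ->
  measurable_fun (S `*` setT : set (mR * borel_space R d)%type)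
    (fun p => c * F (a * p.1 + b) p.2 i j).
Proof.
move=> mS SS mF; apply: measurable_funM => //.
have mSX : measurable (S `*` setT : set (mR * borel_space R d)%type).
  exact: measurableX.
have mD : measurable (`[0, 1] `*` setT : set (mR * borel_space R d)%type).
  by apply: measurableX => //; exact: measurable_itv.
have mg : measurable_fun (S `*` setT : set (mR * borel_space R d)%type)
    (fun p => (a * p.1 + b, p.2) : (mR * borel_space R d)%type).
  have m1 : measurable_fun setT (fun p : mR * borel_space R d => a * p.1 + b : mR).
    by apply: (measurableT_comp (measurable_affine a b)); exact: measurable_fst.
  have m2 : measurable_fun setT (fun p : mR * borel_space R d => p.2).
    exact: measurable_snd.
  exact: (measurable_funTS (measurable_fun_pair m1 m2)).
apply: (measurable_comp mD _ (mF i j) mg).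
by move=> _ [[t x] [/= St _] <-]; split => //=; rewrite in_itv/=; exact: SS.
Qed.

(** The space ['cV[R]_0] has one point: functions of time alone become fields, and [CB_affine] and
    [CB_union] apply to narrow continuity. *)
Lemma CB_time (V : normedModType R) (f : R -> V) : {within `[0, 1], continuous f} ->
  CB `[0, 1] (fun t (_ : 'cV[R]_0) => f t).
Proof.
move=> cf; split.
  apply/subspace_continuousP => -[t x] [/= t01 _] P NP.
  move/subspace_continuousP: cf => /(_ t t01 P NP) K.
  have : (fun q : R * 'cV[R]_0 => q.1) @ ((t, x) : R * 'cV[R]_0) --> t by exact: cvg_fst.
  move=> /(_ _ K) L.
  by apply: (@filterS _ (nbhs ((t, x) : R * 'cV[R]_0)) _ _ _ _ L) => q Hq [q01 _]; exact: Hq.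
have cn : {within `[0, 1], continuous (fun t => `|f t|)}.
  apply/subspace_continuousP => t t01; apply: cvg_norm.
  by move/subspace_continuousP: cf; exact.
have [c _ Hc] := EVT_max ler01 cn.
by exists `|f c| => t _; exact: Hc.
Qed.

End Moved.

(** * Time reversal *)

Section PathOperations.
Context (R : realType) (d : nat).
Local Notation C := ('cV[R]_d).
Local Notation mu := (@lebesgue_measure R).
Local Notation mR := (measurableTypeR R).
Implicit Types (G : R -> psd_measure R d) (U : R -> C -> 'M[R]_d) (u : R -> C -> C).

Definition affine_field (a b : R) m (F : R -> C -> 'M[R]_(d, m)) (t : R) (x : C) :=
  a *: F (a * t + b) x.

Lemma C1b_scale (c : R) m (A : R -> C -> 'M[R]_(d, m)) : C1b A ->
  C1b (fun t x => c *: A t x) /\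
  forall t, 0 <= t <= 1 -> vanish A t -> vanish (fun t x => c *: A t x) t.
Proof.
move=> cA; have [cS dS] := C1b_poly c%:P cA.
have E : (fun t x => (c%:P).[t] *: A t x) = (fun t x => c *: A t x).
  by apply/funext => t; apply/funext => x; rewrite hornerC.
rewrite E in cS dS; split => // t t01 [A0 dA0]; split=> x; first by rewrite A0 scaler0.
by rewrite dS// A0 dA0 !scaler0 addr0.
Qed.

(** Subtract the identity up to [s] from the one up to [t]. The time integrals are additive in their
    bounds because finite energy and bounded mass make the lower integrals of [|lhs|] and [|rhs|]
    finite. *)
Lemma weak_from0 G U u (Phi : R -> C -> 'M[R]_d) :
  narrow_continuous G -> (normsq G U u < +oo)%E -> C1b Phi ->
  let W s t := int_m (G t) (Phi t) - int_m (G s) (Phi s) -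
    int_time s t (lhs G Phi) = int_time s t (rhs G U u Phi) in
  (forall t, 0 <= t <= 1 -> W 0 t) ->
  forall s t, 0 <= s <= 1 -> 0 <= t <= 1 -> W s t.
Proof.
move=> nG fin cP W H s t s01 t01; rewrite /W.
rewrite (int_time_split s01 t01 (lhs_lfin nG cP)).
rewrite (int_time_split s01 t01 (rhs_lfin nG fin cP)).
have := H s s01; have := H t t01; rewrite /W => <- <-; lra.
Qed.

Section Reverse.
Variables (G : R -> psd_measure R d) (U : R -> C -> 'M[R]_d) (u : R -> C -> C).

Let rG (t : R) := G (- 1 * t + 1).
Let rU := affine_field (-1) 1 U.
Let ru := affine_field (-1) 1 u.

Let sK (t : R) : - 1 * (- 1 * t + 1) + 1 = t. Proof. by ring. Qed.
Let s01 (t : R) : 0 <= t <= 1 -> 0 <= - 1 * t + 1 <= 1.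
Proof. by move=> /andP[? ?]; apply/andP; split; lra. Qed.
Let n1 : -1 != 0 :> R. Proof. by rewrite oppr_eq0 oner_eq0. Qed.

Let rev_pm : moved_pm (-1) 1 G rG.
Proof. by move=> r r01 i j A mA; rewrite /rG sK. Qed.

Let rev_field m (F : R -> C -> 'M[R]_(d, m)) : moved (-1) 1 F (affine_field (-1) 1 F).
Proof. by move=> r _ x; rewrite /affine_field sK invrN invr1. Qed.

Let rev_normsq V v V' v' : moved (-1) 1 V V' -> moved (-1) 1 v v' ->
  normsq rG V' v' = normsq G V v.
Proof.
move=> HV Hv; rewrite normsqE.
have m01 : measurable (`[0, 1]%classic : set mR) by exact: measurable_itv.
have E : (fun r : R => -1 * r + 1) @^-1` `[0, 1] = `[0, 1]%classic.
  by apply/seteqP; split => t; rewrite /preimage/= !in_itv/= => /andP[? ?];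
    apply/andP; split; lra.
by rewrite (lint_En2_moved n1 m01 E rev_pm HV Hv) normrN1 invr1 mul1e.
Qed.

Lemma admissible_reverse A B : admissible A B G U u ->
  exists G' U' u', admissible B A G' U' u' /\ normsq G' U' u' = normsq G U u.
Proof.
move=> [nG GA GB [mU mu' sU fin [Un [un [H Hc]]]] W].
exists rG, rU, ru; split; last exact: (rev_normsq (rev_field U) (rev_field u)).
have nrG : narrow_continuous rG.
  move=> phi cp bp; have cb := CB_time (nG phi cp bp).
  have := @CB_affine R 0 _ `[0, 1] `[0, 1] _ (-1) 1 _ cb.
  move=> /(_ _)/CB_slice_t => /(_ 0); apply => t.
  by rewrite /= !in_itv/=; exact: s01.
split; first exact: nrG.
- by move=> i j A' mA'; rewrite /rG mulr0 add0r GB.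
- by move=> i j A' mA'; rewrite /rG mulr1 addNr GA.
- split.
  + move=> i j; have := @measurable_affine_field R d `[0, 1] (-1) 1 d U i j (-1).
    rewrite /rU /affine_field; under [X in _ -> measurable_fun _ X]eq_fun do rewrite mxE.
    by apply => //; move=> t; rewrite /= in_itv/=; exact: s01.
  + move=> i j; have := @measurable_affine_field R d `[0, 1] (-1) 1 1 u i j (-1).
    rewrite /ru /affine_field; under [X in _ -> measurable_fun _ X]eq_fun do rewrite mxE.
    by apply => //; move=> t; rewrite /= in_itv/=; exact: s01.
  + by move=> t x t01; rewrite /rU /affine_field /sym_mx linearZ/= sU// s01.
  + by rewrite (rev_normsq (rev_field U) (rev_field u)).
  + exists (fun n => affine_field (-1) 1 (Un n)), (fun n => affine_field (-1) 1 (un n)).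
    split=> [n|]; last first.
      under eq_cvg do rewrite (rev_normsq (movedB (rev_field U) (rev_field _))
        (movedB (rev_field u) (rev_field _))).
      exact: Hc.
    have [h1 h2 h3] := H n; split.
    * have [c _ _] := C1b_affine n1 s01 h1.
      by have [] := C1b_scale (-1) c.
    * by move=> t x t01; rewrite /affine_field /sym_mx linearZ/= h2// s01.
    * have [c _ _] := C1b_affine n1 s01 h3.
      by have [] := C1b_scale (-1) c.
- move=> Phi cP sP s t sI tI.
  have := @weak_affine _ _ (-1) 1 G U u rG rU ru Phi n1 s01 rev_pm (rev_field U)
    (rev_field u) W cP sP (-1 * s + 1) (-1 * t + 1) (s01 sI) (s01 tI).
  by rewrite !sK.
Qed.

End Reverse.

End PathOperations.

(** * Concatenation *)

Section Concatenation.
Context (R : realType) (d : nat).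
Local Notation C := ('cV[R]_d).
Local Notation mu := (@lebesgue_measure R).
Local Notation mR := (measurableTypeR R).
Variables (l : R) (l01 : 0 < l < 1).
Variables (G1 G2 : R -> psd_measure R d) (U1 U2 : R -> C -> 'M[R]_d)
  (u1 u2 : R -> C -> C).
Hypothesis G12 : pm_eq (G1 1) (G2 0).

(** With this shift [(1 - l)^-1 * t + b] is [(t - l) / (1 - l)], which maps [[l, 1]] onto
    [[0, 1]]. *)
Let b := - (l / (1 - l)).

Definition glue_field m (F1 F2 : R -> C -> 'M[R]_(d, m)) : R -> C -> 'M[R]_(d, m) :=
  glue l (fun t x => l^-1 *: F1 (l^-1 * t + 0) x)
    (fun t x => (1 - l)^-1 *: F2 ((1 - l)^-1 * t + b) x).

Let gG := glue l (fun t (_ : unit) => G1 (l^-1 * t + 0)) (fun t _ => G2 ((1 - l)^-1 * t + b)).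
Definition glue_pm t := gG t tt.

Let l0 : 0 < l. Proof. by case/andP: l01. Qed.
Let m0 : 0 < 1 - l. Proof. by case/andP: l01 => ? ?; lra. Qed.
Let ln0 : l != 0. Proof. by rewrite gt_eqF. Qed.
Let mn0 : 1 - l != 0. Proof. by rewrite gt_eqF. Qed.

Let lK r : l^-1 * (l * r + 0) + 0 = r. Proof. by rewrite !addr0 mulKf. Qed.
Let mK r : (1 - l)^-1 * ((1 - l) * r + l) + b = r.
Proof. by rewrite /b; field. Qed.

Let left_le r : (l * r + 0 <= l) = (r <= 1).
Proof. by rewrite addr0 ger_pMr. Qed.
Let right_le r : ((1 - l) * r + l <= l) = (r <= 0).
Proof. by rewrite gerDr pmulr_rle0. Qed.

Let left01 r : 0 <= r <= 1 -> 0 <= l * r + 0 <= 1.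
Proof.
move=> /andP[r0 r1]; rewrite {1}addr0 mulr_ge0 ?(ltW l0)//=.
have : l * r + 0 <= l by rewrite left_le.
by move: m0; lra.
Qed.
Let right01 r : 0 <= r <= 1 -> 0 <= (1 - l) * r + l <= 1.
Proof.
move=> /andP[r0 r1]; apply/andP; split.
  by apply: addr_ge0; [apply: mulr_ge0 => //|]; apply: ltW.
have : (1 - l) * r <= 1 - l by rewrite ger_pMr.
lra.
Qed.

Let left_pm : moved_pm l 0 G1 glue_pm.
Proof. by move=> r /andP[_ r1] i j A mA; rewrite /glue_pm /gG /glue left_le r1 lK. Qed.

Let right_pm : moved_pm (1 - l) l G2 glue_pm.
Proof.
move=> r /andP[r0 _] i j A mA; rewrite /glue_pm /gG /glue right_le.
(* At the junction time [glue] takes the left branch [G1 1]; [G12] identifies it with [G2 0]. *)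
case: ifPn => [r0'|_]; last by rewrite mK.
have -> : r = 0 by apply/eqP; rewrite eq_le r0 r0'.
by rewrite mulr0 add0r addr0 mulVf// G12.
Qed.

Let left_field m (F1 F2 : R -> C -> 'M[R]_(d, m)) : moved l 0 F1 (glue_field F1 F2).
Proof.
move=> r /andP[_ r1] x; rewrite /glue_field /glue left_le (ltW r1) lK//.
Qed.

Let right_field m (F1 F2 : R -> C -> 'M[R]_(d, m)) :
  moved (1 - l) l F2 (glue_field F1 F2).
Proof.
by move=> r /andP[r0 _] x; rewrite /glue_field /glue right_le leNgt r0/= mK.
Qed.

Let leftK t : l * (l^-1 * t + 0) + 0 = t.
Proof. by rewrite !addr0 mulVKf. Qed.
Let rightK t : (1 - l) * ((1 - l)^-1 * t + b) + l = t.
Proof. by rewrite /b; field. Qed.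

Let inv_left t : 0 <= t <= l -> 0 <= l^-1 * t + 0 <= 1.
Proof.
by move=> /andP[t0 tl]; rewrite addr0 mulr_ge0 ?invr_ge0 ?(ltW l0)//= ler_pdivrMl// mulr1.
Qed.
Let inv_right t : l <= t <= 1 -> 0 <= (1 - l)^-1 * t + b <= 1.
Proof.
move=> /andP[tl t1].
have -> : (1 - l)^-1 * t + b = (t - l) / (1 - l) by rewrite /b; field.
by rewrite divr_ge0 ?(ltW m0) ?subr_ge0//= ler_pdivrMr// mul1r lerD2r.
Qed.

Let normsq_glue V1 v1 V2 v2 V' v' :
  moved l 0 V1 V' -> moved l 0 v1 v' -> moved (1 - l) l V2 V' -> moved (1 - l) l v2 v' ->
  (normsq glue_pm V' v' <=
   l^-1%:E * normsq G1 V1 v1 + (1 - l)^-1%:E * normsq G2 V2 v2)%E.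
Proof.
move=> H1 h1 H2 h2; rewrite [leLHS]normsqE.
have mL : measurable (`[0, l]%classic : set mR) by exact: measurable_itv.
have mT : measurable (`[l, 1]%classic : set mR) by exact: measurable_itv.
have mT' : measurable (`]l, 1]%classic : set mR) by exact: measurable_itv.
have EL : (fun r => l * r + 0) @^-1` `[0, l] = `[0, 1]%classic.
  by apply/seteqP; split => t; rewrite /preimage/= !in_itv/= left_le addr0 pmulr_rge0.
have ET : (fun r => (1 - l) * r + l) @^-1` `[l, 1] = `[0, 1]%classic.
  apply/seteqP; split => t; rewrite /preimage/= !in_itv/= lerDr pmulr_rge0//;
    by rewrite -lerBrDr ger_pMr.
have E : `[0, 1]%classic = `[0, l]%classic `|` `]l, 1]%classic :> set R.
  apply/seteqP; split => t /=; rewrite !in_itv/=; last first.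
    by move: l0 m0 => ? ? [|] /andP[? ?]; apply/andP; split; lra.
  by move=> /andP[t0 t1]; have [tl|lt] := leP t l; [left|right]; rewrite ?t0 ?t1.
rewrite E lint_setU//; last 2 first.
- apply/disj_setPS => t [/=]; rewrite !in_itv/= => /andP[_ tl] /andP[lt _].
  by move: (lt_le_trans lt tl); rewrite ltxx.
- by move=> t _; exact: En2_ge0.
rewrite (lint_En2_moved ln0 mL EL left_pm H1 h1) gtr0_norm//.
have := lint_En2_moved mn0 mT ET right_pm H2 h2; rewrite (gtr0_norm m0) => <-.
(* The second piece is integrated over []l, 1]] on the left and over [[l, 1]] on the right; the
   inequality is enough for all later purposes. *)
apply: leeD => //; rewrite integral_mkcond [leRHS]integral_mkcond.
apply: lint_mono => t _; first by apply: erestrict_ge0 => ? _; exact: En2_ge0.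
rewrite /patch; case: ifPn; rewrite ?inE/= ?in_itv/=.
  by move=> /andP[lt t1]; rewrite mem_set//= in_itv/= (ltW lt).
by move=> _; case: ifP => // _; exact: En2_ge0.
Qed.

Let glue_measurable m (F1 F2 : R -> C -> 'M[R]_(d, m)) :
  measurable_field F1 -> measurable_field F2 -> measurable_field (glue_field F1 F2).
Proof.
move=> mF1 mF2 i j.
have mL : measurable (`[0, l]%classic : set mR) by exact: measurable_itv.
have mT : measurable (`]l, 1]%classic : set mR) by exact: measurable_itv.
have E : `[0, 1]%classic `*` setT = (`[0, l]%classic `*` setT) `|` (`]l, 1]%classic `*` setT)
    :> set (R * borel_space R d).
  apply/seteqP; split => -[t x] /=; rewrite !in_itv/=; last first.
    by move: l0 m0 => ? ? [|] [/andP[? ?] _]; split => //; apply/andP; split; lra.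
  by move=> [/andP[t0 t1] _]; have [tl|lt] := leP t l; [left|right]; rewrite ?t0 ?t1.
rewrite E; apply/measurable_funU; [exact: measurableX|exact: measurableX|split].
- have := @measurable_affine_field R d `[0, l] l^-1 0 m F1 i j l^-1 mL.
  move=> H; apply: eq_measurable_fun (H _ mF1).
    move=> -[t x]; rewrite inE/= in_itv/= => -[/andP[_ tl] _].
    by rewrite /glue_field /glue tl mxE.
  by move=> t; rewrite /= in_itv/=; exact: inv_left.
- have := @measurable_affine_field R d `]l, 1] (1 - l)^-1 b m F2 i j (1 - l)^-1 mT.
  move=> H; apply: eq_measurable_fun (H _ mF2).
    move=> -[t x]; rewrite inE/= in_itv/= => -[/andP[tl _] _].
    by rewrite /glue_field /glue leNgt tl/= mxE.
  by move=> t; rewrite /= in_itv/= => /andP[lt t1]; apply: inv_right; rewrite t1 ltW.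
Qed.

Let glue_sym F1 F2 : sym_field F1 -> sym_field F2 -> sym_field (glue_field F1 F2).
Proof.
move=> s1 s2 t x /andP[t0 t1]; rewrite /glue_field /glue.
have [tl|lt] := leP t l; rewrite /sym_mx linearZ/= ?s1 ?s2 ?inv_left ?inv_right ?t0 ?t1//.
by rewrite (ltW lt).
Qed.

Let glue_C1b m (F1 F2 : R -> C -> 'M[R]_(d, m)) : C1b F1 -> C1b F2 ->
  vanish F1 1 -> vanish F2 0 -> C1b (glue_field F1 F2).
Proof.
move=> c1 c2 v1 v2.
have [c1' v1'] := C1b_scale l^-1 c1; have [c2' v2'] := C1b_scale (1 - l)^-1 c2.
by apply: (C1b_glue l01 c1' c2'); [apply: v1'|apply: v2'] => //; rewrite lexx ler01.
Qed.

Let glue_narrow : narrow_continuous G1 -> narrow_continuous G2 ->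
  narrow_continuous glue_pm.
Proof.
move=> n1 n2 phi cp bp.
have c1 := CB_time (n1 phi cp bp); have c2 := CB_time (n2 phi cp bp).
pose F t (_ : 'cV[R]_0) := int_scalar (glue_pm t) phi.
suff : CB `[0, 1] F by move=> /CB_slice_t => /(_ 0).
have E : `[0, 1]%classic = `[0, l]%classic `|` `[l, 1]%classic :> set R.
  apply/seteqP; split => t /=; rewrite !in_itv/=; last first.
    by move: l0 m0 => ? ? [|] /andP[? ?]; apply/andP; split; lra.
  move=> /andP[t0 t1]; have [tl|lt] := leP t l; [left|right]; rewrite ?t0 ?t1//.
  by rewrite (ltW lt).
rewrite E; apply: CB_union; [exact: itv_closed|exact: itv_closed| |].
- have := @CB_affine R 0 _ `[0, l] `[0, 1] _ l^-1 0 _ c1.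
  move=> H; apply: CB_ext (H _) => [t x|t]; rewrite /= !in_itv/=.
    by move=> /andP[_ tl]; rewrite /F /glue_pm /gG /glue tl.
  exact: inv_left.
- have := @CB_affine R 0 _ `[l, 1] `[0, 1] _ (1 - l)^-1 b _ c2.
  move=> H; apply: CB_ext (H _) => [t x|t]; rewrite /= !in_itv/=.
    move=> /inv_right t01; rewrite /F -[in RHS](rightK t).
    by rewrite (int_scalar_scale phi ler01 (pm_scale1 (right_pm t01))) scale1r.
  exact: inv_right.
Qed.

Let glue_weak : narrow_continuous G1 -> narrow_continuous G2 ->
  (normsq glue_pm (glue_field U1 U2) (glue_field u1 u2) < +oo)%E ->
  weak_equation G1 U1 u1 -> weak_equation G2 U2 u2 ->
  weak_equation glue_pm (glue_field U1 U2) (glue_field u1 u2).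
Proof.
move=> n1 n2 fin W1 W2 Phi cP sP.
have nG := glue_narrow n1 n2.
apply: (weak_from0 nG fin cP) => t t01.
have H1 := weak_affine ln0 left01 left_pm (left_field U1 U2) (left_field u1 u2) W1 cP sP.
have H2 := weak_affine mn0 right01 right_pm (right_field U1 U2) (right_field u1 u2) W2 cP sP.
have I0 : 0 <= (0 : R) <= 1 by rewrite lexx ler01.
have I1 : 0 <= (1 : R) <= 1 by rewrite lexx ler01.
have [tl|lt] := leP t l.
  have tI : 0 <= l^-1 * t + 0 <= 1 by apply: inv_left; case/andP: t01 => -> _.
  by have := H1 _ _ I0 tI; rewrite leftK mulr0 addr0.
have tI : 0 <= (1 - l)^-1 * t + b <= 1.
  by apply: inv_right; case/andP: t01 => _ ->; rewrite (ltW lt).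
have lI : 0 <= l <= 1 by move: l0 m0; lra.
(* Past the junction, the identity of the first path over all of [[0, 1]] is added to that of the
   second path up to the reparametrized [t]; the terms at time [l] cancel. *)
have := H1 _ _ I0 I1; have := H2 _ _ I0 tI.
rewrite !rightK !mulr0 !mulr1 !addr0 !add0r.
rewrite (int_time_split lI t01 (lhs_lfin nG cP)).
rewrite (int_time_split lI t01 (rhs_lfin nG fin cP)); lra.
Qed.

Lemma admissible_glue A B D : admissible A B G1 U1 u1 -> admissible B D G2 U2 u2 ->
  admissible A D glue_pm (glue_field U1 U2) (glue_field u1 u2) /\
  (normsq glue_pm (glue_field U1 U2) (glue_field u1 u2) <=
   l^-1%:E * normsq G1 U1 u1 + (1 - l)^-1%:E * normsq G2 U2 u2)%E.
Proof.
move=> [n1 GA1 GB1 L1 W1] [n2 GA2 GB2 L2 W2].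
have LE := normsq_glue (left_field U1 U2) (left_field u1 u2)
  (right_field U1 U2) (right_field u1 u2).
have [mU1 mu1 sU1 fin1 _] := L1; have [mU2 mu2 sU2 fin2 _] := L2.
have li0 : 0 < l^-1 by rewrite invr_gt0.
have mi0 : 0 < (1 - l)^-1 by rewrite invr_gt0.
have fin : (normsq glue_pm (glue_field U1 U2) (glue_field u1 u2) < +oo)%E.
  apply: le_lt_trans LE _; apply: lte_add_pinfty;
    by apply: lte_mul_pinfty => //; rewrite lee_fin ltW.
split; last exact: LE.
split; first exact: glue_narrow.
- move=> i j X mX; rewrite /glue_pm /gG /glue (ltW l0) mulr0 addr0; exact: GA1.
- move=> i j X mX; have := @right_pm 1; rewrite lexx ler01 => /(_ isT) H.
  by have := H i j X mX; rewrite mulr1 subrK => ->; exact: GB2.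
- have [V1 [v1 [C1 Z1 N1]]] := in_L2_vanish n1 L1.
  have [V2 [v2 [C2 Z2 N2]]] := in_L2_vanish n2 L2.
  split; [exact: glue_measurable|exact: glue_measurable|exact: glue_sym|exact: fin|].
  exists (fun n => glue_field (V1 n) (V2 n)), (fun n => glue_field (v1 n) (v2 n)).
  split=> [n|].
    have [c1 s1 k1] := C1 n; have [c2 s2 k2] := C2 n.
    have [_ z1 _ y1] := Z1 n; have [z2 _ y2 _] := Z2 n.
    by split; [exact: glue_C1b|exact: glue_sym|exact: glue_C1b].
  apply/cvge0P => [n|e e0]; first exact: normsq_ge0.
  (* The tolerances carry the factors [l] and [1 - l] to compensate for the speeds in
     [normsq_glue]. *)
  have e1 : 0 < l * (e / 2) by rewrite mulr_gt0// divr_gt0.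
  have e2 : 0 < (1 - l) * (e / 2) by rewrite mulr_gt0// divr_gt0.
  move/cvge0P : N1 => /(_ (fun n => normsq_ge0 _ _ _) _ e1) K1.
  move/cvge0P : N2 => /(_ (fun n => normsq_ge0 _ _ _) _ e2) K2.
  apply: (@filterS2 _ \oo _ _ _ _ _ K1 K2) => n k1 k2.
  apply: (le_trans (normsq_glue (movedB (left_field U1 U2) (left_field (V1 n) (V2 n)))
   (movedB (left_field u1 u2) (left_field (v1 n) (v2 n)))
   (movedB (right_field U1 U2) (right_field (V1 n) (V2 n)))
   (movedB (right_field u1 u2) (right_field (v1 n) (v2 n))))).
  apply: (@le_trans _ _ (l^-1%:E * (l * (e / 2))%:E + (1 - l)^-1%:E * ((1 - l) * (e / 2))%:E)%E).
    by apply: leeD; apply: lee_wpmul2l => //; rewrite lee_fin ltW.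
  by rewrite -!EFinM -EFinD !mulKf// lee_fin; lra.
- exact: glue_weak.
Qed.

End Concatenation.

(** * The path (1 - c t)^2 G *)

Section UnderIntegral.
Context (R : realType) (d : nat).
Local Notation C := ('cV[R]_d).
Local Notation X := (borel_space R d).
Local Notation mu := (@lebesgue_measure R).
Variable (H : psd_measure R d).

Lemma bilBl m g (A A' B : 'M[R]_(d, m)) : bil g (A - A') B = bil g A B - bil g A' B.
Proof. by rewrite -(scaleN1r A') bilDl bilZl mulN1r. Qed.

Lemma continuous_borel (phi : C -> R) : continuous phi ->
  measurable_fun setT (phi : X -> R).
Proof.
move=> cphi; apply: (measurability _ (RGenOpens.measurableE R)).
move=> _ [_ [a [b ->]] <-]; rewrite setTI; apply: sub_sigma_algebra.
by apply: open_comp => // x _; exact: cphi.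
Qed.

Lemma cvg_bil m T (F : set_system T) {FF : Filter F} g
    (A_ : T -> 'M[R]_(d, m)) (A B : 'M[R]_(d, m)) :
  A_ s @[s --> F] --> A -> bil g (A_ s) B @[s --> F] --> bil g A B.
Proof.
move=> cA; under eq_cvg do rewrite bilE.
rewrite bilE; do 3!apply: cvg_sumr => ?.
apply: cvgM; last exact: cvg_cst; apply: cvgM; first exact: cvg_cst.
exact: (@cvg_comp _ _ _ A_ (fun A : 'M[R]_(d, m) => A _ _) F (nbhs A) _ cA
  (@coord_continuous _ _ _ _ _ A)).
Qed.

Lemma rd_tr_integrable (K : R) :
  (trace_measure H).-integrable setT (fun x => (K * \tr (rd H x))%:E).
Proof.
under eq_fun do rewrite EFinM; apply: integrableZl => //.
under eq_fun do rewrite /mxtrace -sumEFin.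
by apply: integrable_sum => // i _; exact: rd_integrable.
Qed.

Lemma bil1_bound (A : 'M[R]_d) (M : R) (x : X) : 0 <= M ->
  (forall i k, `|A i k| <= M) ->
  `|bil (rd H x) A 1%:M| <= kdim R d d * (M + 1) ^+ 2 * \tr (rd H x).
Proof.
move=> M0 AM; apply: le_trans (bil_young _ _ (rd_psd H x) ltr01) _.
have h1 : bil (rd H x) A A <= kdim R d d * (M + 1) ^+ 2 * \tr (rd H x).
  apply: bil_bound => [|i k]; first exact: rd_psd.
  by apply: le_trans (AM i k) _; rewrite lerDl.
have h2 : bil (rd H x) 1%:M 1%:M <= kdim R d d * (M + 1) ^+ 2 * \tr (rd H x).
  apply: bil_bound; first exact: rd_psd.
  by move=> i k; rewrite mxE; case: eqP => _; rewrite ?normr1 ?normr0 ?lerDr ?addr_ge0.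
by rewrite invr1; lra.
Qed.

Lemma bil_integrable (Psi : C -> 'M[R]_d) (M : R) :
  (forall i j, continuous (fun x => Psi x i j)) ->
  (forall x i k, `|Psi x i k| <= M) ->
  (trace_measure H).-integrable setT (fun x => (bil (rd H x) (Psi x) 1%:M)%:E).
Proof.
move=> cP PM; have mP : measurable_fun setT (fun x : X => bil (rd H x) (Psi x) 1%:M).
  under eq_fun do rewrite bilE.
  do 3!apply: measurable_sum => ?.
  apply: measurable_funM => //; apply: measurable_funM; first exact: rd_measurable.
  exact: continuous_borel.
apply: (@le_integrable _ _ _ _ _ measurableT _
  (fun x => ((kdim R d d * (`|M| + 1) ^+ 2) * \tr (rd H x))%:E)).
- exact/measurable_EFinP.
- move=> x _; rewrite lee_fin [leRHS]ger0_norm; last first.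
    by apply: mulr_ge0; [apply: mulr_ge0; rewrite ?kdim_ge0 ?sqr_ge0|
      exact/psd_tr_ge0/rd_psd].
  by apply: bil1_bound => // i k; exact: le_trans (PM x i k) (ler_norm _).
- exact: rd_tr_integrable.
Qed.

(* The closed formula for [min (max t 0) 1]. *)
Definition clamp (t : R) : R := (`|t| - `|t - 1| + 1) / 2.

Lemma clampE t : 0 <= t <= 1 -> clamp t = t.
Proof.
move=> /andP[t0 t1]; rewrite /clamp ger0_norm// ler0_norm ?subr_le0//.
by rewrite opprB; lra.
Qed.

Lemma clamp01 t : 0 <= clamp t <= 1.
Proof.
rewrite /clamp; have [t0|t0] := ger0P t; have [t1|t1] := ger0P (t - 1);
  by apply/andP; split; lra.
Qed.

Lemma continuous_clamp : continuous clamp.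
Proof.
move=> t; apply: cvgM; last exact: cvg_cst.
apply: cvgD; last exact: cvg_cst.
apply: cvgB; apply: cvg_norm; first exact: cvg_id.
by apply: cvgB; [exact: cvg_id|exact: cvg_cst].
Qed.

Lemma continuous_comp_clamp (V : topologicalType) (g : R -> V) :
  {within `[0, 1], continuous g} -> continuous (g \o clamp).
Proof.
move=> /subspace_continuousP cg t P NP.
have t01 : `[0, 1]%classic (clamp t) by rewrite /= in_itv/= clamp01.
have K := cg _ t01 P NP.
apply: (@filterS _ (nbhs t) _ _ _ _ (@continuous_clamp t _ K)) => s; apply.
by rewrite /= in_itv/= clamp01.
Qed.

Lemma int_m_continuous (Psi : R -> C -> 'M[R]_d) : Cb01 Psi ->
  {within `[0, 1], continuous (fun t => int_m H (Psi t))}.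
Proof.
move=> cP; have [M M0 HM] := Cb01_entry cP.
have cB : CB `[0, 1] Psi.
  case: cP => c [N HN]; split => //; exists N => t x; rewrite /= in_itv/=; exact: HN.
have I (t : R) : (trace_measure H).-integrable setT
    (fun x => (bil (rd H x) (Psi (clamp t) x) 1%:M)%:E).
  apply: (bil_integrable (M := M)) => [i j x|x i k]; last exact/HM/clamp01.
  have cx : {for x, continuous (Psi (clamp t))}.
    by apply: (CB_slice cB); rewrite /= in_itv/= clamp01.
  exact: (@cvg_comp _ _ _ (Psi (clamp t)) (fun A : 'M[R]_d => A i j) _ _ _ cx
    (@coord_continuous _ _ _ i j _)).
pose K := kdim R d d * (M + 1) ^+ 2.
(* Continuity under the integral is invoked on an open interval around [[0, 1]]. Composing with
   [clamp] keeps the field continuous and bounded by [M] there and leaves it unchanged on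
   [[0, 1]]. *)
have cc : {in `](-1), 2[, continuous (fun t => Jn H (Psi (clamp t)) (fun=> 1%:M))}.
  have := @continuity_under_integral R _ X (trace_measure H)
    (fun t x => bil (rd H x) (Psi (clamp t) x) 1%:M) setT measurableT (-1) 2 _ _
    (fun x => K * \tr (rd H x)) _ _.
  move=> L t; rewrite -inE => t12; apply: L => //.
  - by move=> s _; exact: I.
  - apply: aeW => x _ s _; apply: cvg_bil.
    exact: (continuous_comp_clamp (@CB_slice_t _ _ _ _ _ x cB)) s.
  - exact: rd_tr_integrable.
  - move=> s _; apply: aeW => x _; apply: bil1_bound => // i k.
    exact/HM/clamp01.
apply/subspace_continuousP => t; rewrite /= in_itv/= => t01 P.
move=> NP0; have NP : nbhs (Jn H (Psi (clamp t)) (fun=> 1%:M)) P.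
  by rewrite (clampE t01) -int_mE.
have t12 : t \in `](-1), 2[ by rewrite in_itv/=; case/andP: t01 => ? ?; apply/andP; split; lra.
apply: (@filterS _ (nbhs t) _ _ _ _ (cc t t12 P NP)) => s Ps.
rewrite /= in_itv/= => s01; change (P (int_m H (Psi s))).
by rewrite int_mE -(clampE s01).
Qed.

(** A neighbourhood of an interior time lies in [[0, 1]], so the relative limit is the two-sided
    derivative. *)
Lemma is_derive_within (g : R -> R) (t l : R) : 0 < t < 1 ->
  (s - t)^-1 * (g s - g t) @[s --> within `[0, 1] t^'] --> l -> is_derive t 1 g l.
Proof.
move=> /andP[t0 t1] Hg.
have K : h^-1 *: (g (h *: 1 + t) - g t) @[h --> 0^'] --> l.
  move=> P NP; have N := Hg P NP.
  have N01 : \forall s \near t, s \in `[0, 1].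
    have : nbhs t `]0, 1[%classic.
      apply: open_nbhs_nbhs; split; [exact: itv_open|by rewrite /= in_itv/= t0].
    apply: filterS => s; rewrite /= !in_itv/= => /andP[? ?]; apply/andP; split; lra.
  have c : (fun h : R => h *: 1 + t) @ (0 : R) --> t.
    rewrite -[X in _ --> X]add0r -[X in _ --> X + _](scale0r (1 : R)).
    apply: cvgD; last exact: cvg_cst.
    by apply: cvgZl; exact: cvg_id.
  apply: (@filterS2 _ (nbhs (0 : R)) _ _ _ _ _ (c _ N) (c _ N01)) => h h1 h2 h0.
  have /= := h1 _ h2; rewrite /GRing.scale/= mulr1 addrK; apply.
  by rewrite -subr_eq0 addrK.
apply: DeriveDef; first by apply/cvg_ex; exists l.
exact: cvg_lim.
Qed.

Lemma int_m_derive (Phi : R -> C -> 'M[R]_d) (t : R) : C1b Phi -> 0 < t < 1 ->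
  is_derive t 1 (fun s => int_m H (Phi s)) (int_m H (deriv_t Phi t)).
Proof.
move=> cPhi t01; have [h1 _ c3 c4 _] := cPhi.
have [M M0 HM] := Cb01_entry c3; have [N N0 HN] := Cb01_entry c4.
have [hD _ cB _ _] := C1b_C1S cPhi.
pose F (s : R) (x : X) : R := bil (rd H x) (Phi s x) 1%:M.
have dF (s : R) (x : X) : 0 < s < 1 ->
    is_derive s 1 (F ^~ x) (bil (rd H x) (deriv_t Phi s x) 1%:M).
  move=> s01; apply: is_derive_within => //.
  have s01' : `[0, 1]%classic s by rewrite /= in_itv/=; exact: open01.
  have PF := within01_proper (open01 s01).
  have Q r : (r - s)^-1 * (F r x - F s x) = bil (rd H x) (dquot_t Phi s x r) 1%:M.
    by rewrite /F /dquot_t bilZl bilBl.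
  under eq_cvg do rewrite Q.
  exact: (@cvg_bil d R (within `[0, 1] s^') _ (rd H x) (dquot_t Phi s x) _ _ (hD s x s01')).
have intF (s : R) : `]0, 1[%classic s ->
    (trace_measure H).-integrable setT (EFin \o F s).
  rewrite /= in_itv/= => s01; apply: (bil_integrable (M := M)) => [i j x|x i k].
    have cx : {for x, continuous (Phi s)}.
      by apply: (CB_slice cB); rewrite /= in_itv/=; exact: open01.
    exact: (@cvg_comp _ _ _ (Phi s) (fun A : 'M[R]_d => A i j) _ _ _ cx
      (@coord_continuous _ _ _ i j _)).
  exact/HM/open01.
pose K := kdim R d d * (N + 1) ^+ 2.
have ub (s : R) (x : X) : `]0, 1[%classic s -> setT x ->
    `|partial1of2 F s x| <= K * \tr (rd H x).
  rewrite /= in_itv/= => s01 _; rewrite partial1of2E.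
  have [_ ->] := dF s x s01; apply: bil1_bound => // i k; exact/HN/open01.
have tI : `]0, 1[%classic t by rewrite /= in_itv.
have der (s : R) (x : X) : `]0, 1[%classic s -> setT x -> derivable (F ^~ x) s 1.
  by rewrite /= in_itv/= => s01 _; have [] := dF s x s01.
have K0 (x : X) : 0 <= K * \tr (rd H x).
  apply: mulr_ge0; last exact/psd_tr_ge0/rd_psd.
  by apply: mulr_ge0; rewrite ?kdim_ge0 ?sqr_ge0.
have iK : (trace_measure H).-integrable setT (EFin \o (fun x => K * \tr (rd H x))).
  exact: rd_tr_integrable.
have E : (fun s => int_m H (Phi s)) = (fun s => \int[trace_measure H]_x F s x).
  by apply/funext => s; rewrite int_mE.
rewrite E; apply: DeriveDef.
  exact: (derivable_under_integral measurableT tI intF der K0 iK ub).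
rewrite -derive1E (differentiation_under_integral measurableT tI intF der K0 iK ub).
rewrite int_mE; apply: eq_Rintegral => x _.
by rewrite partial1of2E; have [_ ->] := dF t x t01.
Qed.

End UnderIntegral.

Section ScalingPath.
Context (R : realType) (d : nat).
Local Notation C := ('cV[R]_d).
Local Notation mu := (@lebesgue_measure R).
Local Notation mR := (measurableTypeR R).
Variables (G0 : psd_measure R d) (c : R) (c01 : 0 <= c <= 1).

(** For [c = 1] the path ends at 0, for [c = 0] it is constant. The derivative of [(1 - c t)^2] is
    [(1 - c t)^2] times [- 2 c / (1 - c t)], so the equation holds with zero velocity and that
    multiple of the identity. *)
Definition path_pm (t : R) : psd_measure R d := scale_pm (sqr_ge0 (1 - c * t)) G0.
(* [expR (- ln y)] is [y^-1] for [0 < y], and it is manifestly measurable. *)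
Definition path_coef (t : R) : R := - (2 * c) * expR (- ln (1 - c * t)).
Definition path_mx (t : R) (x : C) : 'M[R]_d := path_coef t *: 1%:M.
Definition path_v (t : R) (x : C) : C := 0.

Let pmP t : pm_scale ((1 - c * t) ^+ 2) G0 (path_pm t).
Proof. exact: scale_pmP. Qed.

Let En_zero (H : psd_measure R d) m : En H (fun=> (0 : 'M[R]_(d, m))) = 0%E.
Proof. by apply: integral0_eq => x _; rewrite /bil mulmx0 mul0mx mxtrace0. Qed.

Let pos r : 0 < r < 1 -> 0 < 1 - c * r.
Proof.
move=> /andP[r0 r1]; case/andP: c01 => c0 c1; rewrite subr_gt0.
by apply: le_lt_trans r1; rewrite ler_piMl// ltW.
Qed.

Let coefE r : 0 < r < 1 -> path_coef r = - (2 * c) / (1 - c * r).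
Proof. by move=> /pos p; rewrite /path_coef expRN lnK. Qed.

Let path_En2 t (k : R) :
  (En2 (path_pm t) (fun=> (k *: 1%:M)%R) (fun=> 0%R) <=
   (((1 - c * t) * k) ^+ 2 * (kdim R d d * mass G0))%:E)%E.
Proof.
rewrite /En2 En_zero add0e (En_scale _ (sqr_ge0 _) (pmP t)) EnZ muleA -EFinM.
rewrite -exprMn [leRHS]EFinM; apply: lee_wpmul2l; first by rewrite lee_fin sqr_ge0.
rewrite -[X in (X * _)%R]mulr1 -[X in (_ * X * _)%R](expr1n R 2); apply: En_bound => x i j.
by rewrite mxE; case: eqP => _; rewrite ?normr1 ?normr0.
Qed.

Let K := kdim R d d * mass G0.
Let K0 : 0 <= K. Proof. by apply: mulr_ge0; [exact: kdim_ge0|exact: mass_ge0]. Qed.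

Let m01 : measurable (`[0, 1]%classic : set mR).
Proof. exact: measurable_itv. Qed.

Let path_normsq_le (k : R -> R) (h : R -> R) :
  (forall r, 0 <= h r) -> (forall r, 0 < r < 1 -> ((1 - c * r) * k r) ^+ 2 <= h r) ->
  (normsq path_pm (fun t _ => (k t *: 1%:M)%R) (fun _ _ => 0%R) <=
   \int[mu]_(t in `[0%R, 1%R]) (h t * K)%:E)%E.
Proof.
move=> h0 kh; rewrite normsqE; have [mN N0] := null01 R.
apply: (lint_null_le m01 mN N0) => r.
- by move=> _; exact: En2_ge0.
- by move=> _; rewrite lee_fin mulr_ge0.
- rewrite /= in_itv/= => /andP[r0 r1] /not_orP[n0 n1].
  apply: le_trans (path_En2 r (k r)) _; rewrite lee_fin ler_wpM2r//.
  apply: kh; rewrite !lt_neqAle r0 r1 !andbT.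
  by apply/andP; split; apply/eqP => // e; exact: n0.
Qed.

(** The weight [(1 - c t)^2] cancels the squared pole of the coefficient and leaves [4 c^2] at every
    interior time, also for [c = 1]. *)
Lemma path_normsq : (normsq path_pm path_mx path_v <= (4 * c ^+ 2 * K)%:E)%E.
Proof.
have := @path_normsq_le path_coef (fun=> 4 * c ^+ 2).
rewrite lint01_cst; apply => r; first by rewrite mulr_ge0 ?sqr_ge0.
move=> r01; rewrite coefE// mulrCA mulfV ?gt_eqF ?pos// mulr1 sqrrN exprMn.
by rewrite -natrX.
Qed.

Let path_narrow : narrow_continuous path_pm.
Proof.
move=> phi _ _; apply: continuous_subspaceT => t.
rewrite (_ : (fun t => _) = fun t => ((1 - c * t) ^+ 2) *: int_scalar G0 phi); last first.
  by apply/funext => s; rewrite (int_scalar_scale phi (sqr_ge0 _) (pmP s)).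
apply: cvgZl; pose p : {poly R} := (1 - c%:P * 'X) ^+ 2.
have -> : (fun t => (1 - c * t) ^+ 2) = horner p.
  by apply/funext => s; rewrite /p !(horner_exp, hornerE).
have -> : (1 - c * t) ^+ 2 = p.[t] by rewrite /p !(horner_exp, hornerE).
exact: continuous_horner.
Qed.

Let path_measurable : measurable_field path_mx.
Proof.
move=> i j; apply: measurable_funTS; rewrite /path_mx.
under eq_fun do rewrite mxE.
apply: measurable_funM => //.
apply: (measurableT_comp (f := path_coef : mR -> R)); last exact: measurable_fst.
apply: measurable_funM => //; apply: (measurableT_comp (@measurable_expR R)).
apply: measurableT_comp => //; apply: (measurableT_comp (@measurable_ln R)).
by apply: measurable_funB => //; exact: measurable_funM.
Qed.

(** Partial sums of the geometric series of [- 2 c / (1 - c t)]: bounded smooth fields even when the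
    coefficient itself is unbounded. *)
Let path_poly (n : nat) : {poly R} := (- (2 * c)) *: \sum_(k < n) c ^+ k *: 'X^k.

Let path_polyE n r : (path_poly n).[r] = - (2 * c) * \sum_(k < n) (c * r) ^+ k.
Proof.
rewrite /path_poly hornerZ horner_sum; congr (_ * _); apply: eq_bigr => k _.
by rewrite hornerZ hornerXn exprMn.
Qed.

Let C1b_cst (V : normedModType R) (v : V) : C1b (fun (_ : R) (_ : C) => v).
Proof.
suff : C1S `[0, 1] (fun (_ : R) (_ : C) => v) (fun _ _ => 0) (fun _ _ _ => 0).
  by case/C1S_C1b.
apply: (@C1S_static R d V _ (fun=> v) (fun _ _ => 0)).
- exact: cst_continuous.
- by exists `|v|.
- by move=> k; exact: cst_continuous.
- by move=> k; exists 0 => x; rewrite normr0.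
Qed.

Let path_L2 : in_L2 path_pm path_mx path_v.
Proof.
have [c0 c1] := andP c01.
split.
- exact: path_measurable.
- move=> i j; rewrite (_ : (fun _ => _) = cst 0); first exact: measurable_cst.
  by apply/funext => p; rewrite /path_v mxE.
- by move=> t x _; rewrite /sym_mx /path_mx linearZ/= trmx1.
- exact: le_lt_trans path_normsq (ltry _).
have cst1 := C1b_cst (1%:M : 'M[R]_d); have cst0 := C1b_cst (0 : C).
exists (fun n t x => (path_poly n).[t] *: 1%:M), (fun _ _ _ => 0); split=> [n|].
  split; [by have [] := C1b_poly (path_poly n) cst1| |exact: cst0].
  by move=> t x _; rewrite /sym_mx linearZ/= trmx1.
have B n : (normsq path_pm (fun t x => path_mx t x - (path_poly n).[t] *: 1%:M)%R
    (fun t x => path_v t x - 0)%R <= (4 * K / n.*2.+1%:R)%:E)%E.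
  have -> : (fun t x => path_mx t x - (path_poly n).[t] *: 1%:M) =
      (fun t (_ : C) => (path_coef t - (path_poly n).[t]) *: (1%:M : 'M[R]_d)).
    by apply/funext => t; apply/funext => x; rewrite scalerBl.
  have -> : (fun t x => path_v t x - 0) = (fun _ _ => 0).
    by apply/funext => t; apply/funext => x; rewrite subr0.
  have := @path_normsq_le (fun t => path_coef t - (path_poly n).[t])
    (fun t => 4 * t ^+ n.*2).
  have -> : (\int[mu]_(t in `[0%R, 1%R]) (4 * t ^+ n.*2 * K)%:E =
      (4 * K / n.*2.+1%:R)%:E)%E.
    under eq_integral do rewrite mulrAC EFinM.
    have K40 : 0 <= 4 * K by exact: mulr_ge0.
    rewrite lintZ//; first by rewrite lint_pow.
    by move=> t _; rewrite lee_fin -muln2 exprM sqr_ge0.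
  apply=> r; first by rewrite mulr_ge0// -muln2 exprM sqr_ge0.
  move=> r01; have p := pos r01; have [r0 r1] := andP r01.
  (* With [x = c r], [1 - x] times the partial sum is [1 - x^n]: multiplied by the weight, only a
     power of [x] remains of the tail. *)
  have -> : (1 - c * r) * (path_coef r - (path_poly n).[r]) = - (2 * c) * (c * r) ^+ n.
    rewrite coefE// path_polyE -mulrBr mulrCA; congr (_ * _).
    rewrite mulrBr mulfV ?gt_eqF//.
    by have := subrX1 (c * r) n; lra.
  have -> : (- (2 * c) * (c * r) ^+ n) ^+ 2 = c ^+ 2 * (c ^+ n) ^+ 2 * (4 * r ^+ n.*2).
    have E : (c * r) ^+ n = c ^+ n * r ^+ n by rewrite exprMn.
    by rewrite E -muln2 exprM; ring.
  apply: ler_piMl; first by rewrite mulr_ge0// exprn_ge0// ltW.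
  by rewrite -exprM mulr_ile1 ?exprn_ge0 ?exprn_ile1.
apply/cvge0P => [n|e e0]; first exact: normsq_ge0.
have Ke0 : 0 <= 4 * K / e by rewrite divr_ge0 ?(ltW e0)// mulr_ge0.
exists (Num.bound (4 * K / e)) => // n /= Nn; apply: le_trans (B n) _.
rewrite lee_fin ler_pdivrMr ?ltr0n// [leRHS]mulrC -ler_pdivrMr//.
apply: le_trans (ltW (archi_boundP Ke0)) _; rewrite ler_nat.
by apply: leq_trans Nn _; rewrite -addnn; exact: leqW (leq_addr _ _).
Qed.

Let pa : {poly R} := (1 - c%:P * 'X) ^+ 2.

Let paE r : pa.[r] = (1 - c * r) ^+ 2.
Proof. by rewrite /pa !(horner_exp, hornerE). Qed.

Let dpaE r : pa^`().[r] = - (2 * c) * (1 - c * r).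
Proof.
rewrite /pa expr2 !(derivM, derivB, derivC, derivX, hornerE).
by ring.
Qed.

(** The integrands on the two sides are the two terms of the product rule for [pa * f], where [f] is
    the pairing of [G0] with [Phi]. The equation is the fundamental theorem of calculus for this
    product. *)
Let path_weak : weak_equation path_pm path_mx path_v.
Proof.
move=> Phi cP sP.
have fin : (normsq path_pm path_mx path_v < +oo)%E.
  exact: le_lt_trans path_normsq (ltry _).
apply: (weak_from0 path_narrow fin cP) => t /andP[t0 t1].
pose f (r : R) := int_m G0 (Phi r); pose f1 (r : R) := int_m G0 (deriv_t Phi r).
have int_mS s P : int_m (path_pm s) P = pa.[s] * int_m G0 P.
  by rewrite !int_mE (Jn_scale _ _ (sqr_ge0 _) (pmP s)) paE.
have I0 : 0 <= (0 : R) <= 1 by rewrite lexx ler01.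
have I1 : 0 <= t <= 1 by rewrite t0 t1.
have -> : int_time 0 t (lhs path_pm Phi) = int_time 0 t (fun r => pa.[r] * f1 r).
  by apply: int_time_eq => // r _; rewrite /lhs int_mS.
have -> : int_time 0 t (rhs path_pm path_mx path_v Phi) =
    int_time 0 t (fun r => pa^`().[r] * f r).
  apply: int_time_eq => // r r01; rewrite /rhs int_vvE int_mmE.
  have -> : Jn (path_pm r) (path_v r) (div_mx Phi r) = 0.
    rewrite /Jn /Rintegral integral0_eq// => x _.
    by rewrite /bil /path_v mulmx0 mul0mx mxtrace0.
  rewrite add0r (Jn_scale _ _ (sqr_ge0 _) (pmP r)) JnZl mulrA dpaE /f int_mE.
  congr (_ * _).
    by rewrite coefE// expr2 -mulrA mulrC; field; rewrite gt_eqF// pos.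
  by apply: eq_Rintegral => x _; rewrite bil_sym//; have [] := rd_psd G0 x.
rewrite !int_mS -/(f t) -/(f 0).
have [->|tn0] := eqVneq t 0; first by rewrite !int_timexx !subrr.
have tp : 0 < t by rewrite lt_neqAle eq_sym tn0.
rewrite /int_time t0.
have [_ _ c3 c4 _] := cP.
have cf := @int_m_continuous _ _ G0 _ c3; have cf1 := @int_m_continuous _ _ G0 _ c4.
have sub : (`[0, t]%classic : set R) `<=` `[0, 1].
  by move=> r; rewrite /= !in_itv/= => /andP[? ?]; apply/andP; split; lra.
have ch (q : {poly R}) : {within `[0, t], continuous (horner q)}.
  by apply: continuous_subspaceT; exact: continuous_horner.
have cM (q : {poly R}) (g : R -> R) : {within `[0, 1], continuous g} ->
    {within `[0, t], continuous (fun r => q.[r] * g r)}.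
  move=> cg; apply/subspace_continuousP => r r0t; apply: cvgM.
    by move/subspace_continuousP: (ch q); exact.
  by move/subspace_continuousP: (continuous_subspaceW sub cg); exact.
have c1 := cM pa^`() f cf; have c2 := cM pa f1 cf1; have c3' := cM pa f cf.
have i1 : mu.-integrable `[0, t] (EFin \o (fun r => pa^`().[r] * f r)).
  by apply: continuous_compact_integrable => //; exact: segment_compact.
have i2 : mu.-integrable `[0, t] (EFin \o (fun r => pa.[r] * f1 r)).
  by apply: continuous_compact_integrable => //; exact: segment_compact.
have dH (r : R) : 0 < r < 1 ->
    is_derive r 1 (fun s => pa.[s] * f s) (pa^`().[r] * f r + pa.[r] * f1 r).
  move=> r01; have d1 := @int_m_derive _ _ G0 _ _ cP r01.
  have d2 : is_derive r 1 (horner pa) pa^`().[r].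
    apply: DeriveDef; first exact: derivable_horner.
    by rewrite -derive1E derivE.
  apply: (is_derive_eq (is_deriveM d2 d1)).
  by rewrite /GRing.scale/= addrC mulrC.
have o1 (r : R) : r \in `]0, t[ -> 0 < r < 1.
  by rewrite in_itv/= => /andP[? ?]; apply/andP; split; lra.
have /continuous_within_itvP := c3'; move=> /(_ tp)[_ cl cr].
have := @continuous_FTC2 R (fun r => pa^`().[r] * f r + pa.[r] * f1 r)
  (fun r => pa.[r] * f r) 0 t tp _ _ _.
move=> FTC; suff : \int[mu]_(r in `[0, t]) (pa^`().[r] * f r + pa.[r] * f1 r) =
    pa.[t] * f t - pa.[0] * f 0.
  have m0t : measurable (`[0, t]%classic : set mR) by exact: measurable_itv.
  by rewrite (RintegralD m0t i1 i2) => <-; rewrite addrK.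
rewrite /Rintegral FTC//.
- apply/subspace_continuousP => r r0t; apply: cvgD.
    by move/subspace_continuousP: c1; exact.
  by move/subspace_continuousP: c2; exact.
- by split => // r /o1 r01; have [] := dH r r01.
- by move=> r /o1 r01; rewrite derive1E; have [_ ->] := dH r r01.
Qed.

Lemma admissible_scaling (A B : psd_measure R d) :
  pm_eq G0 A -> pm_scale ((1 - c) ^+ 2) G0 B ->
  admissible A B path_pm path_mx path_v.
Proof.
move=> GA GB; split.
- exact: path_narrow.
- move=> i j X mX; rewrite (pmP 0)// mulr0 subr0 expr1n mul1e; exact: GA.
- by move=> i j X mX; rewrite (pmP 1)// mulr1 GB.
- exact: path_L2.
- exact: path_weak.
Qed.

End ScalingPath.

(** * Uniqueness of matrix measures *)

Section NiceFunctions.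
Context (R : realType) (d : nat).
Local Notation C := ('cV[R]_d).
Local Notation X := (borel_space R d).

Definition bounded_continuous (V : normedModType R) (f : C -> V) : Prop :=
  continuous f /\ exists M : R, forall x, `|f x| <= M.

Definition bC1 (phi : C -> R) : Prop :=
  bounded_continuous phi /\
  forall k, exists2 psi : C -> R, bounded_continuous psi &
    forall x, is_derive x (basis_vec R k) phi (psi x).

Lemma bc_cst (c : R) : bounded_continuous (fun _ : C => c).
Proof. by split; [exact: cst_continuous|exists `|c|]. Qed.

Lemma bcB (f g : C -> R) : bounded_continuous f -> bounded_continuous g ->
  bounded_continuous (fun x => f x - g x).
Proof.
move=> [cf [M HM]] [cg [N HN]]; split.
  by move=> x; exact: (@cvgB _ _ _ (nbhs x) _ f g _ _ (cf x) (cg x)).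
exists (M + N) => x; apply: le_trans (ler_normB _ _) _; exact: lerD.
Qed.

Lemma bcD (f g : C -> R) : bounded_continuous f -> bounded_continuous g ->
  bounded_continuous (fun x => f x + g x).
Proof.
move=> [cf [M HM]] [cg [N HN]]; split.
  by move=> x; exact: (@cvgD _ _ _ (nbhs x) _ f g _ _ (cf x) (cg x)).
exists (M + N) => x; apply: le_trans (ler_normD _ _) _; exact: lerD.
Qed.

Lemma bcM (f g : C -> R) : bounded_continuous f -> bounded_continuous g ->
  bounded_continuous (fun x => f x * g x).
Proof.
move=> [cf [M HM]] [cg [N HN]]; split.
  by move=> x; exact: (@cvgM _ _ (nbhs x) _ f g _ _ (cf x) (cg x)).
by exists (M * N) => x; rewrite normrM ler_pM.
Qed.

Lemma bC1_cst (c : R) : bC1 (fun=> c).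
Proof.
split=> [|k]; first exact: bc_cst.
by exists (fun=> 0) => [|x]; [exact: bc_cst|exact: is_derive_cst].
Qed.

Lemma bC1B (f g : C -> R) : bC1 f -> bC1 g -> bC1 (fun x => f x - g x).
Proof.
move=> [bf df] [bg dg]; split; first exact: bcB.
move=> k; have [f' bf' Hf] := df k; have [g' bg' Hg] := dg k.
exists (fun x => f' x - g' x); first exact: bcB.
by move=> x; have h1 := Hf x; have h2 := Hg x; exact: is_deriveB.
Qed.

Lemma bC1M (f g : C -> R) : bC1 f -> bC1 g -> bC1 (fun x => f x * g x).
Proof.
move=> [bf df] [bg dg]; split; first exact: bcM.
move=> k; have [f' bf' Hf] := df k; have [g' bg' Hg] := dg k.
exists (fun x => f x * g' x + g x * f' x); first by apply: bcD; exact: bcM.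
by move=> x; have h1 := Hf x; have h2 := Hg x; exact: (is_deriveM h1 h2).
Qed.

Lemma bC1_prod I (r : seq I) (f : I -> C -> R) : (forall i, bC1 (f i)) ->
  bC1 (fun x => \prod_(i <- r) f i x).
Proof.
move=> H; elim: r => [|i r IH].
  by under eq_fun do rewrite big_nil; exact: bC1_cst.
by under eq_fun do rewrite big_cons; exact: bC1M.
Qed.

Lemma bC1_exp (f : C -> R) n : bC1 f -> bC1 (fun x => f x ^+ n).
Proof.
move=> nf; elim: n => [|n IH]; first exact: bC1_cst.
by under eq_fun do rewrite exprS; exact: bC1M.
Qed.

(** For functions given by cases, a global quadratic remainder is easier to establish than a limit
    of difference quotients. *)
Lemma is_derive_quadratic (phi : C -> R) (x v : C) (l K : R) :
  (forall h, `|phi (h *: v + x) - phi x - h * l| <= K * h ^+ 2) ->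
  is_derive x v phi l.
Proof.
move=> H; have Hc : h^-1 *: (phi (h *: v + x) - phi x) @[h --> 0^'] --> l.
  apply/cvgrPdist_le => e e0.
  have K0 : 0 < `|K| + 1 by rewrite ltr_wpDl.
  have d0 : 0 < e / (`|K| + 1) by rewrite divr_gt0.
  have N := @dnbhs0_lt R R^o _ d0; apply: filterS2 N (nbhs_dnbhs_neq (0 : R)) => h hd h0.
  have -> : l - h^-1 *: (phi (h *: v + x) - phi x) =
      - (h^-1 * (phi (h *: v + x) - phi x - h * l)).
    by rewrite /GRing.scale/=; field.
  rewrite normrN normrM normfV ler_pdivrMl ?normr_gt0//.
  apply: le_trans (H h) _; rewrite -[h ^+ 2]ger0_norm ?sqr_ge0// normrX expr2 mulrCA.
  apply: ler_wpM2l => //; apply: (@le_trans _ _ ((`|K| + 1) * `|h|)).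
    by apply: ler_wpM2r => //; have := ler_norm K; lra.
  by rewrite mulrC -ler_pdivlMr// ltW.
apply: DeriveDef; first by apply/cvg_ex; exists l.
exact: cvg_lim.
Qed.

(* [x^+ = max x 0], in closed form *)
Definition posp (x : R) : R := (x + `|x|) / 2.

Lemma posp_ge x : 0 <= x -> posp x = x.
Proof. by move=> x0; rewrite /posp ger0_norm//; lra. Qed.

Lemma posp_le x : x <= 0 -> posp x = 0.
Proof. by move=> x0; rewrite /posp ler0_norm//; lra. Qed.

(** Squaring the positive part removes its kink, so that the function is C^1 also at [z = 1] and
    [z = -1]; [dbump] is its derivative. *)
Definition bump (z : R) : R := posp (1 - z ^+ 2) ^+ 2.
Definition dbump (z : R) : R := - 4 * z * posp (1 - z ^+ 2).

Lemma sqr_le1_norm (z : R) : (z ^+ 2 <= 1) = (`|z| <= 1).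
Proof. by rewrite -real_normK ?num_real// expr_le1. Qed.

(** [1 - z^2 = (1 - |z|) (1 + |z|)], where the second factor is at most 2 and the first at most
    [|w| - |z|]. *)
Lemma bump_edge (z w : R) : z ^+ 2 <= 1 -> 1 <= w ^+ 2 -> 1 - z ^+ 2 <= 2 * `|w - z|.
Proof.
rewrite sqr_le1_norm => z1; rewrite -[w ^+ 2]real_normK ?num_real// expr_ge1// => w1.
have := lerB_dist w z; rewrite -[z ^+ 2]real_normK ?num_real//.
have : 0 <= `|z| by []; move: `|z| `|w| `|w - z| z1 w1 => a b c; rewrite expr2; nra.
Qed.

(** If both points are inside, the remainder is an explicit multiple of [(w - z)^2]. If the segment
    leaves [[-1, 1]], [bump_edge] makes every term quadratic; the constant is [4 + 8], from [bump z]
    and from the linear term. *)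
Lemma bump_taylor (z w : R) :
  `|bump w - bump z - (w - z) * dbump z| <= 12 * (w - z) ^+ 2.
Proof.
rewrite /bump /dbump.
have D2 : (w - z) ^+ 2 = `|w - z| ^+ 2 by rewrite real_normK// num_real.
have D0 : 0 <= `|w - z| by [].
have [z1|z1] := leP (z ^+ 2) 1; have [w1|w1] := leP (w ^+ 2) 1.
- rewrite !posp_ge ?subr_ge0//.
  have -> : (1 - w ^+ 2) ^+ 2 - (1 - z ^+ 2) ^+ 2 - (w - z) * (- 4 * z * (1 - z ^+ 2)) =
      (w ^+ 2 + 2 * w * z + 3 * z ^+ 2 - 2) * (w - z) ^+ 2 by ring.
  rewrite normrM [`|_ ^+ 2|]ger0_norm ?sqr_ge0//; apply: ler_wpM2r; first exact: sqr_ge0.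
  have h1 := sqr_ge0 (w + z); have h2 := sqr_ge0 w; have h3 := sqr_ge0 z.
  have h4 := sqr_ge0 (w - z).
  by rewrite ler_norml; apply/andP; split; move: h1 h2 h3 h4 z1 w1;
    rewrite !expr2 => *; lra.
- rewrite (posp_le (_ : 1 - w ^+ 2 <= 0)) ?posp_ge; [|lra|lra].
  have E := bump_edge z1 (ltW w1); have p0 : 0 <= 1 - z ^+ 2 by lra.
  have zn : `|z| <= 1 by rewrite -sqr_le1_norm.
  apply: (@le_trans _ _ (`|(1 - z ^+ 2) ^+ 2| + `|(w - z) * (- 4 * z * (1 - z ^+ 2))|)).
    rewrite expr0n/= sub0r; apply: le_trans (ler_normB _ _) _.
    by rewrite normrN.
  rewrite expr2 !normrM normrN (ger0_norm p0) (_ : `|4| = 4 :> R); last by rewrite ger0_norm.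
  rewrite D2 [leRHS]mulrC.
  move: `|w - z| `|z| (1 - z ^+ 2) D0 zn p0 E (normr_ge0 z) => D a p D0 a1 p0 E a0.
  have h1 : p * p <= 2 * D * (2 * D) by apply: ler_pM.
  have h2 : D * (4 * a * p) <= D * (4 * (2 * D)).
    apply: ler_wpM2l => //; rewrite -mulrA; apply: ler_wpM2l => //.
    by rewrite -[leRHS]mul1r; apply: ler_pM.
  by rewrite expr2; lra.
- rewrite (posp_le (_ : 1 - z ^+ 2 <= 0)) ?posp_ge; [|lra|lra].
  have E := bump_edge w1 (ltW z1); rewrite distrC in E.
  rewrite expr0n/= !mulr0 !subr0 normrX ger0_norm ?subr_ge0// D2.
  have : 0 <= 1 - w ^+ 2 by lra.
  move: `|w - z| (1 - w ^+ 2) D0 E => D p D0 E p0.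
  have : p * p <= 2 * D * (2 * D) by apply: ler_pM.
  by have := mulr_ge0 D0 D0; rewrite !expr2; lra.
- rewrite !posp_le; [|lra|lra]; rewrite expr0n/= !mulr0 !subr0 normr0.
  by rewrite mulr_ge0// sqr_ge0.
Qed.

Lemma bump01 z : 0 <= bump z <= 1.
Proof.
rewrite /bump; have [h|h] := leP (z ^+ 2) 1.
  rewrite posp_ge ?subr_ge0// sqr_ge0 exprn_ile1 ?subr_ge0//.
  by rewrite gerBl sqr_ge0.
by rewrite posp_le ?expr0n ?lexx ?ler01// subr_le0 ltW.
Qed.

Lemma bump_gt0 z : (0 < bump z) = (`|z| < 1).
Proof.
have E : (z ^+ 2 < 1) = (`|z| < 1) by rewrite -real_normK ?num_real// expr_lt1.
rewrite -E /bump; have [h|h] := leP (z ^+ 2) 1.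
  by rewrite posp_ge ?subr_ge0// exprn_even_gt0//= subr_eq0 eq_sym lt_neqAle h andbT.
rewrite posp_le ?subr_le0 ?(ltW h)// expr0n/= ltxx; apply/esym/negbTE.
by rewrite -leNgt ltW.
Qed.

Lemma dbump_le z : `|dbump z| <= 4.
Proof.
rewrite /dbump; have [h|h] := leP (z ^+ 2) 1.
  rewrite posp_ge ?subr_ge0// !normrM normrN (ger0_norm (_ : 0 <= 1 - _)) ?subr_ge0//.
  have -> : `|4| = 4 :> R by rewrite ger0_norm.
  have zn : `|z| <= 1 by rewrite -sqr_le1_norm.
  rewrite -mulrA -[leRHS]mulr1; apply: ler_wpM2l => //.
  by apply: mulr_ile1; rewrite ?subr_ge0// gerBl sqr_ge0.
by rewrite posp_le ?mulr0 ?normr0// subr_le0 ltW.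
Qed.

Lemma cvg_posp T (F : set_system T) {FF : Filter F} (f : T -> R) (l : R) :
  f x @[x --> F] --> l -> posp (f x) @[x --> F] --> posp l.
Proof.
by move=> fl; apply: cvgM; [apply: cvgD => //; exact: cvg_norm|exact: cvg_cst].
Qed.

Lemma continuous_bump : continuous bump.
Proof.
move=> z.
have H : posp (1 - y ^+ 2) @[y --> z] --> posp (1 - z ^+ 2).
  by apply: cvg_posp; apply: cvgB; [exact: cvg_cst|exact: exprn_continuous].
exact: (cvgM H H).
Qed.

Lemma continuous_dbump : continuous dbump.
Proof.
move=> z; apply: cvgM; first by apply: cvgM; [exact: cvg_cst|exact: cvg_id].
by apply: cvg_posp; apply: cvgB; [exact: cvg_cst|exact: exprn_continuous].
Qed.

Definition coord_bump (m r : R) (i : 'I_d) (x : C) : R := bump ((x i 0 - m) / r).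

Lemma bC1_coord_bump m r i : r != 0 -> bC1 (coord_bump m r i).
Proof.
move=> r0.
have cc (g : R -> R) : continuous g ->
    continuous (fun x : C => g ((x i 0 - m) / r)).
  move=> cg x; apply: (@cvg_comp _ _ _ (fun x : C => (x i 0 - m) / r) g (nbhs x)
    (nbhs ((x i 0 - m) / r))); last exact: cg.
  apply: cvgM; last exact: cvg_cst; apply: cvgB; last exact: cvg_cst.
  exact: coord_continuous.
split.
  split; first exact: cc continuous_bump.
  exists 1 => x; have /andP[b0 b1] := bump01 ((x i 0 - m) / r).
  by rewrite /coord_bump ger0_norm.
have E k h (x : C) : (h *: basis_vec R k + x) i 0 = h * (i == k)%:R + x i 0.
  by rewrite /basis_vec !mxE eqxx andbT.
move=> k; have [->|ki] := eqVneq k i; last first.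
  exists (fun=> 0); first exact: bc_cst.
  move=> x; apply: (@is_derive_quadratic _ _ _ _ 0) => h.
  by rewrite /coord_bump E eq_sym (negbTE ki) mulr0n mulr0 add0r subrr subr0 normr0 mul0r.
exists (fun x => dbump ((x i 0 - m) / r) * r^-1).
  apply: bcM; last exact: bc_cst.
  by split; [exact: cc continuous_dbump|exists 4 => x; exact: dbump_le].
move=> x; apply: (@is_derive_quadratic _ _ _ _ (12 * (r^-1) ^+ 2)) => h.
rewrite /coord_bump E eqxx mulr1n mulr1.
have := bump_taylor ((x i 0 - m) / r) ((h + x i 0 - m) / r).
have -> : (h + x i 0 - m) / r - (x i 0 - m) / r = h * r^-1 by field.
have -> : 12 * r^-1 ^+ 2 * h ^+ 2 = 12 * (h * r^-1) ^+ 2 by ring.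
by rewrite -mulrA (mulrC r^-1).
Qed.

Definition box_bump (m : C) (r : R) (x : C) : R := \prod_i coord_bump (m i 0) r i x.

Lemma bC1_box_bump m r : r != 0 -> bC1 (box_bump m r).
Proof. by move=> r0; apply: bC1_prod => i; exact: bC1_coord_bump. Qed.

Lemma box_bump01 m r x : 0 <= box_bump m r x <= 1.
Proof.
have b i : 0 <= coord_bump (m i 0) r i x <= 1 by exact: bump01.
apply/andP; split; first by apply: prodr_ge0 => i _; case/andP: (b i).
by apply: prodr_ile1 => i _; exact: b.
Qed.

Lemma box_bump_gt0 m r x : 0 < r -> 0 < box_bump m r x <-> forall i, `|x i 0 - m i 0| < r.
Proof.
move=> r0; have E i : (0 < coord_bump (m i 0) r i x) = (`|x i 0 - m i 0| < r).
  rewrite /coord_bump bump_gt0 normrM normfV (gtr0_norm r0).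
  by rewrite ltr_pdivrMr// mul1r.
split=> [p i|H]; last by apply: prodr_gt0 => i _; rewrite E.
rewrite -E lt_neqAle eq_sym; apply/andP; split; last first.
  by have /andP[] := bump01 ((x i 0 - m i 0) / r).
apply: contraTneq p => c0; rewrite /box_bump (bigD1 i)//= c0 mul0r ltxx//.
Qed.

End NiceFunctions.

Section Uniqueness.
Context (R : realType) (d : nat).
Local Notation C := ('cV[R]_d).
Local Notation X := (borel_space R d).
Implicit Types (G A B : psd_measure R d).

Lemma bC1_measurable (phi : C -> R) : bC1 phi -> measurable_fun setT (phi : X -> R).
Proof. by move=> [[c _] _]; exact: continuous_borel. Qed.

Lemma pos_set_measurable (phi : C -> R) : bC1 phi ->
  measurable ([set x | 0 < phi x] : set X).
Proof.
move=> /bC1_measurable mphi.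
have := mphi measurableT _ (@measurable_itv R `]0, +oo[); rewrite setTI.
by congr measurable; apply/seteqP; split => x /=; rewrite in_itv/= andbT.
Qed.

Lemma integrable_mul_density G i j (f : X -> R) : measurable_fun setT f ->
  (forall x, 0 <= f x <= 1) ->
  (trace_measure G).-integrable setT (fun x => (f x * density G x i j)%:E).
Proof.
move=> mf f01; apply: le_integrable (density_integrable G i j) => //.
  apply/measurable_EFinP; apply: measurable_funM => //.
  by apply/measurable_EFinP; case/integrableP: (density_integrable G i j).
move=> x _; rewrite lee_fin normrM; have /andP[f0 f1] := f01 x.
by rewrite ler_piMl// ger0_norm.
Qed.

(** As [n] grows, [1 - (1 - phi)^(n+1)] tends to the indicator of [phi > 0], and the integrands are
    dominated by the modulus of the density. These approximants are again bounded C^1 functions. *)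
Lemma charge_pos_set G i j (phi : C -> R) : bC1 phi -> (forall x, 0 <= phi x <= 1) ->
  (int_scalar G (fun x => 1 - (1 - phi x) ^+ n.+1) i j)%:E @[n --> \oo] -->
  G i j [set x | 0 < phi x].
Proof.
move=> np p01; set S := [set x | _].
have mphi := bC1_measurable np; have mS : measurable (S : set X) := pos_set_measurable np.
pose f n (x : X) := ((1 - (1 - phi x) ^+ n.+1) * density G x i j)%:E.
have m1 n : measurable_fun setT (fun x : X => 1 - (1 - phi x) ^+ n.+1).
  apply: measurable_funB => //; apply: measurable_funX; exact: measurable_funB.
have b1 n x : 0 <= 1 - (1 - phi x) ^+ n.+1 <= 1.
  have /andP[p0 p1] := p01 x; have q0 : 0 <= 1 - phi x by rewrite subr_ge0.
  have q1 : 1 - phi x <= 1 by rewrite gerBl.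
  by rewrite subr_ge0 exprn_ile1//= gerBl exprn_ge0.
have iF n := @integrable_mul_density G i j _ (m1 n) (b1 n).
have E n : (int_scalar G (fun x => 1 - (1 - phi x) ^+ n.+1) i j)%:E =
    (\int[trace_measure G]_x f n x)%E.
  by rewrite mxE /Rintegral fineK//; exact: integrable_fin_num.
under eq_cvg do rewrite E.
have idG := density_integrable G i j; have [mdG _] := integrableP _ _ _ idG.
have := @dominated_convergence _ _ _ (trace_measure G) setT measurableT f
  ((fun x => (density G x i j)%:E) \_ S) (fun x => `|(density G x i j)%:E|%E).
rewrite -integral_mkcond integral_density//; case => //.
- by move=> n; case/integrableP: (iF n).
- by apply/(measurable_restrictT _ _).1; [exact: mS|exact: measurable_funS mdG].
- apply/aeW => x _; rewrite patchE.
  have /andP[p0 p1] := p01 x.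
  case: ifPn => [|].
    rewrite inE /S/= => pp; apply: cvg_EFin; first exact: nearW.
    rewrite /f/= -[X in _ --> X]mul1r; apply: cvgM; last exact: cvg_cst.
    rewrite -[X in _ --> X]subr0; apply: cvgB; first exact: cvg_cst.
    have h : `|1 - phi x| < 1 by rewrite ger0_norm ?subr_ge0// gtrBl.
    by have := cvg_expr h; rewrite -(cvg_shiftS (fun n => (1 - phi x) ^+ n)).
  rewrite notin_setE /S/= => /negP; rewrite -leNgt => pp.
  have -> : f ^~ x = cst 0%E; last exact: cvg_cst.
  apply/funext => n; rewrite /f; have -> : phi x = 0 by lra.
  by rewrite subr0 expr1n subrr mul0r.
- exact: integrable_abse.
- apply/aeW => x n _; rewrite lee_fin normrM; have /andP[f0 f1] := b1 n x.
  by rewrite ler_piMl// ger0_norm.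
Qed.

(** The generating family for Dynkin's theorem: closed under intersection because test functions can
    be multiplied, and rich enough to generate the open sets by means of boxes. *)
Definition pos_sets : set (set X) :=
  [set S | exists phi : C -> R, [/\ bC1 phi, forall x, 0 <= phi x <= 1 &
     S = [set x | 0 < phi x]]].

Lemma pos_setsI : setI_closed pos_sets.
Proof.
move=> _ _ [f [nf f01 ->]] [g [ng g01 ->]]; exists (fun x => f x * g x); split.
- exact: bC1M.
- move=> x; have /andP[f0 f1] := f01 x; have /andP[g0 g1] := g01 x.
  by rewrite mulr_ge0// mulr_ile1.
- apply/seteqP; split => x /= => [[]|fg]; first exact: mulr_gt0.
  have /andP[f0 _] := f01 x; have /andP[g0 _] := g01 x.
  move: fg; rewrite !lt_neqAle !(eq_sym 0) f0 g0 !andbT mulf_eq0 negb_or.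
  by move=> /andP[/andP[-> ->]].
Qed.

Lemma open_pos_sets (O : set C) : open O -> <<s pos_sets >> O.
Proof.
move=> oO; pose rv (v : 'cV[rat]_d) : C := \col_i ratr (v i 0).
pose box k := if unpickle k is Some (v, n) then
  [set x | 0 < box_bump (rv v) n.+1%:R^-1 x] else set0.
pose F k := if `[< box k `<=` O >] then box k else set0.
have rn n : 0 < n.+1%:R^-1 :> R by rewrite invr_gt0.
have -> : O = \bigcup_k F k.
  apply/seteqP; split => [x Ox|x [k _]]; last first.
    by rewrite /F; case: asboolP => // kO; exact: kO.
  have /nbhs_ballP[e /= e0 He] := open_nbhs_nbhs (conj oO Ox).
  (* The centre is within [1 / (n + 1)] of [x], and so is every point of the box from the centre;
     twice this radius has to stay below [e]. *)
  have [n _ ne] : exists2 n, True & 2 * n.+1%:R^-1 < e.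
    exists (Num.bound (2 / e)) => //; rewrite -ltr_pdivlMl// [_ * e]mulrC.
    rewrite -[ltRHS]invrK ltf_pV2 ?posrE ?invr_gt0 ?divr_gt0// invf_div.
    have := archi_boundP (ltW (divr_gt0 (ltr0Sn R 1) e0)) => /lt_le_trans; apply.
    by rewrite ler_nat.
  have /choice[r hr] (i : 'I_d) : exists r : rat, `|x i 0 - ratr r| < n.+1%:R^-1.
    have [|r] := @rat_in_itvoo R (x i 0 - n.+1%:R^-1) (x i 0 + n.+1%:R^-1).
      by move: (rn n); move: (n.+1%:R^-1) => q; lra.
    rewrite in_itv/= => /andP[r1 r2]; exists r; rewrite ltr_norml.
    by move: (n.+1%:R^-1) r1 r2 => q; lra.
  exists (pickle ((\col_i r i : 'cV[rat]_d), n)) => //.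
  rewrite /F /box pickleK; case: asboolP => [_|[]].
    by apply/box_bump_gt0 => // i; rewrite !mxE; exact: hr.
  move=> y /(box_bump_gt0 _ _ (rn n)) Hy; apply: He; split => // i j; rewrite ord1.
  apply: le_lt_trans ne; have := Hy i; have := hr i; rewrite !mxE => h1 h2.
  rewrite /ball_/=; apply: ltW; have := ler_distD (ratr (r i)) (x i 0) (y i 0).
  by rewrite (distrC (ratr _)); move: (n.+1%:R^-1) h1 h2 => q; lra.
have [_ _ U] := @smallest_sigma_algebra _ setT pos_sets.
apply: U => k; rewrite /F; case: asboolP => _.
  rewrite /box; case: (unpickle k) => [[v n]|].
    apply: sub_sigma_algebra; exists (box_bump (rv v) n.+1%:R^-1); split => //.
      by apply: bC1_box_bump; rewrite gt_eqF.
    by move=> x; exact: box_bump01.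
  by case: (@smallest_sigma_algebra _ setT pos_sets).
by case: (@smallest_sigma_algebra _ setT pos_sets).
Qed.

Lemma pm_eq_int_scalar A B :
  (forall phi, bC1 phi -> int_scalar A phi = int_scalar B phi) -> pm_eq A B.
Proof.
move=> AB i j S mS.
have gE : @measurable _ X = <<s pos_sets >>.
  apply/seteqP; split.
    by apply: smallest_sub; [exact: smallest_sigma_algebra|exact: open_pos_sets].
  apply: smallest_sub; first exact: sigma_algebra_measurable.
  by move=> _ [phi [np _ ->]]; exact: pos_set_measurable.
have PP S' : pos_sets S' -> A i j S' = B i j S'.
  move=> [phi [np p01 ->]]; have cA := @charge_pos_set A i j _ np p01.
  have cB := @charge_pos_set B i j _ np p01.
  have E n : int_scalar A (fun x => 1 - (1 - phi x) ^+ n.+1) =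
      int_scalar B (fun x => 1 - (1 - phi x) ^+ n.+1).
    by apply: AB; apply: bC1B; [exact: bC1_cst|apply: bC1_exp; apply: bC1B; [exact: bC1_cst|]].
  by apply: (cvg_unique (@ereal_hausdorff R) cA) => /=; under eq_cvg do rewrite E.
have PT : A i j setT = B i j setT.
  (* The whole space is the positivity set of the constant 1. Equality of total values is what
     passes to complements. *)
  apply: PP; exists (fun=> 1); split; first exact: bC1_cst.
    by move=> _; rewrite ler01 lexx.
  by apply/seteqP; split => // x _; exact: ltr01.
apply: (dynkin_induction gE pos_setsI PT PP _ _ _); last by rewrite -gE.
- by move=> S' mS' E; rewrite -setTD !chargeD// !setTI E PT.
- move=> F mF tF E; have mU : measurable (\bigcup_k F k) by exact: bigcup_measurable.
  have cA := @charge_semi_sigma_additive _ _ _ (A i j) F mF tF mU.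
  have cB := @charge_semi_sigma_additive _ _ _ (B i j) F mF tF mU.
  apply: (cvg_unique (@ereal_hausdorff R) cA) => /=.
  by under eq_cvg do under eq_bigr do rewrite E.
Qed.

End Uniqueness.

(** * Lower bound and the distance axioms *)

Section LowerBound.
Context (R : realType) (d : nat).
Local Notation C := ('cV[R]_d).
Local Notation X := (borel_space R d).
Local Notation mu := (@lebesgue_measure R).
Implicit Types (A B : psd_measure R d) (G : R -> psd_measure R d)
  (U : R -> C -> 'M[R]_d) (u : R -> C -> C).

Definition test_mx (phi : C -> R) (S : 'M[R]_d) (_ : R) (x : C) : 'M[R]_d := phi x *: S.

Lemma C1b_test phi S : bC1 phi -> C1b (test_mx phi S) /\
  forall t, 0 <= t <= 1 -> deriv_t (test_mx phi S) t = fun=> 0.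
Proof.
move=> [[cphi [M HM]] dphi].
have /choice[psi Hpsi] k : exists psi : C -> R, bounded_continuous psi /\
    forall x, is_derive x (basis_vec R k) phi (psi x).
  by have [psi ? ?] := dphi k; exists psi.
have cZ (f : C -> R) : continuous f -> continuous (fun x => f x *: S).
  by move=> cf x; exact: cvgZl (cf x).
have bZ (f : C -> R) : (exists M, forall x, `|f x| <= M) ->
    exists M, forall x, `|f x *: S| <= M.
  by move=> [N HN]; exists (N * `|S|) => x; rewrite normrZ ler_wpM2r.
have : C1S `[0, 1] (test_mx phi S) (fun _ _ => 0) (fun k _ x => psi k x *: S).
  apply: (@C1S_static R d _ _ (fun x => phi x *: S) (fun k x => psi k x *: S)).
  - move=> x k; have [_ /(_ x)[dv vE]] := Hpsi k.
    have Hc : h^-1 *: (phi (h *: basis_vec R k + x) *: S - phi x *: S) @[h --> 0^'] -->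
        psi k x *: S.
      under eq_cvg do rewrite -scalerBl scalerA.
      by apply: cvgZl; rewrite -vE; exact: dv.
    apply: DeriveDef; first by apply/cvg_ex; exists (psi k x *: S).
    exact: cvg_lim.
  - exact: cZ.
  - by apply: bZ; exists M.
  - by move=> k; apply: cZ; have [[]] := Hpsi k.
  - by move=> k; apply: bZ; have [[]] := Hpsi k.
move=> /C1S_C1b[c1 c2 _]; split => // t t01.
by apply/funext => x; rewrite c2.
Qed.

Lemma int_m_test A phi S t :
  int_m A (test_mx phi S t) = \int[trace_measure A]_x (phi x * \tr (rd A x *m S)).
Proof.
rewrite int_mE; apply: eq_Rintegral => x _.
by rewrite /test_mx bilZl /bil trmx1 mulmx1.
Qed.

Lemma mass_test A t : int_m A (test_mx (fun=> 1) 1%:M t) = mass A.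
Proof. by rewrite int_m_test; apply: eq_Rintegral => x _; rewrite mul1r mulmx1. Qed.

Lemma tr_mul_delta (g : 'M[R]_d) i j : \tr (g *m delta_mx i j) = g j i.
Proof.
rewrite /mxtrace (bigD1 j)//= big1 ?addr0 => [|k kj].
  rewrite mxE (bigD1 i)//= big1 ?addr0 => [|k ki]; first by rewrite mxE !eqxx mulr1.
  by rewrite mxE (negbTE ki) mulr0.
by rewrite mxE big1// => l _; rewrite mxE (negbTE kj) andbF mulr0.
Qed.

(** Test fields have to be symmetric, so an entry is read off with the symmetrized elementary
    matrix. The factor 2 is right also for [i = j]. *)
Lemma int_scalar_test A phi i j t :
  int_m A (test_mx phi (delta_mx i j + delta_mx j i) t) = 2 * int_scalar A phi i j.
Proof.
rewrite int_m_test int_scalarE -RintZ//; apply: eq_Rintegral => x _.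
have [s _] := rd_psd A x; have E : rd A x j i = rd A x i j by rewrite -[in LHS]s mxE.
by rewrite mulmxDr mxtraceD !tr_mul_delta E; lra.
Qed.

(** The test field does not depend on time, so the [lhs] term drops out and only Young's bound on
    [rhs] remains. [K] is fixed before the path, and [s] stays free to balance energy against
    mass. *)
Lemma static_test_bound phi S : bC1 phi -> sym_mx S ->
  exists2 K : R, 0 <= K & forall A B G U u (N M s t : R), 0 < s -> 0 <= t <= 1 ->
  admissible A B G U u -> (normsq G U u <= N%:E)%E ->
  (forall t, 0 <= t <= 1 -> mass (G t) <= M) ->
  `|int_m (G t) (test_mx phi S t) - int_m A (test_mx phi S 0)| <=
    s / 2 * N + s^-1 / 2 * K * M.
Proof.
move=> np sS; have [cP dP] := C1b_test S np; set Phi := test_mx phi S in cP dP *.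
have sP : sym_field Phi by move=> t x _; rewrite /sym_mx /Phi linearZ/= sS.
have [K K0 HK] := rhs_bound cP; exists K => // A B G U u N M s t s0 t01.
move=> [nG G0 G1 L2 W] GN mM.
have I0 : 0 <= (0 : R) <= 1 by rewrite lexx ler01.
have -> : int_m A (Phi 0) = int_m (G 0) (Phi 0).
  by rewrite !int_mE (Jn_scale _ _ ler01 (pm_scale1 G0)) mul1r.
have := W Phi cP sP 0 t I0 t01.
have Z : int_time 0 t (lhs G Phi) = 0.
  apply/eqP; rewrite -normr_le0.
  apply: (@int_time_bound R 0 t _ (fun=> 0%E) 0 I0 t01) => [r r01|].
    rewrite /lhs (dP r r01) int_mE /Jn /Rintegral integral0_eq ?normr0// => x _.
    by rewrite /bil mulmx0 mul0mx mxtrace0.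
  by rewrite integral0.
rewrite -/(lhs G Phi) Z subr0 => ->.
have a0 : 0 <= s / 2 by rewrite divr_ge0// ltW.
have k0 : 0 <= s^-1 / 2 * K by rewrite mulr_ge0// divr_ge0// invr_ge0 ltW.
apply: (int_time_bound I0 t01 (fun r => HK G U u s r s0)).
apply: le_trans (@lint_En2_add R d G U u _ _ M a0 k0 mM) _.
by rewrite EFinD leeD2r// [leRHS]EFinM; apply: lee_wpmul2l; rewrite ?lee_fin.
Qed.

(** At a time of maximal mass [m], testing with the identity and [s = K + 1] gives
    [m <= mass A + (K + 1) N / 2 + m / 2], because [K / (K + 1) <= 1]; the last term is absorbed. *)
Lemma mass_path_bound : exists2 K : R, 0 <= K & forall A B G U u (N : R),
  admissible A B G U u -> (normsq G U u <= N%:E)%E ->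
  forall t, 0 <= t <= 1 -> mass (G t) <= 2 * mass A + K * N.
Proof.
have [K K0 HK] := @static_test_bound (fun=> 1) 1%:M (bC1_cst d 1) (trmx1 _ _).
exists (K + 1); first by lra.
move=> A B G U u N adm GN t t01.
have [nG _ _ _ _] := adm; have [c c01 Hc] := narrow_mass_max nG.
have s0 : 0 < K + 1 by lra.
apply: le_trans (Hc _ t01) _.
have := HK A B G U u N (mass (G c)) (K + 1) c s0 c01 adm GN Hc.
rewrite !mass_test => H; have {H} := le_trans (ler_norm _) H.
have : (K + 1)^-1 * K <= 1 by rewrite ler_pdivrMl// mulr1; lra.
have := mass_ge0 (G c); move: ((K + 1)^-1) (mass (G c)) => q m m0 q1.
have : q * K * m <= m by rewrite ler_piMl.
by rewrite [q / 2 * K]mulrAC; lra.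
Qed.

Lemma pm_eq_energy0 A B :
  (forall e : R, 0 < e -> exists G U u, admissible A B G U u /\ (normsq G U u <= e%:E)%E) ->
  pm_eq A B.
Proof.
move=> H; apply: pm_eq_int_scalar => phi np; apply/matrixP => i j.
have sS : sym_mx (delta_mx i j + delta_mx j i : 'M[R]_d).
  by rewrite /sym_mx linearD/= !trmx_delta addrC.
suff : 2 * int_scalar B phi i j = 2 * int_scalar A phi i j by lra.
rewrite -(int_scalar_test A phi i j 0) -(int_scalar_test B phi i j 1).
have [K K0 HK] := static_test_bound np sS; have [L L0 HL] := mass_path_bound.
apply/eqP; rewrite -subr_eq0 -normr_le0; apply/ler_addgt0Pr => e e0; rewrite add0r.
set D := 2 * mass A + L; have D0 : 0 <= D.
  by rewrite addr_ge0// mulr_ge0// mass_ge0.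
(* This makes [K D / s <= e], and an energy of at most [e / s] makes [s N <= e]; Young's inequality
   takes half of each. Keeping the energy below 1 makes [D] a bound for the mass along the path. *)
set s := K * D / e + 1; have s0 : 0 < s by rewrite ltr_wpDl// divr_ge0 ?mulr_ge0// ltW.
have [G [U [u [adm GN]]]] := H (Num.min 1 (e / s)) (ltac:(by rewrite lt_min ltr01 divr_gt0)).
set N := Num.min _ _ in GN; have N1 : N <= 1 by rewrite ge_min lexx.
have Ne : N <= e / s by rewrite ge_min lexx orbT.
have I1 : 0 <= (1 : R) <= 1 by rewrite ler01 lexx.
have mD t : 0 <= t <= 1 -> mass (G t) <= D.
  move=> t01; apply: le_trans (HL _ _ _ _ _ _ adm GN t t01) _.
  by rewrite lerD2l ler_piMr.
have := HK _ _ _ _ _ _ _ _ _ s0 I1 adm GN mD.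
have [_ _ G1 _ _] := adm.
have -> : int_m (G 1) (test_mx phi (delta_mx i j + delta_mx j i) 1) =
    int_m B (test_mx phi (delta_mx i j + delta_mx j i) 1).
  by rewrite !int_mE (Jn_scale _ _ ler01 (pm_scale1 G1)) mul1r.
move=> h; apply: le_trans h _.
have h1 : s * N <= e by rewrite -ler_pdivlMl// mulrC.
have h2 : s^-1 * (K * D) <= e.
  by rewrite ler_pdivrMl// -ler_pdivrMr// lerDl.
by move: (s^-1) h2 => q; lra.
Qed.

End LowerBound.

Section Distance.
Context (R : realType) (d : nat).
Local Notation C := ('cV[R]_d).
Implicit Types (A B D : psd_measure R d) (G : R -> psd_measure R d)
  (U : R -> C -> 'M[R]_d) (u : R -> C -> C) (a b : R).

Lemma dKB_ge0 A B : (0 <= dKB A B)%E.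
Proof. exact: sqrte_ge0. Qed.

Let sqrte_pow a : 0 <= a -> sqrte (a ^+ 2)%:E = a%:E.
Proof. by move=> a0; rewrite /= sqrtr_sqr ger0_norm. Qed.

Lemma dKB_le A B G U u a : 0 <= a -> admissible A B G U u ->
  (normsq G U u <= (a ^+ 2)%:E)%E -> (dKB A B <= a%:E)%E.
Proof.
move=> a0 adm H; rewrite -(sqrte_pow a0) /dKB lee_sqrt ?lee_fin ?sqr_ge0//.
by apply: le_trans H; apply: ereal_inf_lbound; exists G, U, u.
Qed.

(** The strict inequality leaves room for a path that nearly attains the infimum, whose existence as
    a minimum is never claimed. *)
Lemma dKB_lt A B a : (dKB A B < a%:E)%E ->
  exists G U u, admissible A B G U u /\ (normsq G U u <= (a ^+ 2)%:E)%E.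
Proof.
move=> H; have a0 : 0 <= a by rewrite -lee_fin (le_trans (dKB_ge0 A B))// ltW.
have [|_ [G [U [u [adm ->]]]] /ltW HG] := @ereal_inf_lt R
  [set c | exists G U u, admissible A B G U u /\ c = normsq G U u] (a ^+ 2)%:E.
  rewrite ltNge; apply/negP => K; move: H; rewrite ltNge => /negP; apply.
  rewrite -(sqrte_pow a0) /dKB lee_sqrt//.
  by apply: le_ereal_inf_tmp => _ [G [U [u [_ ->]]]]; exact: normsq_ge0.
by exists G, U, u.
Qed.

(* Time fractions proportional to the lengths [a] and [b] of the two pieces. *)
Lemma dKB_concat A B D G U u G' U' u' a b : 0 < a -> 0 < b ->
  admissible A B G U u -> (normsq G U u <= (a ^+ 2)%:E)%E ->
  admissible B D G' U' u' -> (normsq G' U' u' <= (b ^+ 2)%:E)%E ->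
  (dKB A D <= (a + b)%:E)%E.
Proof.
move=> a0 b0 p1 n1 p2 n2; have ab0 : 0 < a + b by exact: addr_gt0.
pose l := a / (a + b); have l01 : 0 < l < 1.
  by rewrite divr_gt0//= ltr_pdivrMr// mul1r ltrDl.
have l1E : 1 - l = b / (a + b) by rewrite /l; field; rewrite gt_eqF.
have G12 : pm_eq (G 1) (G' 0).
  by have [_ _ h1 _ _] := p1; have [_ h2 _ _ _] := p2 => i j X mX; rewrite h1// h2.
have [adm H] := admissible_glue l01 G12 p1 p2.
apply: (dKB_le (ltW ab0) adm); apply: le_trans H _.
(* This choice of [l] minimizes [a^2 / l + b^2 / (1 - l)], and the minimum is the square of the sum
   of the lengths. *)
have -> : (a + b) ^+ 2 = l^-1 * a ^+ 2 + (1 - l)^-1 * b ^+ 2.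
  by rewrite l1E /l; field; rewrite !gt_eqF.
rewrite EFinD; apply: leeD; rewrite EFinM; apply: lee_wpmul2l => //.
  by rewrite lee_fin invr_ge0 divr_ge0// ltW.
by rewrite l1E lee_fin invr_ge0 divr_ge0// ltW.
Qed.

Lemma path_to_zero A B : pm_scale 0 A B -> exists G U u a,
  [/\ 0 < a, admissible A B G U u & (normsq G U u <= (a ^+ 2)%:E)%E].
Proof.
move=> AB; have c01 : 0 <= (1 : R) <= 1 by rewrite lexx ler01.
(* With [k] the constant times the mass, the energy is at most [4 k]; [4 k + 1] has a larger square
   and is positive even for mass 0, as [dKB_concat] demands of a length. *)
exists (path_pm A 1), (path_mx 1), (@path_v R d), (4 * (kdim R d d * mass A) + 1).
have K0 : 0 <= kdim R d d * mass A by rewrite mulr_ge0 ?kdim_ge0 ?mass_ge0.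
split; first by lra.
  by apply: (admissible_scaling c01) => //; rewrite subrr expr0n.
apply: le_trans (path_normsq A c01) _; rewrite lee_fin expr1n mulr1.
by move: (_ * mass A) K0 => k k0; rewrite expr2; nra.
Qed.

Lemma dKB_fin A B : dKB A B \is a fin_num.
Proof.
pose Z := scale_pm (lexx 0) A.
have [G [U [u [a [a0 p1 n1]]]]] := path_to_zero (scale_pmP (lexx 0) A).
(* The zero measure, though built from [A], is also 0 times [B], so both paths end at the same
   [Z]. *)
have BZ : pm_scale 0 B Z by move=> i j X mX; rewrite (scale_pmP (lexx 0) A)// !mul0e.
have [G' [U' [u' [b [b0 p2 n2]]]]] := path_to_zero BZ.
have [G2 [U2 [u2 [p3 E]]]] := admissible_reverse p2; rewrite -E in n2.
rewrite ge0_fin_numE ?dKB_ge0//.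
exact: le_lt_trans (dKB_concat a0 b0 p1 n1 p3 n2) (ltry _).
Qed.

Lemma dKB_eq0 A B : dKB A B = 0%E <-> pm_eq A B.
Proof.
split=> [AB0|AB].
  apply: pm_eq_energy0 => e e0; have s0 : 0 < Num.sqrt e by rewrite sqrtr_gt0.
  have [|G [U [u [adm H]]]] := @dKB_lt A B (Num.sqrt e); first by rewrite AB0 lte_fin.
  by exists G, U, u; rewrite sqr_sqrtr ?(ltW e0)// in H.
(* With [c = 0] the scaling path is constant and its energy bound vanishes; it ends at [B] since [B]
   takes the same values on Borel sets as [A]. *)
have c01 : 0 <= (0 : R) <= 1 by rewrite lexx ler01.
apply/eqP; rewrite eq_le dKB_ge0 andbT; apply: (dKB_le (lexx 0)).
  apply: (admissible_scaling (G0 := A) c01) => //.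
  by rewrite subr0 expr1n; apply: pm_scale1 => i j X mX; rewrite AB.
by apply: le_trans (path_normsq A c01) _; rewrite expr0n/= mulr0 mul0r.
Qed.

Lemma dKB_sym_le A B : (dKB A B <= dKB B A)%E.
Proof.
rewrite -(fineK (dKB_fin B A)); apply/lee_addgt0Pr => e e0.
have H : (dKB B A < (fine (dKB B A) + e)%:E)%E.
  by rewrite -[ltLHS](fineK (dKB_fin B A)) lte_fin ltrDl.
have [G [U [u [adm n]]]] := dKB_lt H.
have [G' [U' [u' [adm' E]]]] := admissible_reverse adm.
apply: (dKB_le _ adm'); last by rewrite E.
by rewrite addr_ge0 ?fine_ge0 ?dKB_ge0 ?(ltW e0).
Qed.

Lemma dKB_triangle A B D : (dKB A D <= dKB A B + dKB B D)%E.
Proof.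
have H A' B' (e : R) : 0 < e -> (dKB A' B' < (fine (dKB A' B') + e)%:E)%E.
  by move=> e0; rewrite -[ltLHS](fineK (dKB_fin A' B')) lte_fin ltrDl.
rewrite -(fineK (dKB_fin A B)) -(fineK (dKB_fin B D)).
apply/lee_addgt0Pr => e e0; have e20 : 0 < e / 2 by rewrite divr_gt0.
have [G [U [u [p1 n1]]]] := dKB_lt (H A B _ e20).
have [G' [U' [u' [p2 n2]]]] := dKB_lt (H B D _ e20).
rewrite -!EFinD (_ : _ + _ = (fine (dKB A B) + e / 2) + (fine (dKB B D) + e / 2)); last first.
  by lra.
by apply: (dKB_concat _ _ p1 n1 p2 n2); rewrite ltr_wpDl// fine_ge0 ?dKB_ge0.
Qed.

End Distance.

Theorem theorem1 (R : realType) (d : nat) (hd : (0 < d)%N) :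
  [/\ forall G0 G1 : psd_measure R d,
        dKB G0 G1 \is a fin_num /\ (0 <= dKB G0 G1)%E,
      forall G0 G1 : psd_measure R d, dKB G0 G1 = 0%E <-> pm_eq G0 G1,
      forall G0 G1 : psd_measure R d, dKB G0 G1 = dKB G1 G0 &
      forall G0 G1 G2 : psd_measure R d,
        (dKB G0 G2 <= dKB G0 G1 + dKB G1 G2)%E].
Proof.
split.
- by move=> G0 G1; split; [exact: dKB_fin|exact: dKB_ge0].
- exact: dKB_eq0.
- by move=> G0 G1; apply/eqP; rewrite eq_le !dKB_sym_le.
- exact: dKB_triangle.
Qed.
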